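(* Let $H$ be a separable complex Hilbert space and let $T\in\mathcal{L}(H)$ be an essentially unitary $C_0$-contraction. Let $f\in H^\infty$. Then the following assertions are equivalent: (1) $T^nf(T)\to 0$ in operator norm as $n\to\infty$; (2) $f(T)$ is compact.
   Context: $\mathbb{D}$ is the open unit disk, $\mathcal{L}(H)$ the bounded operators on $H$. $H^\infty$ is the set of bounded holomorphic functions on $\mathbb{D}$. A contraction is an operator of norm at most $1$; it is completely nonunitary if it has no nonzero reducing subspace on which it acts as a unitary operator. A contraction $T$ on $H$ is a $C_0$-contraction if it is completely nonunitary and there is a nonzero $\theta\in H^\infty$ with $\theta(T)=0$. For a completely nonunitary contraction $T$ and $f\in H^\infty$, $f(T)$ is defined by the Sz.-Nagy--Foias $H^\infty$ functional calculus. A contraction $T$ is essentially unitary if $I_H-T^*T$ is compact, where $I_H$ is the identity on $H$. *)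

(* Defs.v *)
From mathcomp Require Import all_boot all_order all_algebra.
From mathcomp Require Import sesquilinear complex.
From mathcomp Require Import all_classical all_reals all_analysis.

Set Implicit Arguments.
Unset Strict Implicit.
Unset Printing Implicit Defensive.

Import Order.TTheory GRing.Theory Num.Theory.
Import numFieldNormedType.Exports.

Local Open Scope classical_set_scope.
Local Open Scope ring_scope.
Local Open Scope complex_scope.

(* R[i] as a structure, so that its normed topology is found by inference. *)
Definition Cplx (R : realType) : numClosedFieldType := R[i].

Section Hinfty.
Variable R : realType.

Definition disk : set (Cplx R) := ball 0 1.

Definition Hinfty (f : Cplx R -> Cplx R) : Prop :=
  (forall z, disk z -> derivable f z 1) /\ [bounded f z | z in disk].

Definition taylor_coef (f : Cplx R -> Cplx R) (k : nat) : Cplx R :=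
  derive1n k f 0 / k`!%:R.

End Hinfty.

Section Operators.
Variables (R : realType) (H : completeNormedModType (Cplx R)).

Definition separable : Prop := exists A : set H, countable A /\ dense A.

(* The norm of H takes its values in R[i] (nonnegative reals), hence Re. The
   value is +oo exactly when the linear map A is unbounded. *)
Definition op_norm (A : H -> H) : \bar R :=
  ereal_sup [set (complex.Re `|A x|)%:E | x in [set x : H | `|x| <= 1]].

Definition contraction (T : H -> H) : Prop := (op_norm T <= 1%:E)%E.

Definition compact_op (A : H -> H) : Prop :=
  precompact (A @` [set x : H | `|x| <= 1]).

(* f(rT) x, for 0 <= r < 1 *)
Definition dilated_calculus (T : H -> H) (f : Cplx R -> Cplx R) (r : R) (x : H) : H :=
  limn (fun N : nat =>
    \sum_(k < N) (taylor_coef f k * r%:C ^+ k) *: iter k T x).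

(* Sz.-Nagy--Foias: f(T) is the strong limit of f(rT) as r increases to 1; the
   limit exists for every completely nonunitary contraction T and f in Hinfty. *)
Definition calculus (T : H -> H) (f : Cplx R -> Cplx R) (x : H) : H :=
  lim (dilated_calculus T f r x @[r --> (1 : R)^'-]).

End Operators.

Section Hilbert.
Variables (R : realType) (H : completeNormedModType (Cplx R)).
Variable dot : {dot H for (@Num.conj (Cplx R))}.

(* dot is linear in its first argument *)
Definition hilbert_norm : Prop := forall x : H, `|x| ^+ 2 = dot x x.

(* By Riesz, the set below is a singleton when T is bounded. *)
Definition adjoint (T : H -> H) (y : H) : H :=
  xget 0 [set z | forall x, dot (T x) y = dot x z].

Definition closed_subspace (M : set H) : Prop :=
  [/\ closed M, M 0 & forall (a : Cplx R) x y, M x -> M y -> M (a *: x + y)].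

Definition reducing (T : H -> H) (M : set H) : Prop :=
  [/\ closed_subspace M, T @` M `<=` M & adjoint T @` M `<=` M].

Definition unitary_on (T : H -> H) (M : set H) : Prop :=
  (forall x y, M x -> M y -> dot (T x) (T y) = dot x y) /\ T @` M = M.

Definition completely_nonunitary (T : H -> H) : Prop :=
  forall M : set H, reducing T M -> unitary_on T M -> M = [set 0].

Definition C0_contraction (T : H -> H) : Prop :=
  [/\ contraction T, completely_nonunitary T &
    exists theta : Cplx R -> Cplx R,
      [/\ Hinfty theta, exists2 z, (disk z) & theta z != 0 &
          forall x, calculus T theta x = 0]].

Definition essentially_unitary (T : H -> H) : Prop :=
  compact_op (fun x => x - adjoint T (T x)).

End Hilbert.

(* Main.v *)
(** Write a_k for the Taylor coefficients of f, Ts for the adjoint of T and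
    D = 1 - Ts T, which is compact.

    Complete nonunitarity enters through one principle.  Let X be a closed
    subspace with T X <= X, with T^-1 X <= X, and containing the range of
    1 - T Ts.  On the orthogonal complement of X one has T Ts = 1, and the two
    stability conditions make T and Ts mutually inverse there, so that this
    complement reduces T to a unitary operator; hence X is the whole space.

    Vectors v = (1 - T Ts) y satisfy |sum b_k T^k v|^2 <= |y|^2 sum |b_k|^2, and
    <T^n v, z> -> 0, because the defects |u|^2 - |Ts u|^2 telescope along the
    orbits of Ts.  With the uniform bound |f(rT)| <= sup |f| (von Neumann), the
    principle then shows that f(rT) x converges as r increases to 1 for every x,
    so f(T) is a bounded operator commuting with T, and that T^n -> 0 weakly.

    If f(T) is compact, then T^n f(T) x = f(T) T^n x -> 0 in norm for each x, and
    uniformly on the unit ball since its image is totally bounded.  Conversely,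
    |w|^2 = |T w|^2 + <D w, w> shows that when T A is totally bounded up to e, so
    is A, up to any e' > e; iterating, A = f(T) is compact if T^n A -> 0.

    The bound on f(rT) and the square summability of (a_k) only depend on the
    partial sums of the Taylor series, which are controlled by Cauchy's formula;
    it is derived here from Goursat's theorem in polar coordinates. *)
Require Import Defs.
From mathcomp Require Import all_boot all_order all_algebra.
From mathcomp Require Import sesquilinear complex.
From mathcomp Require Import all_classical all_reals all_analysis.
From mathcomp Require cyclic separable cyclotomic.
From mathcomp Require Import ring lra.
Set Implicit Arguments.
Unset Strict Implicit.
Unset Printing Implicit Defensive.
Import Order.TTheory GRing.Theory Num.Theory.
Import numFieldNormedType.Exports.
Local Open Scope classical_set_scope.
Local Open Scope ring_scope.
Local Open Scope complex_scope.

(** * Real-valued norms *)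

Section RealNorm.
Variable R : realType.
Local Notation C := (Cplx R).

(** [calculus] is a [lim], so it says nothing until f(rT)x is known to converge. The principle drawn
    from complete nonunitarity asks for a set stable under preimages by T, and the identity f(rT)x =
    a_0 x + r g(rT)Tx that serves this purpose replaces f by its backward shift g. Convergence is
    therefore proved for all symbols at once, a symbol being a coefficient sequence whose partial
    sums are eventually bounded, by one constant, on each circle near the unit circle
    ([bounded_symbol]). This class is closed under the shift and is all that the complex analysis
    has to deliver.

    Von Neumann's inequality is reached without a unitary dilation. The form |u|^2 - |Su|^2 is
    nonnegative, telescopes along the orbits of S and, as a difference of squared norms, obeys
    Parseval over roots of unity; this replaces integration of vector-valued functions. A strict
    contraction is gained by writing r = s^2: one factor s goes to the variable of the polynomial,
    the other to sT. Constants are not sharp: only uniformity in r matters. *)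

Lemma real_complexI (a b : R) : (a%:C = b%:C :> C) -> a = b.
Proof. by case. Qed.

(** The norm lives in [R[i]], whose order is only partial. A copy in [R] has a total order and
    suprema, and is within reach of [lra]. *)
Definition rnorm (V : normedZmodType C) (x : V) : R := complex.Re `|x|.

Lemma rnormE (V : normedZmodType C) (x : V) : `|x| = (rnorm x)%:C.
Proof. by rewrite /rnorm RRe_real// normr_real. Qed.

Section Zmod.
Variable V : normedZmodType C.
Implicit Types x y a b : V.

Lemma rnorm_ge0 x : 0 <= rnorm x.
Proof. by have := normr_ge0 x; rewrite rnormE lecR. Qed.

Lemma rnorm0 : rnorm (0 : V) = 0.
Proof. by rewrite /rnorm normr0. Qed.

Lemma rnorm_eq0 x : (rnorm x == 0) = (x == 0).
Proof. by rewrite -[x == 0]normr_eq0 rnormE; apply/esym; apply/eqP/eqP => [/real_complexI//|->]. Qed.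

Lemma rnorm_gt0 x : (0 < rnorm x) = (x != 0).
Proof. by rewrite lt_def rnorm_ge0 andbT rnorm_eq0. Qed.

Lemma rnormN x : rnorm (- x) = rnorm x.
Proof. by rewrite /rnorm normrN. Qed.

Lemma rnormD x y : rnorm (x + y) <= rnorm x + rnorm y.
Proof. by have := ler_normD x y; rewrite !rnormE -rmorphD/= lecR. Qed.

Lemma rnormB x y : rnorm (x - y) <= rnorm x + rnorm y.
Proof. by rewrite -(rnormN y); exact: rnormD. Qed.

Lemma rdistC x y : rnorm (x - y) = rnorm (y - x).
Proof. by rewrite -rnormN opprB. Qed.

Lemma rdistD z x y : rnorm (x - y) <= rnorm (x - z) + rnorm (z - y).
Proof. by rewrite -[x - y](subrKA z); exact: rnormD. Qed.

Lemma rdist3 a b x y : rnorm (x - y) <= rnorm (a - x) + rnorm (a - b) + rnorm (b - y).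
Proof.
by rewrite [rnorm (a - x)]rdistC -addrA (le_trans (rdistD a x y))// lerD2l rdistD.
Qed.

Lemma rnorm_sum (I : Type) (r : seq I) (P : pred I) (F : I -> V) :
  rnorm (\sum_(i <- r | P i) F i) <= \sum_(i <- r | P i) rnorm (F i).
Proof.
apply: (big_ind2 (fun x s => rnorm x <= s)) => //; first by rewrite rnorm0.
by move=> x1 x2 y1 y2 h1 h2; apply: le_trans (rnormD _ _) (lerD h1 h2).
Qed.

Lemma rnorm_dist x y : `|rnorm x - rnorm y| <= rnorm (x - y).
Proof.
rewrite ler_norml; apply/andP; split.
  by have := rnormD (y - x) x; rewrite subrK rdistC; lra.
by have := rnormD (x - y) y; rewrite subrK; lra.
Qed.

End Zmod.

Lemma rnormZ (V : normedModType C) (a : C) (x : V) :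
  rnorm (a *: x) = rnorm a * rnorm x.
Proof. by apply: real_complexI; rewrite rmorphM/= -!rnormE normrZ. Qed.

Implicit Types (x y : C) (r : R).

Lemma rnormM x y : rnorm (x * y) = rnorm x * rnorm y.
Proof. by apply: real_complexI; rewrite rmorphM/= -!rnormE normrM. Qed.

Lemma rnorm1 : rnorm (1 : C) = 1.
Proof. by rewrite /rnorm normr1. Qed.

Lemma rnormV x : rnorm x^-1 = (rnorm x)^-1.
Proof. by apply: real_complexI; rewrite fmorphV/= -!rnormE normfV. Qed.

Lemma rnormX x n : rnorm (x ^+ n) = rnorm x ^+ n.
Proof. by elim: n => [|n IH]; rewrite ?expr0 ?rnorm1// !exprS rnormM IH. Qed.

Lemma rnormr r : rnorm (r%:C : C) = `|r|.
Proof. by rewrite /rnorm normc_def/= expr0n/= addr0 sqrtr_sqr. Qed.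

Lemma rnorm_sqr x : rnorm x ^+ 2 = complex.Re x ^+ 2 + complex.Im x ^+ 2.
Proof.
by rewrite /rnorm normc_def/= sqr_sqrtr// addr_ge0// sqr_ge0.
Qed.

Lemma Re_le_rnorm x : `|complex.Re x| <= rnorm x.
Proof.
rewrite -ler_sqr ?nnegrE ?rnorm_ge0// rnorm_sqr real_normK ?num_real//.
by rewrite lerDl sqr_ge0.
Qed.

Lemma Im_le_rnorm x : `|complex.Im x| <= rnorm x.
Proof.
rewrite -ler_sqr ?nnegrE ?rnorm_ge0// rnorm_sqr real_normK ?num_real//.
by rewrite lerDr sqr_ge0.
Qed.

Lemma rnorm_ReIm x : rnorm x <= `|complex.Re x| + `|complex.Im x|.
Proof.
rewrite -ler_sqr ?nnegrE ?rnorm_ge0 ?addr_ge0// rnorm_sqr sqrrD.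
rewrite !real_normK ?num_real//.
have : 0 <= `|complex.Re x| * `|complex.Im x| *+ 2 by rewrite mulrn_wge0// mulr_ge0.
lra.
Qed.

Lemma cvg_rnormP (V : normedModType C) (T : Type) (F : set_system T) {FF : Filter F}
    (u : T -> V) (l : V) :
  u @ F --> l <-> forall e : R, 0 < e -> \forall x \near F, rnorm (l - u x) <= e.
Proof.
split=> [/cvgrPdist_le H e e0|H].
  have /H : 0 < (e%:C : C) by rewrite ltcR.
  by apply: filterS => x; rewrite rnormE lecR.
apply/cvgrPdist_le => e e0.
have eE : e = (complex.Re e)%:C by rewrite RRe_real// ger0_real// ltW.
move: e0; rewrite eE ltcR => e0.
by apply: filterS (H _ e0) => x; rewrite rnormE lecR.
Qed.

Lemma near_rnorm (V : normedModType C) (l : V) (P : set V) :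
  (\forall x \near l, P x) <-> exists2 d : R, 0 < d & forall x : V, rnorm (x - l) <= d -> P x.
Proof.
split=> [/nbhs_ballP[e /= e0]|[d d0 H]].
  have eE : e = (complex.Re e)%:C by rewrite RRe_real// ger0_real// ltW.
  move: e0; rewrite eE ltcR => e0 H.
  exists (complex.Re e / 2); first by rewrite divr_gt0.
  move=> x xl; apply: H; rewrite -ball_normE /ball_ /= distrC rnormE ltcR.
  by apply: le_lt_trans xl _; lra.
apply/nbhs_ballP; exists (d%:C : C); first by rewrite /= ltcR.
move=> x; rewrite -ball_normE /ball_ /= distrC rnormE ltcR => /ltW; exact: H.
Qed.

End RealNorm.

(** * Goursat's theorem for divergence-free fields *)

Section Green.
Variable R : realType.
Implicit Types (f g : R -> R) (a b c : R).

Definition itg f a b : R := \int[@lebesgue_measure R]_(x in `[a, b]) f x.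

(** Continuity is two-sided even at the endpoints, so that it passes to subintervals without any
    argument. *)
Definition cont_on f a b := forall x, a <= x <= b -> {for x, continuous f}.

Lemma cont_on_integrable f a b : cont_on f a b ->
  (@lebesgue_measure R).-integrable `[a, b] (EFin \o f).
Proof.
move=> cf; apply: continuous_compact_integrable; first exact: segment_compact.
apply: continuous_in_subspaceT => x.
by rewrite inE/= in_itv/= => xab; exact: cf.
Qed.

Lemma itg_split f a b c : a <= b <= c -> cont_on f a c ->
  itg f a c = itg f a b + itg f b c.
Proof.
move=> /andP[ab bc] cf; rewrite /itg.
have intf := cont_on_integrable cf.
have := @Rintegral_itvB R f (BLeft a) (BRight c) b intf.
rewrite !bnd_simp => /(_ ab bc) H.
rewrite -(@Rintegral_itv_obnd_cbnd R b (BRight c) f).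
  by rewrite -H addrC subrK.
apply: integrableS intf => //; apply: subset_itvr; rewrite bnd_simp.
by apply: le_trans ab _.
Qed.

Lemma itgB f g a b : cont_on f a b -> cont_on g a b ->
  itg (fun x => f x - g x) a b = itg f a b - itg g a b.
Proof. by move=> cf cg; rewrite /itg RintegralB//; exact: cont_on_integrable. Qed.

Lemma itgD f g a b : cont_on f a b -> cont_on g a b ->
  itg (fun x => f x + g x) a b = itg f a b + itg g a b.
Proof. by move=> cf cg; rewrite /itg RintegralD//; exact: cont_on_integrable. Qed.

Lemma itgZ k f a b : cont_on f a b ->
  itg (fun x => k * f x) a b = k * itg f a b.
Proof. by move=> cf; rewrite /itg RintegralZl//; exact: cont_on_integrable. Qed.

Lemma eq_itg f g a b : (forall x, a <= x <= b -> f x = g x) -> itg f a b = itg g a b.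
Proof. by move=> fg; apply: eq_Rintegral => x; rewrite inE/= in_itv/=; exact: fg. Qed.

Lemma itg_cst k a b : a <= b -> itg (fun=> k) a b = k * (b - a).
Proof.
move=> ab; rewrite /itg Rintegral_cst//= lebesgue_measure_itv/= lte_fin.
by move: ab; rewrite le_eqVlt => /predU1P[->|->//]; rewrite ltxx subrr.
Qed.

Lemma le_itg f g a b : cont_on f a b -> cont_on g a b ->
  (forall x, a <= x <= b -> f x <= g x) -> itg f a b <= itg g a b.
Proof.
move=> cf cg fg; apply: le_Rintegral => //; try exact: cont_on_integrable.
Qed.

Lemma itg_near_cst f k K a b : a <= b -> cont_on f a b ->
  (forall x, a <= x <= b -> `|f x - k| <= K) ->
  `|itg f a b - k * (b - a)| <= K * (b - a).
Proof.
move=> ab cf fk.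
have cc (l : R) : cont_on (fun=> l) a b by move=> x _; exact: cvg_cst.
have H1 : itg f a b <= itg (fun=> k + K) a b.
  by apply: le_itg => // x /fk; rewrite ler_norml; lra.
have H2 : itg (fun=> k - K) a b <= itg f a b.
  by apply: le_itg => // x /fk; rewrite ler_norml; lra.
rewrite !itg_cst// in H1 H2.
by rewrite ler_norml; apply/andP; split; lra.
Qed.

(** Total differentiability at (s, t), with partial derivatives [p] and [q]. Nothing is asked of the
    derivatives at other points. *)
Definition diff2 (F : R -> R -> R) (s t p q : R) := forall e, 0 < e ->
  exists2 d, 0 < d & forall s' t', `|s' - s| <= d -> `|t' - t| <= d ->
    `|F s' t' - F s t - p * (s' - s) - q * (t' - t)| <= e * (`|s' - s| + `|t' - t|).

Lemma near_dist_le (x d : R) : 0 < d -> \forall y \near x, `|y - x| <= d.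
Proof. by move=> d0; apply/nbhs_ballP; exists d => // y; rewrite /ball/= distrC => /ltW. Qed.

Lemma diff2_contl F s t p q : diff2 F s t p q -> {for s, continuous (F^~ t)}.
Proof.
move=> H; apply/cvgrPdist_le => e e0.
have [d d0 {}H] := H 1 ltr01.
have k0 : 0 < 1 + `|p| by rewrite ltr_wpDr.
near=> x.
have xd : `|x - s| <= d.
  by near: x; exact: near_dist_le.
have := H x t xd; rewrite subrr normr0 mulr0 subr0 addr0 mul1r => /(_ (ltW d0)) Hx.
have xe : `|x - s| <= e / (1 + `|p|).
  by near: x; apply: near_dist_le; rewrite divr_gt0.
rewrite distrC; rewrite ler_pdivlMr// in xe; apply: le_trans xe.
have -> : F x t - F s t = (F x t - F s t - p * (x - s)) + p * (x - s) by ring.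
apply: (le_trans (ler_normD _ _)); rewrite normrM; lra.
Unshelve. all: by end_near. Qed.

Lemma diff2_sym F s t p q : diff2 F s t p q -> diff2 (fun x y => F y x) t s q p.
Proof.
move=> H e /H[d d0 {}H]; exists d => // t' s' ht hs; have := H s' t' hs ht.
rewrite [`|s' - s| + _]addrC; apply: le_trans; rewrite le_eqVlt; apply/orP; left.
by apply/eqP; congr `|_|; ring.
Qed.

Lemma diff2_contr F s t p q : diff2 F s t p q -> {for t, continuous (F s)}.
Proof. by move=> /diff2_sym /diff2_contl. Qed.

Lemma dist_itv a b x y : a <= x <= b -> a <= y <= b -> `|x - y| <= b - a.
Proof. by move=> /andP[? ?] /andP[? ?]; rewrite ler_norml; apply/andP; split; lra. Qed.

Lemma midpoint a b (c : R := (a + b) / 2) : a <= b ->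
  [/\ a <= c, c <= b, c - a = (b - a) / 2 & b - c = (b - a) / 2].
Proof. by rewrite /c => ab; split; lra. Qed.

Variables (u v : R -> R -> R) (S1 S2 T1 T2 : R).
Hypothesis uv : forall s t, S1 <= s <= S2 -> T1 <= t <= T2 ->
  exists p q r, diff2 u s t p q /\ diff2 v s t r p.

(** The outward flux of the field (u, -v) through the boundary of a rectangle. The [p] shared by the
    two halves of [uv] says that du/ds = dv/dt, which is the vanishing of the divergence. *)
Let flux s1 s2 t1 t2 :=
  itg (fun t => u s2 t - u s1 t) t1 t2 - itg (fun s => v s t2 - v s t1) s1 s2.

Let sub s1 s2 t1 t2 := [/\ S1 <= s1, s1 <= s2 & s2 <= S2] /\ [/\ T1 <= t1, t1 <= t2 & t2 <= T2].

Let cu s1 s2 t1 t2 : sub s1 s2 t1 t2 -> forall s, s1 <= s <= s2 -> cont_on (u s) t1 t2.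
Proof.
move=> [[a1 a2 a3] [b1 b2 b3]] s /andP[hs hs'] t /andP[ht ht'].
have [||p [q [r [H _]]]] := @uv s t _ _; [by apply/andP; split; lra..|].
exact: diff2_contr H.
Qed.

Let cv s1 s2 t1 t2 : sub s1 s2 t1 t2 -> forall t, t1 <= t <= t2 -> cont_on (v^~ t) s1 s2.
Proof.
move=> [[a1 a2 a3] [b1 b2 b3]] t /andP[hs hs'] s /andP[ht ht'].
have [||p [q [r [_ H]]]] := @uv s t _ _; [by apply/andP; split; lra..|].
exact: diff2_contl H.
Qed.

Let fluxE s1 s2 t1 t2 : sub s1 s2 t1 t2 -> flux s1 s2 t1 t2 =
  itg (u s2) t1 t2 - itg (u s1) t1 t2 - (itg (v^~ t2) s1 s2 - itg (v^~ t1) s1 s2).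
Proof.
move=> h; have [[? ? ?] [? ? ?]] := h.
rewrite /flux !itgB//; first [apply: (cu h) | apply: (cv h)]; apply/andP; split; lra.
Qed.

Let flux_quarters s1 s2 t1 t2 : sub s1 s2 t1 t2 ->
  let s := (s1 + s2) / 2 in let t := (t1 + t2) / 2 in
  flux s1 s2 t1 t2 = flux s1 s t1 t + flux s s2 t1 t + flux s1 s t t2 + flux s s2 t t2.
Proof.
move=> h s t; have [[? ? ?] [? ? ?]] := h.
rewrite !fluxE; try by split; split; rewrite /s /t; lra.
rewrite (@itg_split (u s1) t1 t t2); [|by rewrite /t; apply/andP; split; lra|by apply: (cu h); apply/andP; split; lra].
rewrite (@itg_split (u s2) t1 t t2); [|by rewrite /t; apply/andP; split; lra|by apply: (cu h); apply/andP; split; lra].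
rewrite (@itg_split (v^~ t1) s1 s s2); [|by rewrite /s; apply/andP; split; lra|by apply: (cv h); apply/andP; split; lra].
rewrite (@itg_split (v^~ t2) s1 s s2); [|by rewrite /s; apply/andP; split; lra|by apply: (cv h); apply/andP; split; lra].
ring.
Qed.

(** The threshold is quadratic in the side lengths: halving the sides divides it by four, the number
    of quarters. *)
Let bad e s1 s2 t1 t2 := e * ((s2 - s1) + (t2 - t1)) ^+ 2 < `|flux s1 s2 t1 t2|.

(** The four thresholds add up to that of the whole rectangle, so the quarters cannot all be good.
    The premises stand under the existential quantifier so that [choice] yields a total map, to be
    iterated. *)
Let bad_quarter e (x : R * R * R * R) : exists y : R * R * R * R,
  let: (s1, s2, t1, t2) := x in let: (s1', s2', t1', t2') := y in
  sub s1 s2 t1 t2 -> bad e s1 s2 t1 t2 ->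
  [/\ [/\ s1 <= s1', s1' <= s2' & s2' <= s2], [/\ t1 <= t1', t1' <= t2' & t2' <= t2],
     s2' - s1' = (s2 - s1) / 2, t2' - t1' = (t2 - t1) / 2 & bad e s1' s2' t1' t2'].
Proof.
move: x => [[[s1 s2] t1] t2].
have [[hs hb]|n] := pselect (sub s1 s2 t1 t2 /\ bad e s1 s2 t1 t2); last first.
  by exists (s1, s2, t1, t2) => ? ?; exfalso; apply: n.
have [[? ? ?] [? ? ?]] := hs.
pose s := (s1 + s2) / 2; pose t := (t1 + t2) / 2.
have E := flux_quarters hs; rewrite /= -/s -/t in E.
have [ss1 ss2 ss3 ss4] : [/\ s1 <= s, s <= s2, s - s1 = (s2 - s1) / 2 & s2 - s = (s2 - s1) / 2] by exact: midpoint.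
have [tt1 tt2 tt3 tt4] : [/\ t1 <= t, t <= t2, t - t1 = (t2 - t1) / 2 & t2 - t = (t2 - t1) / 2] by exact: midpoint.
have [b1|n1] := boolP (bad e s1 s t1 t).
  by exists (s1, s, t1, t) => _ _; do !split.
have [b2|n2] := boolP (bad e s s2 t1 t).
  by exists (s, s2, t1, t) => _ _; do !split.
have [b3|n3] := boolP (bad e s1 s t t2).
  by exists (s1, s, t, t2) => _ _; do !split.
have [b4|n4] := boolP (bad e s s2 t t2).
  by exists (s, s2, t, t2) => _ _; do !split.
move: n1 n2 n3 n4; rewrite /bad -!leNgt => n1 n2 n3 n4.
exfalso; move: hb; rewrite /bad ltNge => /negP; apply.
rewrite E; apply: (@le_trans _ _ (_ + _ + _ + _)).
  apply: le_trans (ler_normD _ _) _; apply: lerD; last exact: n4.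
  apply: le_trans (ler_normD _ _) _; apply: lerD; last exact: n3.
  apply: le_trans (ler_normD _ _) _; apply: lerD; [exact: n1|exact: n2].
by rewrite le_eqVlt; apply/orP; left; apply/eqP; rewrite /s /t; field.
Qed.

(** The affine part of the field contributes [p] times the area to both integrals and cancels. Each
    integrand is a difference of two values, each with remainder at most e/4 times [D], so the total
    error is at most e/2 times the square of [D]. *)
Let flux_small e s1 s2 t1 t2 : S1 <= s1 -> s2 <= S2 -> T1 <= t1 -> t2 <= T2 ->
  forall s t, s1 <= s <= s2 -> t1 <= t <= t2 -> 0 < e ->
  exists2 d, 0 < d & forall a1 a2 b1 b2, a1 <= s <= a2 -> b1 <= t <= b2 ->
    s1 <= a1 -> a2 <= s2 -> t1 <= b1 -> b2 <= t2 -> a2 - a1 <= d -> b2 - b1 <= d -> ~ bad e a1 a2 b1 b2.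
Proof.
move=> h1 h2 h3 h4 s t /andP[hs hs'] /andP[ht ht'] e0.
have [||p [q [r [Hu Hv]]]] := @uv s t; [by apply/andP; split; lra..|].
have e4 : 0 < e / 4 by lra.
have e2e : e / 2 <= e by lra.
have [d1 d10 {}Hu] := Hu _ e4; have [d2 d20 {}Hv] := Hv _ e4.
exists (Num.min d1 d2); first by rewrite lt_min d10.
move=> a1 a2 b1 b2 /andP[as1 as2] /andP[bt1 bt2] a1s a2s b1t b2t.
rewrite !le_min => /andP[ad1 ad2] /andP[bd1 bd2].
have a12 : a1 <= a2 := le_trans as1 as2; have b12 : b1 <= b2 := le_trans bt1 bt2.
rewrite /bad; apply/negP; rewrite -leNgt.
set D := (a2 - a1) + (b2 - b1).
have hsub : sub a1 a2 b1 b2.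
  by split; split=> //; [exact: le_trans a1s|exact: le_trans h2|exact: le_trans b1t|exact: le_trans h4].
have dA x : a1 <= x <= a2 -> `|x - s| <= a2 - a1.
  by move=> xa; apply: dist_itv => //; rewrite as1.
have dB x : b1 <= x <= b2 -> `|x - t| <= b2 - b1.
  by move=> xb; apply: dist_itv => //; rewrite bt1.
have D0 : 0 <= D by rewrite addr_ge0// subr_ge0.
have ia1 : a1 <= a1 <= a2 by rewrite lexx.
have ia2 : a1 <= a2 <= a2 by rewrite a12 lexx.
have ib1 : b1 <= b1 <= b2 by rewrite lexx.
have ib2 : b1 <= b2 <= b2 by rewrite b12 lexx.
have e24 : e / 2 * D = e / 4 * D + e / 4 * D by field.
have K1 : `|itg (fun y => u a2 y - u a1 y) b1 b2 - p * (a2 - a1) * (b2 - b1)| <= e / 2 * D * (b2 - b1).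
  apply: itg_near_cst; first exact: b12.
    move=> x xb; apply: continuousB; [exact: (cu hsub ia2)|exact: (cu hsub ia1)].
  move=> y yb.
  have A1 := Hu a1 y (le_trans (dA _ ia1) ad1) (le_trans (dB _ yb) bd1).
  have A2 := Hu a2 y (le_trans (dA _ ia2) ad1) (le_trans (dB _ yb) bd1).
  have B1 : e / 4 * (`|a1 - s| + `|y - t|) <= e / 4 * D.
    by rewrite ler_pM2l// lerD ?dA ?dB.
  have B2 : e / 4 * (`|a2 - s| + `|y - t|) <= e / 4 * D.
    by rewrite ler_pM2l// lerD ?dA ?dB.
  have -> : u a2 y - u a1 y - p * (a2 - a1) =
      (u a2 y - u s t - p * (a2 - s) - q * (y - t)) - (u a1 y - u s t - p * (a1 - s) - q * (y - t)) by ring.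
  by apply: le_trans (ler_normB _ _) _; rewrite e24; apply: lerD; [exact: le_trans A2 B2|exact: le_trans A1 B1].
have K2 : `|itg (fun x => v x b2 - v x b1) a1 a2 - p * (b2 - b1) * (a2 - a1)| <= e / 2 * D * (a2 - a1).
  apply: itg_near_cst; first exact: a12.
    move=> x xb; apply: continuousB; [exact: (cv hsub ib2)|exact: (cv hsub ib1)].
  move=> x xa.
  have A1 := Hv x b1 (le_trans (dA _ xa) ad2) (le_trans (dB _ ib1) bd2).
  have A2 := Hv x b2 (le_trans (dA _ xa) ad2) (le_trans (dB _ ib2) bd2).
  have B1 : e / 4 * (`|x - s| + `|b1 - t|) <= e / 4 * D.
    by rewrite ler_pM2l// lerD ?dA ?dB.
  have B2 : e / 4 * (`|x - s| + `|b2 - t|) <= e / 4 * D.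
    by rewrite ler_pM2l// lerD ?dA ?dB.
  have -> : v x b2 - v x b1 - p * (b2 - b1) =
      (v x b2 - v s t - r * (x - s) - p * (b2 - t)) - (v x b1 - v s t - r * (x - s) - p * (b1 - t)) by ring.
  by apply: le_trans (ler_normB _ _) _; rewrite e24; apply: lerD; [exact: le_trans A2 B2|exact: le_trans A1 B1].
have : e / 2 * D * (b2 - b1) + e / 2 * D * (a2 - a1) <= e * D ^+ 2.
  have -> : e / 2 * D * (b2 - b1) + e / 2 * D * (a2 - a1) = e / 2 * D ^+ 2 by rewrite /D; ring.
  by rewrite ler_wpM2r ?sqr_ge0.
apply: le_trans; apply: le_trans (lerD K1 K2).
rewrite /flux.
set X := itg _ _ _; set Y := itg _ _ _.
have -> : X - Y = (X - p * (a2 - a1) * (b2 - b1)) - (Y - p * (b2 - b1) * (a2 - a1)) by ring.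
exact: ler_normB.
Qed.

(* Goursat's bisection: the flux of a differentiable divergence-free field,
   not assumed to have continuous derivatives. *)
Lemma divergence_free_flux : S1 <= S2 -> T1 <= T2 ->
  itg (fun t => u S2 t - u S1 t) T1 T2 = itg (fun s => v s T2 - v s T1) S1 S2.
Proof.
move=> S12 T12; apply/eqP; rewrite -subr_eq0 -/(flux _ _ _ _) -normr_le0.
pose L := (S2 - S1) + (T2 - T1).
suff H e : 0 < e -> `|flux S1 S2 T1 T2| <= e * L ^+ 2.
  apply/ler_addgt0Pr => e e0; rewrite add0r.
  have h : 0 < e / (L ^+ 2 + 1) by rewrite divr_gt0// ltr_wpDl ?sqr_ge0.
  apply: le_trans (H _ h) _; rewrite -mulrA ler_piMr ?(ltW e0)//.
  by rewrite mulrC ler_pdivrMr ?mul1r; have := sqr_ge0 L; lra.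
move=> e0; rewrite leNgt; apply/negP => B0.
have [next Hnext] := choice (bad_quarter e).
pose Q n := iter n next (S1, S2, T1, T2).
pose s1 n := (Q n).1.1.1; pose s2 n := (Q n).1.1.2; pose t1 n := (Q n).1.2; pose t2 n := (Q n).2.
have QE n : Q n = (s1 n, s2 n, t1 n, t2 n) by rewrite /s1 /s2 /t1 /t2; case: (Q n) => [[[? ?] ?] ?].
have P n : [/\ sub (s1 n) (s2 n) (t1 n) (t2 n), bad e (s1 n) (s2 n) (t1 n) (t2 n),
    s2 n - s1 n = (S2 - S1) / 2 ^+ n & t2 n - t1 n = (T2 - T1) / 2 ^+ n].
  elim: n => [|n [IH1 IH2 IH3 IH4]].
    by rewrite /s1 /s2 /t1 /t2 /= expr0 !divr1; split.
  have := Hnext (Q n); rewrite {1}QE -[next (Q n)]/(Q n.+1) QE => /(_ IH1 IH2).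
  move=> [[x1 x2 x3] [y1 y2 y3] z1 z2 z3].
  have [[u1 _ u3] [v1 _ v3]] := IH1.
  split => //.
  - by split; split=> //; [exact: le_trans x1|exact: le_trans u3|exact: le_trans y1|exact: le_trans v3].
  - by rewrite z1 IH3 exprS invfM; ring.
  - by rewrite z2 IH4 exprS invfM; ring.
have M n : [/\ [/\ s1 n <= s1 n.+1, s1 n.+1 <= s2 n.+1 & s2 n.+1 <= s2 n],
    [/\ t1 n <= t1 n.+1, t1 n.+1 <= t2 n.+1 & t2 n.+1 <= t2 n]
    & True].
  have [IH1 IH2 _ _] := P n.
  by have := Hnext (Q n); rewrite {1}QE -[next (Q n)]/(Q n.+1) QE => /(_ IH1 IH2)[].
have mono (w : nat -> R) : (forall n, w n <= w n.+1) -> forall m n, (m <= n)%N -> w m <= w n.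
  move=> hw m n /subnKC <-; elim: (n - m)%N => [|k]; first by rewrite addn0.
  by move=> /le_trans; apply; rewrite addnS.
have common (a b : nat -> R) : (forall n, a n <= a n.+1) -> (forall n, b n.+1 <= b n) -> (forall n, a n <= b n) ->
    exists c, forall n, a n <= c <= b n.
  move=> ha hb hab.
  have up : forall m n, a m <= b n.
    move=> m n; have h1 := mono _ ha _ _ (leq_maxl m n).
    have := @mono (fun n => - b n) _ _ _ (leq_maxr m n); rewrite lerN2 => h2.
    by apply: le_trans h1 _; apply: le_trans (hab _) _; apply: h2 => k; rewrite lerN2.
  have hs : has_sup (range a).
    by split; [exists (a 0%N); exists 0%N|exists (b 0%N) => _ [n _ <-]; exact: up].
  exists (sup (range a)) => n; apply/andP; split; first by apply: sup_upper_bound => //; exists n.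
  by apply: ge_sup => //; [exists (a 0%N); exists 0%N|move=> _ [m _ <-]; exact: up].
have [sl Hs] : exists c, forall n, s1 n <= c <= s2 n.
  apply: common => n; [by have [[? ? ?] _ _] := M n|by have [[? ? ?] _ _] := M n|by have [[[? ? ?] _] _ _] := P n].
have [tl Ht] : exists c, forall n, t1 n <= c <= t2 n.
  apply: common => n; [by have [_ [? ? ?] _] := M n|by have [_ [? ? ?] _] := M n|by have [[_ [? ? ?]] _ _] := P n].
have [d d0 Hd] := @flux_small e S1 S2 T1 T2 (lexx _) (lexx _) (lexx _) (lexx _) sl tl (Hs 0%N) (Ht 0%N) e0.
have [n Hn] : exists n : nat, L <= d * 2 ^+ n.
  have := @cvg_geometric R L (2^-1); rewrite ger0_norm ?invr_ge0// invf_lt1 ?ltr1n//.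
  move=> /(_ erefl) /cvgrPdist_lt /(_ d d0) [N _ /(_ N (leqnn N))] /=.
  rewrite sub0r normrN /geometric /= exprVn => h; exists N.
  by rewrite -ler_pdivrMr ?exprn_gt0//; apply: ltW (le_lt_trans (ler_norm _) h).
have [[[? ? ?] [? ? ?]] Hb E1 E2] := P n.
have p2 : 0 < 2 ^+ n :> R by rewrite exprn_gt0.
apply: (Hd _ _ _ _ (Hs n) (Ht n)) Hb => //.
  by rewrite E1 ler_pdivrMr//; apply: le_trans Hn; rewrite /L; lra.
by rewrite E2 ler_pdivrMr//; apply: le_trans Hn; rewrite /L; lra.
Qed.

End Green.

(** * Cauchy's formula *)

Section Polar.
Variable R : realType.
Local Notation C := (Cplx R).
Implicit Types (F G : R -> R -> R) (f : R -> R) (s t : R).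

Lemma derive_eps f s d : is_derive s (1 : R) f d -> forall e, 0 < e ->
  exists2 k, 0 < k & forall x, `|x - s| <= k -> `|f x - f s - d * (x - s)| <= e * `|x - s|.
Proof.
move=> [df fE] e e0.
have : (fun h : R => h^-1 *: (f (h *: 1 + s) - f s)) @ 0^' --> d.
  by rewrite -fE.
move=> /cvgrPdist_le /(_ e e0); rewrite near_withinE => /nbhs_ballP[k /= k0 H].
exists (k / 2); first by rewrite divr_gt0.
move=> x xs; have [->|xs0] := eqVneq x s; first by rewrite !subrr mulr0 subrr normr0 mulr0.
have hk : ball (0 : R) k (x - s).
  by rewrite -ball_normE/= sub0r normrN; apply: le_lt_trans xs _; lra.
have x0 : x - s != 0 by rewrite subr_eq0.
have := H _ hk x0; rewrite /= /GRing.scale/= mulr1 subrK.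
move=> /(ler_wpM2l (normr_ge0 (x - s))); rewrite -normrM [_ * e]mulrC.
apply: le_trans; rewrite -normrN le_eqVlt; apply/orP; left; apply/eqP; congr `|_|.
by field.
Qed.

Lemma diff2_fst f s t d : is_derive s (1 : R) f d -> diff2 (fun x _ => f x) s t d 0.
Proof.
move=> fd e e0; have [k k0 H] := derive_eps fd e0; exists k => // s' t' hs ht.
rewrite mul0r subr0; apply: le_trans (H _ hs) _.
by rewrite mulrDr lerDl mulr_ge0// ltW.
Qed.

Lemma diff2_snd f s t d : is_derive t (1 : R) f d -> diff2 (fun _ x => f x) s t 0 d.
Proof. by move=> /(diff2_fst s) /diff2_sym. Qed.

Lemma diff2M F G s t p q p' q' : diff2 F s t p q -> diff2 G s t p' q' ->
  diff2 (fun x y => F x y * G x y) s t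
    (p * G s t + F s t * p') (q * G s t + F s t * q').
Proof.
move=> dF dG e e0.
(* The error splits below as (remainder of F) G' + (linear part of F)(G' - G) + F (remainder of G).
   [K] dominates the sum of the factors met there, so the whole is at most a K N, with a K <= e. *)
pose K := 1 + `|G s t| + `|F s t| + `|p| + `|q| + `|p'| + `|q'|.
have K1 : 1 <= K.
  rewrite /K; have := normr_ge0 (G s t); have := normr_ge0 (F s t).
  have := normr_ge0 p; have := normr_ge0 q; have := normr_ge0 p'; have := normr_ge0 q'; lra.
have K0 : 0 < K by lra.
pose a := Num.min 1 (e / K).
have a0 : 0 < a by rewrite lt_min ltr01 divr_gt0.
have a1 : a <= 1 by rewrite ge_min lexx.
have aK : a * K <= e by rewrite -ler_pdivlMr// ge_min lexx orbT.
have [k1 k10 HF] := dF _ a0; have [k2 k20 HG] := dG _ a0.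
exists (Num.min (a / (2 * K)) (Num.min k1 k2)).
  by rewrite !lt_min k10 k20 divr_gt0// mulr_gt0.
move=> s' t'; rewrite !le_min => /and3P[hs1 hs2 hs3] /and3P[ht1 ht2 ht3].
have {}HF := HF _ _ hs2 ht2; have {}HG := HG _ _ hs3 ht3.
set N := `|s' - s| + `|t' - t|.
have N0 : 0 <= N by rewrite addr_ge0.
have NK : N * K <= a.
  have : N <= a / K.
    have -> : a / K = a / (2 * K) + a / (2 * K) by field; rewrite lt0r_neq0.
    exact: lerD.
  by rewrite ler_pdivlMr.
have dlin (x y : R) : `|x * (s' - s) + y * (t' - t)| <= (`|x| + `|y|) * N.
  apply: le_trans (ler_normD _ _) _; rewrite !normrM /N.
  rewrite mulrDl; apply: lerD; rewrite ler_wpM2l//.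
    by rewrite lerDl.
  by rewrite lerDr.
have dG' : `|G s' t' - G s t| <= a.
  have -> : G s' t' - G s t = (G s' t' - G s t - p' * (s' - s) - q' * (t' - t)) + (p' * (s' - s) + q' * (t' - t)) by ring.
  apply: le_trans (ler_normD _ _) _; apply: le_trans (lerD HG (dlin _ _)) _.
  apply: le_trans NK; rewrite -/N -mulrDl mulrC ler_wpM2l// /K.
  have := normr_ge0 (G s t); have := normr_ge0 (F s t).
  have := normr_ge0 p; have := normr_ge0 q; lra.
have G' : `|G s' t'| <= `|G s t| + 1.
  have -> : G s' t' = G s t + (G s' t' - G s t) by ring.
  apply: le_trans (ler_normD _ _) _; lra.
have -> : F s' t' * G s' t' - F s t * G s t - (p * G s t + F s t * p') * (s' - s) - (q * G s t + F s t * q') * (t' - t)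
  = (F s' t' - F s t - p * (s' - s) - q * (t' - t)) * G s' t'
    + (p * (s' - s) + q * (t' - t)) * (G s' t' - G s t)
    + F s t * (G s' t' - G s t - p' * (s' - s) - q' * (t' - t)) by ring.
apply: (@le_trans _ _ (a * K * N)); last by rewrite ler_wpM2r.
have -> : a * K * N = (a * N) * (`|G s t| + 1) + (`|p| + `|q|) * N * a + `|F s t| * (a * N) + (a * N) * (`|p'| + `|q'|).
  by rewrite /K; ring.
rewrite -[leLHS]addr0; apply: lerD; last by rewrite !mulr_ge0// ?addr_ge0// ltW.
apply: le_trans (ler_normD _ _) _; apply: lerD; last first.
  by rewrite normrM ler_wpM2l.
apply: le_trans (ler_normD _ _) _; rewrite !normrM; apply: lerD.
  by apply: ler_pM.
by apply: ler_pM.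
Qed.

(** Complex differentiability in remainder form, the shape in which [cdiff_chain] composes it with
    two real coordinates. *)
Definition cdiff (phi : C -> C) (z D : C) := forall e : R, 0 < e ->
  exists2 d : R, 0 < d & forall h : C, rnorm h <= d ->
    rnorm (phi (z + h) - phi z - D * h) <= e * rnorm h.

Lemma cdiff_continuous phi z D : cdiff phi z D -> {for z, continuous phi}.
Proof.
move=> H; apply/(cvg_rnormP (V := C) (F := nbhs (z : C))) => e e0; apply/(near_rnorm (V := C)).
have [d d0 {}H] := H 1 ltr01.
have k0 : 0 < 1 + rnorm D by rewrite ltr_wpDr// rnorm_ge0.
exists (Num.min d (e / (1 + rnorm D))); first by rewrite lt_min d0 divr_gt0.
move=> x; rewrite le_min ler_pdivlMr// => /andP[xd xe].
have := H _ xd; rewrite mul1r [z + _]addrC subrK => Hx; rewrite rdistC.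
have -> : phi x - phi z = (phi x - phi z - D * (x - z)) + D * (x - z) by ring.
apply: le_trans (rnormD _ _) _; rewrite rnormM; lra.
Qed.

Lemma cdiffZ k phi z D : cdiff phi z D -> cdiff (fun x => k * phi x) z (k * D).
Proof.
move=> H e e0.
have k0 : 0 < 1 + rnorm k by rewrite ltr_wpDr// rnorm_ge0.
have [|d d0 {}H] := H (e / (1 + rnorm k)); first by rewrite divr_gt0.
exists d => // h hd; have {}H := H h hd.
have -> : k * phi (z + h) - k * phi z - k * D * h = k * (phi (z + h) - phi z - D * h) by ring.
rewrite rnormM; apply: (@le_trans _ _ (rnorm k * (e / (1 + rnorm k) * rnorm h))).
  by rewrite ler_wpM2l ?rnorm_ge0.
rewrite mulrA ler_wpM2r ?rnorm_ge0// mulrCA ler_piMr ?(ltW e0)//.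
by rewrite ler_pdivrMr// mul1r; lra.
Qed.

Lemma derivable_cdiff (phi : C -> C) z : derivable phi z 1 -> exists D, cdiff phi z D.
Proof.
move=> dphi; exists ('D_1 phi z) => e e0.
have : (fun h : C => h^-1 *: (phi (h *: 1 + z) - phi z)) @ 0^' --> 'D_1 phi z by [].
move=> /(cvg_rnormP (V := C) (F := (0 : C)^')) /(_ e e0); rewrite near_withinE => /(near_rnorm (V := C))[d d0 H].
exists d => // h hd; have [->|h0] := eqVneq h 0.
  by rewrite addr0 subrr mulr0 subrr rnorm0 mulr0.
rewrite -{1}(subr0 h) in hd.
have := H h hd h0; rewrite /GRing.scale/= mulr1 => {}H.
have := ler_wpM2l (rnorm_ge0 h) H; rewrite -rnormM [_ * e]mulrC.
apply: le_trans; rewrite -rnormN [h + z]addrC le_eqVlt; apply/orP; left; apply/eqP; congr rnorm.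
by field.
Qed.

Lemma cdiff_cvg phi z D : cdiff phi z D ->
  (fun h : C => h^-1 *: (phi (h *: 1 + z) - phi z)) @ 0^' --> D.
Proof.
move=> H; apply/(cvg_rnormP (V := C) (F := (0 : C)^')) => e e0.
rewrite near_withinE; apply/(near_rnorm (V := C)).
have [d d0 {}H] := H e e0; exists d => // h; rewrite subr0 => hd h0.
have h0' : 0 < rnorm h by rewrite rnorm_gt0.
rewrite /GRing.scale/= mulr1 -(ler_pM2r h0') -rnormM [h + z]addrC.
have -> : (D - h^-1 * (phi (z + h) - phi z)) * h = - (phi (z + h) - phi z - D * h) by field.
by rewrite rnormN; exact: H.
Qed.

Lemma cdiff_derive1 (phi : C -> C) z D : cdiff phi z D -> derive1 phi z = D.
Proof. by move=> /cdiff_cvg h; rewrite derive1E; exact: cvg_lim h. Qed.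

Lemma cdiff_derivable phi z D : cdiff phi z D -> derivable phi z 1.
Proof. by move=> /cdiff_cvg h; apply/cvg_ex; exists D. Qed.

Lemma cdiff_chain phi z D F G s t p q p' q' : z = F s t +i* G s t :> C ->
  cdiff phi z D -> diff2 F s t p q -> diff2 G s t p' q' ->
  forall e, 0 < e -> exists2 d, 0 < d & forall s' t', `|s' - s| <= d -> `|t' - t| <= d ->
   rnorm (phi (F s' t' +i* G s' t' : C) - phi z - D * (p +i* p' : C) * (s' - s)%:C
      - D * (q +i* q' : C) * (t' - t)%:C) <= e * (`|s' - s| + `|t' - t|).
Proof.
move=> zE dphi dF dG e e0.
set A : C := p +i* p'; set B : C := q +i* q'.
pose K := 2 + rnorm A + rnorm B + 2 * rnorm D.
have K2 : 2 <= K.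
  by rewrite /K; have := rnorm_ge0 A; have := rnorm_ge0 B; have := rnorm_ge0 D; lra.
have K0 : 0 < K by lra.
pose a := Num.min 1 (e / K).
have a0 : 0 < a by rewrite lt_min ltr01 divr_gt0.
have a1 : a <= 1 by rewrite ge_min lexx.
have aK : a * K <= e by rewrite -ler_pdivlMr// ge_min lexx orbT.
have [k1 k10 HF] := dF _ a0; have [k2 k20 HG] := dG _ a0; have [k3 k30 Hp] := dphi _ a0.
exists (Num.min (k3 / (2 * K)) (Num.min k1 k2)).
  by rewrite !lt_min k10 k20 divr_gt0// mulr_gt0.
move=> s' t'; rewrite !le_min => /and3P[hs1 hs2 hs3] /and3P[ht1 ht2 ht3].
have {}HF := HF _ _ hs2 ht2; have {}HG := HG _ _ hs3 ht3.
set N := `|s' - s| + `|t' - t| in HF HG *.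
have N0 : 0 <= N by rewrite addr_ge0.
have NK : N * K <= k3.
  have : N <= k3 / K.
    have -> : k3 / K = k3 / (2 * K) + k3 / (2 * K) by field; rewrite lt0r_neq0.
    exact: lerD.
  by rewrite ler_pdivlMr.
pose h : C := (F s' t' +i* G s' t') - z.
pose r : C := h - A * (s' - s)%:C - B * (t' - t)%:C.
have hr : rnorm r <= 2 * a * N.
  have -> : r = (F s' t' - F s t - p * (s' - s) - q * (t' - t)) +i*
     (G s' t' - G s t - p' * (s' - s) - q' * (t' - t)).
    rewrite /r /h /A /B zE; apply/eqP; rewrite eq_complex/=; apply/andP; split; apply/eqP; ring.
  by apply: le_trans (rnorm_ReIm _) _ => /=; lra.
have hh : rnorm h <= (rnorm A + rnorm B + 2 * a) * N.
  have -> : h = A * (s' - s)%:C + B * (t' - t)%:C + r by rewrite /r; ring.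
  rewrite mulrDl; apply: le_trans (rnormD _ _) _; apply: lerD => //.
  apply: le_trans (rnormD _ _) _; rewrite !rnormM !rnormr mulrDl; apply: lerD.
    by rewrite ler_wpM2l ?rnorm_ge0// /N lerDl.
  by rewrite ler_wpM2l ?rnorm_ge0// /N lerDr.
have hK : rnorm h <= k3.
  apply: le_trans hh _; apply: le_trans NK; rewrite mulrC ler_wpM2l// /K.
  by have := rnorm_ge0 D; lra.
have := Hp _ hK; rewrite /h [z + _]addrC subrK -/h => {}Hp.
have -> : phi (F s' t' +i* G s' t') - phi z - D * A * (s' - s)%:C - D * B * (t' - t)%:C
  = (phi (F s' t' +i* G s' t') - phi z - D * h) + D * r by rewrite /r; ring.
apply: le_trans (rnormD _ _) _; rewrite rnormM.
apply: (@le_trans _ _ (a * K * N)); last by rewrite ler_wpM2r.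
apply: (@le_trans _ _ (a * ((rnorm A + rnorm B + 2 * a) * N) + rnorm D * (2 * a * N))).
  apply: lerD; first by apply: le_trans Hp _; rewrite ler_wpM2l// ltW.
  by rewrite ler_wpM2l ?rnorm_ge0.
have -> : a * ((rnorm A + rnorm B + 2 * a) * N) + rnorm D * (2 * a * N) =
  a * (rnorm A + rnorm B + 2 * a + 2 * rnorm D) * N by ring.
rewrite ler_wpM2r// ler_wpM2l ?(ltW a0)// /K; lra.
Qed.

Definition polar (r t : R) : C := (r * cos t) +i* (r * sin t).

Lemma rnorm_polar r t : rnorm (polar r t) = `|r|.
Proof.
apply/eqP; rewrite -(@eqrXn2 _ 2)// ?rnorm_ge0// rnorm_sqr/= !exprMn -mulrDr.
by rewrite cos2Dsin2 mulr1 real_normK ?num_real.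
Qed.

Lemma polarM r t : polar r t = r%:C * polar 1 t.
Proof.
by rewrite /polar; apply/eqP; rewrite eq_complex/= !mul1r !mul0r subr0 addr0 !eqxx.
Qed.

Lemma polar_2pi r : polar r (2 * pi) = polar r 0.
Proof. by rewrite /polar mulr_natl cos2pi sin2pi cos0 sin0. Qed.

(** The Cauchy-Riemann equations in polar coordinates: with A = D e^{it}, the derivative of phi(r
    e^{it}) is A in r and i r A in t. *)
Lemma polar_diff2 phi r t D : cdiff phi (polar r t) D ->
  diff2 (fun r t => complex.Re (phi (polar r t))) r t
      (complex.Re (D * polar 1 t)) (- (r * complex.Im (D * polar 1 t))) /\
  diff2 (fun r t => complex.Im (phi (polar r t))) r t
      (complex.Im (D * polar 1 t)) (r * complex.Re (D * polar 1 t)).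
Proof.
move=> dphi.
have dr : diff2 (fun x _ => x) r t 1 0 by apply: (@diff2_fst id); exact: is_derive_id.
have dc : diff2 (fun x y => x * cos y) r t (1 * cos t + r * 0) (0 * cos t + r * - sin t).
  by apply: diff2M dr _; apply: diff2_snd.
have ds : diff2 (fun x y => x * sin y) r t (1 * sin t + r * 0) (0 * sin t + r * cos t).
  by apply: diff2M dr _; apply: diff2_snd.
have H := @cdiff_chain phi (polar r t) D (fun x y => x * cos y) (fun x y => x * sin y) r t _ _ _ _ erefl dphi dc ds.
split=> e /H[d d0 {}H]; exists d => // s' t' hs ht; apply: le_trans (H _ _ hs ht).
  apply: le_trans (Re_le_rnorm _); rewrite le_eqVlt; apply/orP; left; apply/eqP; congr `|_|.
  rewrite -/(polar s' t'); move: (phi _) (phi _) => [a b] [a' b']; case: D {dphi H} => x y /=.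
  ring.
apply: le_trans (Im_le_rnorm _); rewrite le_eqVlt; apply/orP; left; apply/eqP; congr `|_|.
rewrite -/(polar s' t'); move: (phi _) (phi _) => [a b] [a' b']; case: D {dphi H} => x y /=.
ring.
Qed.

(** Dividing the imaginary part by r turns the polar Cauchy-Riemann equations into the divergence
    condition. The sides t = 0 and t = 2 pi of the rectangle carry the same values, so their
    contributions cancel. *)
Lemma annulus_itg_Re phi a b r1 r2 : 0 <= a -> a < r1 -> r1 <= r2 -> r2 < b ->
  (forall z, a < rnorm z < b -> exists D, cdiff phi z D) ->
  itg (fun t => complex.Re (phi (polar r2 t)) - complex.Re (phi (polar r1 t))) 0 (2 * pi) = 0.
Proof.
move=> a0 ar1 r12 r2b Hphi.
rewrite (@divergence_free_flux R (fun r t => complex.Re (phi (polar r t)))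
  (fun r t => complex.Im (phi (polar r t)) * r^-1)) //.
- rewrite (_ : (fun _ => _) = fun=> 0) ?itg_cst ?mul0r//.
  by apply: funext => s; rewrite polar_2pi subrr.
- move=> r t /andP[hr1 hr2] _.
  have r0 : 0 < r by apply: lt_le_trans hr1; apply: le_lt_trans ar1.
  have [|D dD] := Hphi (polar r t).
    by rewrite rnorm_polar gtr0_norm// (lt_le_trans ar1)// (le_lt_trans _ r2b).
  have [h1 h2] := polar_diff2 dD.
  do 3!eexists; split; first exact: h1.
  have -> : complex.Re (D * polar 1 t) = (r * complex.Re (D * polar 1 t)) * r^-1 + complex.Im (phi (polar r t)) * 0.
    by field; rewrite lt0r_neq0.
  apply: diff2M h2 _; apply: (@diff2_fst (fun x : R => x^-1)).
  by apply: is_deriveV; rewrite lt0r_neq0.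
- by rewrite mulr_ge0// pi_ge0.
Qed.

End Polar.

(** * Means over circles, and how they depend on the radius *)

Section Mean.
Variable R : realType.
Local Notation C := (Cplx R).
Implicit Types (g h : R -> C) (f phi : C -> C) (r t a b : R) (z w D : C).

Lemma continuous_complexP g :
  continuous g <-> continuous (fun t => complex.Re (g t)) /\ continuous (fun t => complex.Im (g t)).
Proof.
split=> [cg|[cr ci] t].
  split=> t; apply/cvgrPdist_le => e e0.
    move: (cg t) => /(cvg_rnormP (V := C) (F := nbhs (t : R))) /(_ e e0).
    apply: filterS => x; apply: le_trans.
    have -> : complex.Re (g t) - complex.Re (g x) = complex.Re (g t - g x).
      by case: (g t) (g x) => ? ? [].
    exact: Re_le_rnorm.
  move: (cg t) => /(cvg_rnormP (V := C) (F := nbhs (t : R))) /(_ e e0).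
  apply: filterS => x; apply: le_trans.
  have -> : complex.Im (g t) - complex.Im (g x) = complex.Im (g t - g x).
    by case: (g t) (g x) => ? ? [].
  exact: Im_le_rnorm.
apply/(cvg_rnormP (V := C) (F := nbhs (t : R))) => e e0.
have e2 : 0 < e / 2 by lra.
near=> x.
have h1 : `|complex.Re (g t) - complex.Re (g x)| <= e / 2.
  by near: x; move: (cr t) => /cvgrPdist_le; apply.
have h2 : `|complex.Im (g t) - complex.Im (g x)| <= e / 2.
  by near: x; move: (ci t) => /cvgrPdist_le; apply.
apply: le_trans (rnorm_ReIm _) _; move: h1 h2.
by case: (g t) (g x) => ? ? [? ?] /=; lra.
Unshelve. all: by end_near. Qed.

Lemma continuous_polar r : continuous (polar r).
Proof.
apply/continuous_complexP; split=> t /=; apply: continuousM; try exact: cst_continuous.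
  exact: continuous_cos.
exact: continuous_sin.
Qed.

Lemma continuous_on_circle phi r :
  (forall t, {for polar r t, continuous phi}) -> continuous (fun t => phi (polar r t)).
Proof. by move=> H t; apply: continuous_comp; [exact: continuous_polar|exact: H]. Qed.

Definition cmean g : C :=
  ((2 * pi)^-1 * itg (fun t => complex.Re (g t)) 0 (2 * pi)) +i*
  ((2 * pi)^-1 * itg (fun t => complex.Im (g t)) 0 (2 * pi)).

Let pi2 : 0 < 2 * pi :> R. Proof. by rewrite mulr_gt0// pi_gt0. Qed.
Lemma contRe g a b : continuous g -> cont_on (fun t => complex.Re (g t)) a b.
Proof. by move=> /continuous_complexP[cg _] t _; exact: cg. Qed.

Lemma contIm g a b : continuous g -> cont_on (fun t => complex.Im (g t)) a b.
Proof. by move=> /continuous_complexP[_ cg] t _; exact: cg. Qed.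

Lemma cmeanD g h : continuous g -> continuous h ->
  cmean (fun t => g t + h t) = cmean g + cmean h.
Proof.
move=> cg ch; rewrite /cmean; apply/eqP; rewrite eq_complex/= -!mulrDr.
rewrite -itgD; [|exact: contRe..]; rewrite -itgD; [|exact: contIm..].
by apply/andP; split; apply/eqP; congr (_ * _); apply: eq_itg => t _; case: (g t) (h t) => ? ? [].
Qed.

Lemma cmeanZ z g : continuous g -> cmean (fun t => z * g t) = z * cmean g.
Proof.
move=> cg; rewrite /cmean; case: z => x y; apply/eqP; rewrite eq_complex/=.
have cr := @contRe g 0 (2 * pi) cg; have ci := @contIm g 0 (2 * pi) cg.
have crZ k : cont_on (fun t => k * complex.Re (g t)) 0 (2 * pi).
  by move=> t ht; apply: continuousM; [exact: cst_continuous|exact: cr].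
have ciZ k : cont_on (fun t => k * complex.Im (g t)) 0 (2 * pi).
  by move=> t ht; apply: continuousM; [exact: cst_continuous|exact: ci].
apply/andP; split; apply/eqP.
  rewrite (_ : itg _ _ _ = itg (fun t => x * complex.Re (g t) - y * complex.Im (g t)) 0 (2 * pi)).
    by rewrite itgB// !itgZ//; ring.
  by apply: eq_itg => t _; case: (g t).
rewrite (_ : itg _ _ _ = itg (fun t => x * complex.Im (g t) + y * complex.Re (g t)) 0 (2 * pi)).
  by rewrite itgD// !itgZ//; ring.
by apply: eq_itg => t _; case: (g t).
Qed.

Lemma cmean_cst z : cmean (fun=> z) = z.
Proof.
rewrite /cmean !itg_cst ?(ltW pi2)// subr0.
have E k : (2 * pi)^-1 * (k * (2 * pi)) = k :> R by rewrite mulrCA mulVf ?mulr1// lt0r_neq0.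
by rewrite !E; case: z.
Qed.

Lemma cmeanB g h : continuous g -> continuous h ->
  cmean (fun t => g t - h t) = cmean g - cmean h.
Proof.
move=> cg ch.
rewrite (_ : (fun _ => _) = (fun t => g t + (-1) * h t)); last by apply: funext => t; rewrite mulN1r.
have cNh : continuous (fun t => (-1) * h t) by move=> t; apply: cvgM; [exact: cvg_cst|exact: ch].
by rewrite (cmeanD cg cNh) (cmeanZ (-1) ch) mulN1r.
Qed.

(** Real and imaginary parts are bounded separately, which costs the factor 2. The lemma is applied
    only where a fixed factor is harmless. *)
Lemma rnorm_cmean g K : continuous g -> (forall t, 0 <= t <= 2 * pi -> rnorm (g t) <= K) -> rnorm (cmean g) <= 2 * K.
Proof.
move=> cg gK; apply: le_trans (rnorm_ReIm _) _ => /=.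
have bnd (u : R -> R) : cont_on u 0 (2 * pi) -> (forall t, 0 <= t <= 2 * pi -> `|u t| <= K) ->
    `|(2 * pi)^-1 * itg u 0 (2 * pi)| <= K.
  move=> cu uK; have := @itg_near_cst R u 0 K 0 (2 * pi) (ltW pi2) cu.
  rewrite mul0r !subr0 => H; rewrite normrM ger0_norm ?invr_ge0 ?(ltW pi2)//.
  by rewrite mulrC ler_pdivrMr//; apply: H => x hx; rewrite subr0; exact: uK.
rewrite (_ : 2 * K = K + K); last by ring.
apply: lerD; apply: bnd.
- exact: contRe.
- by move=> t ht; apply: le_trans (gK t ht); exact: Re_le_rnorm.
- exact: contIm.
- by move=> t ht; apply: le_trans (gK t ht); exact: Im_le_rnorm.
Qed.

Lemma annulus_mean phi a b r1 r2 : 0 <= a -> a < r1 -> r1 <= r2 -> r2 < b ->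
  (forall z, a < rnorm z < b -> exists D, cdiff phi z D) ->
  cmean (fun t => phi (polar r1 t)) = cmean (fun t => phi (polar r2 t)).
Proof.
move=> a0 ar1 r12 r2b Hphi.
have r10 : 0 < r1 by apply: le_lt_trans ar1.
have cphi r : r1 <= r <= r2 -> continuous (fun t => phi (polar r t)).
  move=> /andP[h1 h2]; apply: continuous_on_circle => t.
  have [|D] := Hphi (polar r t); last exact: cdiff_continuous.
  rewrite rnorm_polar gtr0_norm ?(lt_le_trans r10)//.
  by rewrite (lt_le_trans ar1)// (le_lt_trans h2).
have c1 := cphi r1; rewrite lexx r12 in c1; have {}c1 := c1 isT.
have c2 := cphi r2; rewrite lexx r12 in c2; have {}c2 := c2 isT.
(* The imaginary part of phi is the real part of -i phi, so the real statement applies twice. *)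
have dphi z : a < rnorm z < b -> exists D, cdiff (fun z => - 'i%C * phi z) z D.
  by move=> /Hphi[D dD]; exists (- 'i%C * D); exact: cdiffZ.
have cr1 := @contRe _ 0 (2 * pi) c1; have cr2 := @contRe _ 0 (2 * pi) c2.
have ci1 := @contIm _ 0 (2 * pi) c1; have ci2 := @contIm _ 0 (2 * pi) c2.
have HR := annulus_itg_Re a0 ar1 r12 r2b Hphi.
have HI := annulus_itg_Re a0 ar1 r12 r2b dphi.
apply/esym/eqP; rewrite eq_complex/=; apply/andP; split; rewrite -subr_eq0 -mulrBr -itgB//.
  by rewrite HR mulr0.
rewrite (_ : itg _ _ _ = 0) ?mulr0// -[RHS]HI.
by apply: eq_itg => t _; case: (phi _) (phi _) => ? ? [? ?] /=; ring.
Qed.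

(** Compactness of [0, 2 pi] makes the continuity at the points of the circle of radius [r0]
    uniform. Nothing is assumed of phi off that circle, hence the separate continuity premise for
    the radius r. *)
Lemma cmean_cvg phi r0 : 0 <= r0 -> (forall t, {for polar r0 t, continuous phi}) ->
  forall e, 0 < e -> exists2 d, 0 < d & forall r, `|r - r0| <= d ->
    continuous (fun t => phi (polar r t)) ->
    rnorm (cmean (fun t => phi (polar r t)) - cmean (fun t => phi (polar r0 t))) <= e.
Proof.
move=> r00 cphi e e0.
have e2 : 0 < e / 2 by lra.
have H t : exists2 d, 0 < d & forall r s, `|r - r0| <= d -> `|s - t| <= d ->
    rnorm (phi (polar r s) - phi (polar r0 t)) <= e / 4.
  have e4 : 0 < e / 4 by lra.
  move: (cphi t) => /(cvg_rnormP (V := C) (F := nbhs (polar r0 t : C))) /(_ _ e4) /(near_rnorm (V := C))[d d0 {}H].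
  have /(cvg_rnormP (V := C) (F := nbhs (t : R))) := @continuous_polar 1 t.
  have r1 : 0 < d / (2 * (1 + r0)) by rewrite divr_gt0// mulr_gt0//; lra.
  move=> /(_ _ r1) /nbhs_ballP[k /= k0 Hk].
  exists (Num.min (d / 2) (k / 2)); first by rewrite lt_min !divr_gt0.
  move=> r s; rewrite !le_min => /andP[h1 h2] /andP[h3 h4].
  rewrite rdistC; apply: H.
  have -> : polar r s - polar r0 t = (r - r0)%:C * polar 1 s + r0%:C * (polar 1 s - polar 1 t).
    by rewrite (polarM r) (polarM r0) rmorphB/=; ring.
  apply: le_trans (rnormD _ _) _; rewrite !rnormM !rnormr rnorm_polar normr1 mulr1 (ger0_norm r00).
  have : r0 * rnorm (polar 1 s - polar 1 t) <= d / 2.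
    apply: (@le_trans _ _ ((1 + r0) * (d / (2 * (1 + r0))))); last first.
      by rewrite le_eqVlt; apply/orP; left; apply/eqP; field; rewrite lt0r_neq0//; lra.
    apply: ler_pM => //; [exact: rnorm_ge0|lra|].
    rewrite rdistC; apply: Hk; rewrite -ball_normE/= distrC.
    by apply: le_lt_trans h4 _; lra.
  lra.
have := @segment_compact R 0 (2 * pi); move=> /compact_near_coveringP cov.
have := cov _ (nbhs r0) (fun r t => rnorm (phi (polar r t) - phi (polar r0 t)) <= e / 2).
have cov1 : forall t, `[0, 2 * pi]%classic t -> \forall t' \near t & r \near r0,
    rnorm (phi (polar r t') - phi (polar r0 t')) <= e / 2.
  move=> t _; have [d d0 Hd] := H t.
  exists (ball t d, ball r0 d) => /=; first by split; exact: nbhsx_ballx.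
  move=> [s r] /= []; rewrite -!ball_normE /ball_/= distrC => h1; rewrite distrC => h2.
  have a1 := Hd r s (ltW h2) (ltW h1).
  have a2 : rnorm (phi (polar r0 s) - phi (polar r0 t)) <= e / 4.
    by apply: Hd; [rewrite subrr normr0 ltW|exact: ltW].
  rewrite rdistC in a2.
  by apply: le_trans (rdistD (phi (polar r0 t)) _ _) _; lra.
move=> /(_ _ cov1); rewrite near_simpl => /nbhs_ballP[d /= d0 Hd].
exists (d / 2); first by rewrite divr_gt0.
move=> r hr cr; have c0 : continuous (fun t => phi (polar r0 t)) by exact: continuous_on_circle.
rewrite -(cmeanB cr c0); apply: le_trans (rnorm_cmean (K := e / 2) _ _) _; last lra.
  by move=> t; apply: cvgB; [exact: cr|exact: c0].
move=> t ht; apply: (Hd r); last by rewrite /= in_itv.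
by rewrite -ball_normE /ball_/= distrC; apply: le_lt_trans hr _; lra.
Qed.

Lemma polar_neq0 r t : 0 < r -> polar r t != 0.
Proof. by move=> r0; rewrite -rnorm_eq0 rnorm_polar lt0r_neq0// normr_gt0 lt0r_neq0. Qed.

Lemma near_cdiff phi psi z D : (\forall x \near z, phi x = psi x) ->
  cdiff phi z D -> cdiff psi z D.
Proof.
move=> /(near_rnorm (V := C))[k k0 E] H e /H[d d0 {}H].
exists (Num.min d k); first by rewrite lt_min d0.
move=> h; rewrite le_min => /andP[hd hk]; rewrite -!E; first exact: H.
  by rewrite subrr rnorm0 ltW.
by rewrite addrC addKr.
Qed.

Lemma cdiff_dslope f w z D Dw : z != w -> cdiff f z D ->
  exists D', cdiff (fun x => if x == w then Dw else (f x - f w) / (x - w)) z D'.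
Proof.
move=> zw dz.
have [D' dD'] : exists D', cdiff (fun x => (f x - f w) * (x - w)^-1) z D'.
  apply: derivable_cdiff; apply: derivableM.
    by apply: derivableB; [exact: cdiff_derivable dz|exact: derivable_cst].
  apply: derivableV; first by rewrite subr_eq0.
  by apply: derivableB; [exact: derivable_id|exact: derivable_cst].
exists D'; apply: near_cdiff dD'; apply/(near_rnorm (V := C)).
have d0 : 0 < rnorm (z - w) by rewrite rnorm_gt0 subr_eq0.
exists (rnorm (z - w) / 2); first by rewrite divr_gt0.
move=> x xz; case: eqP => // xw; exfalso; move: xz; rewrite xw rdistC; lra.
Qed.

Lemma continuous_dslope f w D : cdiff f w D ->
  {for w, continuous (fun x => if x == w then D else (f x - f w) / (x - w))}.
Proof.
move=> H; apply/(cvg_rnormP (V := C) (F := nbhs (w : C))) => e e0; apply/(near_rnorm (V := C)).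
have [d d0 {}H] := H _ e0; exists d => // x xw; rewrite eqxx.
case: eqP => [_|/eqP xw0]; first by rewrite subrr rnorm0 ltW.
have := H _ xw; rewrite [w + _]addrC subrK => {}H.
have xw1 : x - w != 0 by rewrite subr_eq0.
have p : 0 < rnorm (x - w) by rewrite rnorm_gt0.
rewrite -(ler_pM2r p) -rnormM.
have -> : (D - (f x - f w) / (x - w)) * (x - w) = - (f x - f w - D * (x - w)) by field.
by rewrite rnormN.
Qed.

End Mean.

(** * The Cauchy kernel and Cauchy's formula *)

Section Cauchy.
Variable R : realType.
Local Notation C := (Cplx R).
Implicit Types (g h : R -> C) (f phi : C -> C) (r t a b : R) (z w D : C).

(** The annulus is shrunk by a small [k] on both sides and [cmean_cvg] closes the gap. On the
    boundary circles continuity suffices, and a = 0 is allowed: both matter in [cauchy_formula]. *)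
Lemma annulus_mean_closed phi a b : 0 <= a -> a < b ->
  (forall t, {for polar a t, continuous phi}) ->
  (forall t, {for polar b t, continuous phi}) ->
  (forall z, a < rnorm z < b -> exists D, cdiff phi z D) ->
  cmean (fun t => phi (polar a t)) = cmean (fun t => phi (polar b t)).
Proof.
move=> a0 ab ca cb dphi; apply/eqP; rewrite -subr_eq0 -rnorm_eq0 eq_le rnorm_ge0 andbT.
apply/ler_addgt0Pr => e e0; rewrite add0r.
have e2 : 0 < e / 2 by lra.
have b0 : 0 <= b by lra.
have [d1 d10 H1] := cmean_cvg a0 ca e2; have [d2 d20 H2] := cmean_cvg b0 cb e2.
pose k := Num.min ((b - a) / 3) (Num.min d1 d2).
have k0 : 0 < k by rewrite !lt_min d10 d20 divr_gt0// subr_gt0.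
have k1 : k <= (b - a) / 3 by rewrite ge_min lexx.
have k2 : k <= d1 by rewrite !ge_min lexx orbT.
have k3 : k <= d2 by rewrite !ge_min lexx !orbT.
have cphi r : a < r < b -> continuous (fun t => phi (polar r t)).
  move=> /andP[ar rb]; apply: continuous_on_circle => t.
  have [|D] := dphi (polar r t); last exact: cdiff_continuous.
  by rewrite rnorm_polar gtr0_norm ?ar ?rb//; lra.
have {}H1 := H1 (a + k); have {}H2 := H2 (b - k).
have E : cmean (fun t => phi (polar (a + k) t)) = cmean (fun t => phi (polar (b - k) t)).
  by apply: annulus_mean dphi => //; lra.
have {}H1 : rnorm (cmean (fun t => phi (polar (a + k) t)) - cmean (fun t => phi (polar a t))) <= e / 2.
  apply: H1; first by rewrite addrC addKr gtr0_norm.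
  by apply: cphi; apply/andP; split; lra.
have {}H2 : rnorm (cmean (fun t => phi (polar (b - k) t)) - cmean (fun t => phi (polar b t))) <= e / 2.
  apply: H2; first by rewrite addrC addKr normrN gtr0_norm.
  by apply: cphi; apply/andP; split; lra.
rewrite rdistC in H1; apply: le_trans (rdistD _ _ _) _; rewrite E in H1.
by apply: le_trans (lerD H1 H2) _; lra.
Qed.

Lemma polar_sub_neq0 w r t : rnorm w < r -> polar r t - w != 0.
Proof.
move=> wr; rewrite subr_eq0; apply/eqP => E; move: wr; rewrite -E rnorm_polar.
by have := ler_norm r; lra.
Qed.

Lemma rnorm_polar_sub w r t : rnorm w < r -> r - rnorm w <= rnorm (polar r t - w).
Proof.
move=> wr; have := rnorm_dist (polar r t) w; rewrite rnorm_polar [`|r|]ger0_norm; last first.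
  by have := rnorm_ge0 w; lra.
by rewrite ler_norml; lra.
Qed.

Lemma continuous_inv_polar_sub w r : rnorm w < r -> continuous (fun t => (polar r t - w)^-1).
Proof.
move=> wr t; apply: cvgV; first exact: polar_sub_neq0.
by apply: cvgB; [exact: continuous_polar|exact: cvg_cst].
Qed.

Lemma continuous_kernel w r : rnorm w < r -> continuous (fun t => polar r t / (polar r t - w)).
Proof.
move=> wr t; apply: cvgM; first exact: continuous_polar.
exact: continuous_inv_polar_sub.
Qed.

(** Beyond |w| the mean does not depend on the radius, and the kernel tends to 1 at infinity. *)
Lemma cmean_kernel w r : rnorm w < r -> cmean (fun t => polar r t / (polar r t - w)) = 1.
Proof.
move=> wr; apply/eqP; rewrite -subr_eq0 -rnorm_eq0 eq_le rnorm_ge0 andbT.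
apply/ler_addgt0Pr => e e0; rewrite add0r.
have w0 := rnorm_ge0 w.
(* The kernel minus 1 has norm at most |w| / (s - |w|), and this [s] brings it below e/2. *)
pose s := r + 2 * (rnorm w + 1) / e.
have rs : r <= s by rewrite lerDl divr_ge0// ?(ltW e0)//; lra.
have dk z : rnorm w < rnorm z < s + 1 -> exists D, cdiff (fun z => z / (z - w)) z D.
  move=> /andP[h _]; apply: derivable_cdiff; apply: derivableM; first exact: derivable_id.
  apply: derivableV.
    by rewrite subr_eq0; apply/eqP => E; move: h; rewrite E ltxx.
  by apply: derivableB; [exact: derivable_id|exact: derivable_cst].
rewrite (@annulus_mean R (fun z => z / (z - w)) (rnorm w) (s + 1) r s)//; [|by rewrite ltrDl].
have ws : rnorm w < s by lra.
have ck := continuous_kernel ws.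
have c1 : continuous (fun _ : R => 1 : C) by move=> t; exact: cvg_cst.
rewrite -[X in _ - X](cmean_cst (1 : C)) -(cmeanB ck c1).
apply: le_trans (rnorm_cmean (K := e / 2) _ _) _; last lra.
  by move=> t; exact: (cvgB (ck t) (c1 t)).
move=> t _; have h0 := @polar_sub_neq0 w s t ws.
have -> : polar s t / (polar s t - w) - 1 = w / (polar s t - w) by field.
rewrite rnormM rnormV.
have h1 := rnorm_polar_sub t ws.
have p : 0 < rnorm (polar s t - w) by lra.
rewrite ler_pdivrMr//; apply: (@le_trans _ _ (e / 2 * (s - rnorm w))); last first.
  by rewrite ler_wpM2l//; lra.
have -> : e / 2 * (s - rnorm w) = e / 2 * (r - rnorm w) + (rnorm w + 1).
  by rewrite /s; field; rewrite lt0r_neq0.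
have : 0 <= e / 2 * (r - rnorm w) by rewrite mulr_ge0//; lra.
lra.
Qed.

Section Formula.
Variable f : C -> C.
Hypothesis df : forall z, rnorm z < 1 -> exists D, cdiff f z D.

Lemma continuous_circle_disk r : 0 <= r -> r < 1 -> continuous (fun t => f (polar r t)).
Proof.
move=> r0 r1; apply: continuous_on_circle => t.
have [|D] := df (z := polar r t); last exact: cdiff_continuous.
by rewrite rnorm_polar ger0_norm.
Qed.

(** The function x (f x - f w) / (x - w), continuous at w and differentiable elsewhere in the disk,
    has mean 0 at radius 0. The radius grows in two stages, from 0 to |w| and from |w| to r, so that
    w lies only on a boundary circle, where continuity is enough. The mean of the kernel then leaves
    f w. *)
Lemma cauchy_formula w r : rnorm w < r -> r < 1 ->
  f w = cmean (fun t => f (polar r t) * (polar r t / (polar r t - w))).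
Proof.
move=> wr r1; have w0 := rnorm_ge0 w.
have [|Dw dfw] := df (z := w); first lra.
pose psi x : C := if x == w then Dw else (f x - f w) / (x - w).
pose phi x : C := x * psi x.
have cphi z : rnorm z < 1 -> {for z, continuous phi}.
  have ci : {for z, continuous (fun x : C => x)} by exact: cvg_id.
move=> z1; apply: (continuousM ci).
  have [->|zw] := eqVneq z w; first exact: continuous_dslope.
  have [D dD] := df z1; have [D' dD'] := cdiff_dslope Dw zw dD.
  exact: cdiff_continuous dD'.
have dphi z : rnorm z < 1 -> z != w -> exists D, cdiff phi z D.
  move=> z1 zw; have [D dD] := df z1; have [D' dD'] := cdiff_dslope Dw zw dD.
  apply: derivable_cdiff; apply: derivableM; first exact: derivable_id.
  exact: cdiff_derivable dD'.
have cp s : 0 <= s -> s < 1 -> forall t, {for polar s t, continuous phi}.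
  by move=> s0 s1 t; apply: cphi; rewrite rnorm_polar ger0_norm.
have m0 : cmean (fun t => phi (polar 0 t)) = 0.
  rewrite (_ : (fun _ => _) = fun=> 0) ?cmean_cst//.
  apply: funext => t; rewrite /phi (_ : polar 0 t = 0) ?mul0r//.
  by apply/eqP; rewrite -rnorm_eq0 rnorm_polar normr0.
have mw : cmean (fun t => phi (polar (rnorm w) t)) = 0.
  have [E|wn0] := eqVneq w 0; first by rewrite (_ : rnorm w = 0) ?m0// E rnorm0.
  rewrite -m0; apply/esym; apply: annulus_mean_closed.
  - exact: lexx.
  - by rewrite rnorm_gt0.
  - by apply: cp; [exact: lexx|exact: ltr01].
  - by apply: cp; [exact: w0|exact: lt_trans wr r1].
  - move=> z /andP[h1 h2]; apply: dphi; first exact: lt_trans h2 (lt_trans wr r1).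
    by apply/eqP => E; rewrite E ltxx in h2.
have : cmean (fun t => phi (polar r t)) = 0.
  rewrite -mw; apply/esym; apply: annulus_mean_closed.
  - exact: w0.
  - exact: wr.
  - by apply: cp; [exact: w0|exact: lt_trans wr r1].
  - by apply: cp; [exact: ltW (le_lt_trans w0 wr)|exact: r1].
  - move=> z /andP[h1 h2]; apply: dphi; first exact: lt_trans h2 r1.
    by apply/eqP => E; rewrite E ltxx in h1.
have ck := continuous_kernel wr.
have cf : continuous (fun t => f (polar r t)) by apply: continuous_circle_disk => //; lra.
rewrite (_ : (fun _ => _) = (fun t => f (polar r t) * (polar r t / (polar r t - w)) - f w * (polar r t / (polar r t - w)))).
  rewrite cmeanB.
  - rewrite cmeanZ// cmean_kernel// mulr1 => /eqP; rewrite subr_eq0 => /eqP ->//.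
  - by move=> t; exact: (cvgM (cf t) (ck t)).
  - by move=> t; exact: (cvgM (cvg_cst _) (ck t)).
apply: funext => t; rewrite /phi /psi; have h := polar_sub_neq0 t wr.
rewrite ifN; last by rewrite -subr_eq0.
by field.
Qed.

End Formula.
End Cauchy.

(** * Taylor coefficients *)

Section Taylor.
Variable R : realType.
Local Notation C := (Cplx R).
Implicit Types (r t : R) (z w D : C).

(* second-order expansion of h |-> (zeta - w - h)^-n, with
   u = (zeta - w)^-1 and v = (zeta - w - h)^-1 *)
Lemma inv_pow_diff (u v h : C) (B : R) n : v - u = h * u * v ->
  rnorm u <= B -> rnorm v <= B ->
  rnorm (v ^+ n - u ^+ n - n%:R * h * u ^+ n.+1) <= n%:R ^+ 2 * B ^+ n.+2 * rnorm h ^+ 2.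
Proof.
move=> vu uB vB; have B0 : 0 <= B by apply: le_trans uB; exact: rnorm_ge0.
elim: n => [|n IH].
  by rewrite !expr0 subrr mulr0n !mul0r subr0 rnorm0 expr0n/= !mul0r.
have -> : v ^+ n.+1 - u ^+ n.+1 - n.+1%:R * h * u ^+ n.+2 =
   v * (v ^+ n - u ^+ n - n%:R * h * u ^+ n.+1) + n.+1%:R * h ^+ 2 * (u ^+ n.+2 * v).
  transitivity (v * (v ^+ n - u ^+ n - n%:R * h * u ^+ n.+1) + n.+1%:R * h ^+ 2 * (u ^+ n.+2 * v)
     + u ^+ n * (1 + n%:R * h * u + h * u) * (v - u - h * u * v)).
    by rewrite !exprS -natr1; ring.
  by rewrite vu subrr mulr0 addr0.
apply: le_trans (rnormD _ _) _; rewrite [rnorm (v * _)]rnormM [rnorm (_ * (_ * v))]rnormM.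
rewrite [rnorm (_ * v)]rnormM [rnorm (_ * h ^+ 2)]rnormM [rnorm (u ^+ _)]rnormX [rnorm (h ^+ 2)]rnormX.
have nE k : rnorm (k%:R : C) = k%:R.
  by rewrite -[k%:R]/(k%:R : C) -(rmorph_nat (real_complex R)) rnormr normr_nat.
rewrite nE.
have h1 : rnorm v * rnorm (v ^+ n - u ^+ n - n%:R * h * u ^+ n.+1) <= B * (n%:R ^+ 2 * B ^+ n.+2 * rnorm h ^+ 2).
  by apply: ler_pM => //; exact: rnorm_ge0.
have h2 : n.+1%:R * rnorm h ^+ 2 * (rnorm u ^+ n.+2 * rnorm v) <= n.+1%:R * rnorm h ^+ 2 * (B ^+ n.+2 * B).
  rewrite ler_wpM2l ?mulr_ge0 ?rnorm_ge0//.
  by apply: ler_pM => //; rewrite ?exprn_ge0 ?rnorm_ge0// lerXn2r// ?nnegrE ?rnorm_ge0.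
apply: le_trans (lerD h1 h2) _.
have -> : B * (n%:R ^+ 2 * B ^+ n.+2 * rnorm h ^+ 2) + n.+1%:R * rnorm h ^+ 2 * (B ^+ n.+2 * B) =
   (n%:R ^+ 2 + n.+1%:R) * (B ^+ n.+3 * rnorm h ^+ 2) by rewrite !exprS; ring.
rewrite -[leRHS]mulrA; apply: ler_wpM2r; first by apply: mulr_ge0; rewrite ?exprn_ge0 ?rnorm_ge0.
rewrite -natr1.
have := ler0n R n; set x := n%:R => x0; have -> : (x + 1) ^+ 2 = x ^+ 2 + 2 * x + 1 by ring.
lra.
Qed.

Variable f : C -> C.
Hypothesis Hf : Hinfty f.

Lemma Hinfty_cdiff z : rnorm z < 1 -> exists D, cdiff f z D.
Proof.
move=> z1; apply: derivable_cdiff; apply: (proj1 Hf).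
by rewrite /disk -ball_normE /ball_/= sub0r normrN rnormE ltcR.
Qed.

Lemma Hinfty_bounded : exists2 M : R, 0 <= M & forall z, rnorm z < 1 -> rnorm (f z) <= M.
Proof.
have [_ /ex_strict_bound_gt0[M M0 HM]] := Hf.
have ME : M = (complex.Re M)%:C by rewrite RRe_real// ger0_real// ltW.
exists (complex.Re M); first by move: M0; rewrite ME ltcR => /ltW.
move=> z z1.
have : disk z by rewrite /disk -ball_normE /ball_/= sub0r normrN rnormE ltcR.
by move=> /HM /=; rewrite rnormE ME ltcR => /ltW.
Qed.

Let kern r n w t : C := f (polar r t) * (polar r t * (polar r t - w)^-1 ^+ n.+1).

Let continuous_kern r n w : rnorm w < r -> r < 1 -> continuous (kern r n w).
Proof.
move=> wr r1 t; apply: cvgM.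
  by apply: continuous_circle_disk => //; [exact: Hinfty_cdiff|have := rnorm_ge0 w; lra].
apply: cvgM; first exact: continuous_polar.
have := @continuous_inv_polar_sub R w r wr t.
elim: n => [|n IH] H; first exact: H.
under eq_fun do rewrite exprS.
by rewrite exprS; apply: cvgM; [exact: H|exact: IH].
Qed.

(** Cauchy's integral for the n-th derivative at w divided by n!. The factor [polar r t] in [kern]
    comes from d zeta = i zeta dt. *)
Definition cauchy_int r n w : C := cmean (kern r n w).

(** Differentiation under the integral sign: [inv_pow_diff] bounds the second-order remainder of the
    integrand uniformly on the circle. *)
Lemma cauchy_int_cdiff r n w : rnorm w < r -> r < 1 ->
  cdiff (cauchy_int r n) w (n.+1%:R * cauchy_int r n.+1 w).
Proof.
move=> wr r1 e e0; have w0 := rnorm_ge0 w.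
have [M M0 fM] := Hinfty_bounded.
pose d := r - rnorm w; have d0 : 0 < d by rewrite subr_gt0.
(* For |h| <= d/2 both zeta - w and zeta - w - h have norm at least d/2 on the circle, so [B] bounds
   both inverses. *)
have [B BE B0] : exists2 B, B = 2 / d & 0 < B by exists (2 / d); rewrite ?divr_gt0.
pose K := 1 + 2 * (M * (r * (n.+1%:R ^+ 2 * B ^+ n.+3))).
have K1 : 1 <= K.
  have r0 : 0 <= r by lra.
  have Bn : 0 <= B ^+ n.+3 by rewrite exprn_ge0// ltW.
  by rewrite /K lerDl pmulr_rge0//; exact: (mulr_ge0 M0 (mulr_ge0 r0 (mulr_ge0 (sqr_ge0 _) Bn))).
exists (Num.min (d / 2) (e / K)); first by rewrite lt_min !divr_gt0//; lra.
move=> h; rewrite le_min [_ <= e / K]ler_pdivlMr; last by lra.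
move=> /andP[hd he].
have whr : rnorm (w + h) < r by apply: le_lt_trans (rnormD _ _) _; rewrite /d in hd; lra.
have c1 := continuous_kern (n := n) whr r1; have c2 := continuous_kern (n := n) wr r1.
have c3 := continuous_kern (n := n.+1) wr r1.
have cB : continuous (fun t => kern r n (w + h) t - kern r n w t).
  by move=> t; exact: (cvgB (c1 t) (c2 t)).
have cZ : continuous (fun t => n.+1%:R * h * kern r n.+1 w t).
  by move=> t; exact: (cvgM (cvg_cst _) (c3 t)).
have -> : cauchy_int r n (w + h) - cauchy_int r n w - n.+1%:R * cauchy_int r n.+1 w * h =
    cmean (fun t => (kern r n (w + h) t - kern r n w t) - n.+1%:R * h * kern r n.+1 w t).
  rewrite (cmeanB cB cZ) (cmeanB c1 c2) (cmeanZ _ c3) /cauchy_int.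
  by rewrite [in LHS]mulrAC.
apply: (@le_trans _ _ (2 * (M * (r * (n.+1%:R ^+ 2 * B ^+ n.+3 * rnorm h ^+ 2))))); last first.
  have -> : 2 * (M * (r * (n.+1%:R ^+ 2 * B ^+ n.+3 * rnorm h ^+ 2))) = (K - 1) * rnorm h * rnorm h.
    by rewrite /K; ring.
  rewrite ler_wpM2r ?rnorm_ge0//; apply: le_trans he.
  by rewrite mulrC ler_wpM2l ?rnorm_ge0// gerBl.
apply: rnorm_cmean; first by move=> t; exact: (cvgB (cB t) (cZ t)).
move=> t _; rewrite /kern.
set z := polar r t; set u := (z - w)^-1; set v := (z - (w + h))^-1.
have zw := polar_sub_neq0 t wr; have zwh := polar_sub_neq0 t whr; rewrite -/z in zw zwh.
have -> : f z * (z * v ^+ n.+1) - f z * (z * u ^+ n.+1) - n.+1%:R * h * (f z * (z * u ^+ n.+2)) =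
  f z * (z * (v ^+ n.+1 - u ^+ n.+1 - n.+1%:R * h * u ^+ n.+2)) by ring.
have zr : rnorm z = r by rewrite rnorm_polar ger0_norm//; lra.
rewrite !rnormM; apply: ler_pM; rewrite ?mulr_ge0 ?rnorm_ge0//.
  by apply: fM; rewrite zr.
rewrite zr ler_wpM2l//; first by lra.
apply: inv_pow_diff.
- by rewrite /u /v; field; rewrite zw zwh.
- rewrite rnormV BE -[2 / d]invf_div lef_pV2 ?posrE ?divr_gt0 ?rnorm_gt0//.
  by apply: le_trans (rnorm_polar_sub t wr); rewrite -/d; lra.
- rewrite rnormV BE -[2 / d]invf_div lef_pV2 ?posrE ?divr_gt0 ?rnorm_gt0//.
  apply: le_trans (rnorm_polar_sub t whr).
  by have := rnormD w h; rewrite /d in hd *; lra.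
Qed.

Lemma derive1n_cauchy_int r n w : rnorm w < r -> r < 1 ->
  derive1n n f w = n`!%:R * cauchy_int r n w.
Proof.
move=> wr r1; elim: n w wr => [|n IH] w wr.
  rewrite /= mul1r (cauchy_formula Hinfty_cdiff wr r1) /cauchy_int /kern.
  by under [in RHS]eq_fun do rewrite expr1.
rewrite -[LHS]/(derive1 (derive1n n f) w); apply: cdiff_derive1.
rewrite factS mulnC natrM -mulrA.
apply: near_cdiff (cdiffZ _ (cauchy_int_cdiff n wr r1)).
apply/(near_rnorm (V := C)); exists ((r - rnorm w) / 2); first by lra.
move=> x xw; rewrite IH//.
by have := rnormD (x - w) w; rewrite subrK; lra.
Qed.

Lemma taylor_coefE r n : 0 < r -> r < 1 -> taylor_coef f n = cauchy_int r n 0.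
Proof.
move=> r0 r1; rewrite /taylor_coef (@derive1n_cauchy_int r) ?rnorm0//.
by rewrite mulrC mulKf// pnatr_eq0 -lt0n fact_gt0.
Qed.

Let continuous_remainder r z n : rnorm z < r -> r < 1 -> continuous (fun t =>
  f (polar r t) * ((z / polar r t) ^+ n * (polar r t / (polar r t - z)))).
Proof.
move=> zr r1; have r0 : 0 < r by apply: le_lt_trans zr; exact: rnorm_ge0.
have fc : continuous (fun t => f (polar r t)).
  by apply: continuous_circle_disk; [exact: Hinfty_cdiff|exact: ltW|].
have kc := continuous_kernel zr.
have ic : continuous (fun t => (polar r t)^-1).
  by move=> t; apply: cvgV; [exact: polar_neq0|exact: continuous_polar].
have pc : continuous (fun t => (z / polar r t) ^+ n).
  elim: n => [|n IH] t; first by under eq_fun do rewrite expr0; exact: cvg_cst.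
  under eq_fun do rewrite exprS.
  exact: (cvgM (cvgM (cvg_cst _) (ic t)) (IH t)).
by move=> t; exact: (cvgM (fc t) (cvgM (pc t) (kc t))).
Qed.

(** For N = 0 this is Cauchy's formula. Each further Taylor term removes the leading term of the
    geometric series of zeta / (zeta - z) in powers of z / zeta. *)
Lemma taylor_remainder r z N : rnorm z < r -> r < 1 ->
  f z - \sum_(k < N) taylor_coef f k * z ^+ k =
  cmean (fun t => f (polar r t) * ((z / polar r t) ^+ N * (polar r t / (polar r t - z)))).
Proof.
move=> zr r1; have r0 : 0 < r by apply: le_lt_trans zr; exact: rnorm_ge0.
have gc n := @continuous_remainder r z n zr r1.
elim: N => [|N IH].
  rewrite big_ord0 subr0 (cauchy_formula Hinfty_cdiff zr r1).
  by under [in RHS]eq_fun do rewrite expr0 mul1r.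
have kN := continuous_kern (n := N) (w := 0) _ r1; rewrite rnorm0 in kN; have {}kN := kN r0.
have zkN : continuous (fun t => z ^+ N * kern r N 0 t).
  by move=> t; exact: (cvgM (cvg_cst _) (kN t)).
rewrite big_ord_recr/= opprD addrA IH (taylor_coefE N r0 r1) mulrC -(cmeanZ _ kN) -(cmeanB (gc N) zkN).
congr cmean; apply: funext => t; rewrite /kern subr0.
have p0 := polar_neq0 t r0; have pz := polar_sub_neq0 t zr.
have -> : z ^+ N * (f (polar r t) * (polar r t * (polar r t)^-1 ^+ N.+1)) =
    f (polar r t) * (z / polar r t) ^+ N.
  by rewrite exprS mulVKf// mulrCA -exprMn.
rewrite exprSr; set x := (z / _) ^+ N; set y := f _.
by field; rewrite p0 pz.
Qed.

Lemma taylor_bounded : exists2 M : R, 0 <= M & forall r, 0 <= r -> r < 1 ->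
  exists N0, forall N, (N0 <= N)%N -> forall z, rnorm z = r ->
    rnorm (\sum_(k < N) taylor_coef f k * z ^+ k) <= M.
Proof.
have [M M0 fM] := Hinfty_bounded.
exists (M + 1); first lra.
(* Integrating on a circle strictly between r and 1 makes the remainder decay like (r/s)^N, at the
   same rate for all z with |z| = r. Once it is below 1, the partial sums are within 1 of f. *)
move=> r r0 r1; pose s := (1 + r) / 2.
have rs : r < s by rewrite /s; lra.
have s1 : s < 1 by rewrite /s; lra.
have s0 : 0 < s by lra.
pose q := r / s.
have q0 : 0 <= q by rewrite divr_ge0// ltW.
have q1 : q < 1 by rewrite ltr_pdivrMr// mul1r.
pose K := 1 + 2 * (M * (s / (s - r))).
have K0 : 0 < K.
  have : 0 <= 2 * (M * (s / (s - r))) by rewrite !mulr_ge0// ?invr_ge0; lra.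
  by rewrite /K; lra.
have : geometric K q @ \oo --> 0 by apply: cvg_geometric; rewrite ger0_norm.
move=> /cvgrPdist_le /(_ 1 ltr01) [N0 _ H]; exists N0 => N /H /=.
rewrite sub0r normrN /geometric/= ger0_norm ?mulr_ge0 ?exprn_ge0 ?(ltW K0)// => {}H z zr.
have zs : rnorm z < s by rewrite zr.
have -> : \sum_(k < N) taylor_coef f k * z ^+ k = f z - (f z - \sum_(k < N) taylor_coef f k * z ^+ k) by ring.
apply: le_trans (rnormB _ _) _; apply: lerD; first by apply: fM; rewrite zr.
rewrite (taylor_remainder N zs s1); apply: le_trans H.
apply: (@le_trans _ _ (2 * (M * (q ^+ N * (s / (s - r)))))); last first.
  rewrite (_ : 2 * (M * (q ^+ N * (s / (s - r)))) = (K - 1) * q ^+ N); last by rewrite /K; ring.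
  by rewrite ler_wpM2r ?exprn_ge0//; lra.
apply: rnorm_cmean; first exact: continuous_remainder.
move=> t _; rewrite !rnormM rnormX rnormM !rnormV rnorm_polar zr ger0_norm ?(ltW s0)//.
have h := rnorm_polar_sub t zs; rewrite zr in h.
apply: ler_pM; first exact: rnorm_ge0.
- rewrite mulr_ge0//; first by rewrite exprn_ge0.
  by rewrite mulr_ge0 ?invr_ge0 ?rnorm_ge0// ltW.
- by apply: fM; rewrite rnorm_polar ger0_norm// ltW.
- apply: ler_wpM2l; first by rewrite exprn_ge0.
  apply: ler_wpM2l; first exact: ltW.
  by rewrite lef_pV2 ?posrE//; lra.
Qed.

End Taylor.

(** * Hilbert space geometry *)

Section Complete.
Variable R : realType.
Local Notation C := (Cplx R).

Lemma gt0_real_complex (e : C) : 0 < e -> exists2 r : R, 0 < r & e = r%:C.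
Proof.
move=> e0; have eE : e = (complex.Re e)%:C by rewrite RRe_real// ger0_real// ltW.
by exists (complex.Re e) => //; move: e0; rewrite {1}eE ltcR.
Qed.

Lemma closed_rnormP (V : normedModType C) (X : set V) :
  closed X <-> forall x, (forall e : R, 0 < e -> exists2 y, X y & rnorm (y - x) <= e) -> X x.
Proof.
split=> [cX x H|H].
  rewrite (closure_id X).1// => B /near_rnorm[d d0 Bd].
  by have [y Xy yx] := H d d0; exists y; split=> //; exact: Bd.
rewrite closure_id eqEsubset; split; first exact: subset_closure.
move=> x cx; apply: H => e e0.
have [|y [Xy yx]] := cx [set y | rnorm (y - x) <= e]; last by exists y.
by apply/near_rnorm; exists e.
Qed.

(** A general filter is kept because the lemma serves both for sequences and for r increasing to
    1. *)
Lemma cauchy_rnorm_cvg (H : completeNormedModType C) (T : Type) (F : set_system T)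
    (FF : ProperFilter F) (u : T -> H) :
  (forall e : R, 0 < e -> exists2 A, F A & forall x y, A x -> A y -> rnorm (u x - u y) <= e) ->
  cvg (u @ F).
Proof.
move=> Hu; apply/cauchy_cvgP; apply/cauchy_exP => _ /gt0_real_complex[e e0 ->].
have [|A FA HA] := Hu (e / 2); first lra.
have [x Ax] := filter_ex FA; exists (u x).
rewrite fmapE; apply: filterS FA => y Ay; rewrite /= -ball_normE /ball_/= rnormE ltcR.
by apply: le_lt_trans (HA _ _ Ax Ay) _; lra.
Qed.

End Complete.

(** * The underlying real inner product and orthogonal projections *)

Section InnerProduct.
Variables (R : realType) (H : completeNormedModType (Cplx R)).
Variable dot : {dot H for (@Num.conj (Cplx R))}.
Hypothesis Hdot : hilbert_norm dot.
Local Notation C := (Cplx R).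
Implicit Types (x y z : H) (r : R).

Definition ip x y : R := complex.Re (dot x y).

Lemma ReD (a b : C) : complex.Re (a + b) = complex.Re a + complex.Re b.
Proof. by case: a b => ? ? []. Qed.
Lemma ReN (a : C) : complex.Re (- a) = - complex.Re a.
Proof. by case: a. Qed.

Lemma dotC x y : dot x y = Num.conj (dot y x).
Proof. by rewrite hermC/= expr0 mul1r. Qed.

Lemma ipC x y : ip x y = ip y x.
Proof. by rewrite /ip hermC/= expr0 mul1r; case: (dot y x). Qed.
Lemma ipDl x y z : ip (x + y) z = ip x z + ip y z.
Proof. by rewrite /ip linearDl ReD. Qed.
Lemma ipDr x y z : ip z (x + y) = ip z x + ip z y.
Proof. by rewrite ipC ipDl !(ipC z). Qed.
Lemma ipNl x y : ip (- x) y = - ip x y.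
Proof. by rewrite /ip linearNl ReN. Qed.
Lemma ipNr x y : ip x (- y) = - ip x y.
Proof. by rewrite ipC ipNl ipC. Qed.
Lemma ipBl x y z : ip (x - y) z = ip x z - ip y z.
Proof. by rewrite ipDl ipNl. Qed.
Lemma ipBr x y z : ip z (x - y) = ip z x - ip z y.
Proof. by rewrite ipDr ipNr. Qed.
Lemma ipZl r x y : ip (r%:C *: x) y = r * ip x y.
Proof. by rewrite /ip linearZl_LR/=; case: (dot x y) => a b /=; rewrite mul0r subr0. Qed.
Lemma ipZr r x y : ip x (r%:C *: y) = r * ip x y.
Proof. by rewrite ipC ipZl ipC. Qed.
Lemma ipxx x : ip x x = rnorm x ^+ 2.
Proof.
rewrite /ip -Hdot rnormE -[_ ^+ 2]/((rnorm x)%:C * (rnorm x)%:C).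
by rewrite /= mul0r subr0 -expr2.
Qed.
Lemma ip0l x : ip 0 x = 0.
Proof. by rewrite -[X in ip X](subrr x) ipBl subrr. Qed.
Lemma ip0r x : ip x 0 = 0.
Proof. by rewrite ipC ip0l. Qed.

Lemma rnormD_sqr x y : rnorm (x + y) ^+ 2 = rnorm x ^+ 2 + 2 * ip x y + rnorm y ^+ 2.
Proof. by rewrite -!ipxx ipDl !ipDr (ipC y x); ring. Qed.

Lemma rnormB_sqr x y : rnorm (x - y) ^+ 2 = rnorm x ^+ 2 - 2 * ip x y + rnorm y ^+ 2.
Proof. by rewrite rnormD_sqr ipNr rnormN; ring. Qed.

Lemma ip_le x y : ip x y <= rnorm x * rnorm y.
Proof.
have := rnormD x y; rewrite -ler_sqr ?nnegrE ?addr_ge0 ?rnorm_ge0// rnormD_sqr sqrrD.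
lra.
Qed.

Lemma norm_ip_le x y : `|ip x y| <= rnorm x * rnorm y.
Proof.
rewrite ler_norml ip_le andbT lerNl -ipNl.
by apply: le_trans (ip_le _ _) _; rewrite rnormN.
Qed.

(** Multiplying the first argument by i exposes the imaginary part. Projections and Riesz can thus
    be treated over the reals, and the complex form is recovered afterwards. *)
Lemma dot_ext x y x' y' : ip x y = ip x' y' -> ip ('i%C *: x) y = ip ('i%C *: x') y' ->
  dot x y = dot x' y'.
Proof.
rewrite /ip !linearZl_LR/=; case: (dot x y) (dot x' y') => a b [a' b'] /= ->.
by rewrite !mul0r !mul1r !sub0r => /oppr_inj ->.
Qed.

Lemma ip_eq0 x : (forall y, ip x y = 0) -> x = 0.
Proof. by move=> /(_ x)/eqP; rewrite ipxx sqrf_eq0 rnorm_eq0 => /eqP. Qed.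

Definition real_subspace (X : set H) :=
  [/\ closed X, X 0, (forall x y, X x -> X y -> X (x + y)) & forall r x, X x -> X (r%:C *: x)].

Lemma parallelogram x y :
  rnorm (x - y) ^+ 2 + rnorm (x + y) ^+ 2 = 2 * rnorm x ^+ 2 + 2 * rnorm y ^+ 2.
Proof. by rewrite rnormB_sqr rnormD_sqr; ring. Qed.

Lemma projection (X : set H) z : real_subspace X ->
  exists2 p, X p & forall x, X x -> ip (z - p) x = 0.
Proof.
move=> [cX X0 XD XZ].
pose E := [set rnorm (z - x) ^+ 2 | x in X].
have E0 : lbound E 0 by move=> _ [x _ <-]; exact: sqr_ge0.
have hE : has_lbound E by exists 0.
have Ene : E !=set0 by exists (rnorm (z - 0) ^+ 2), 0.
pose D := inf E.
have DE x : X x -> D <= rnorm (z - x) ^+ 2 by move=> Xx; apply: ge_inf => //; exists x.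
have ex n : exists x, X x /\ rnorm (z - x) ^+ 2 <= D + n.+1%:R^-1.
  have [|_ [x Xx <-] xD] := @inf_adherent R E n.+1%:R^-1 _ (conj Ene hE).
    by rewrite invr_gt0.
  by exists x; split=> //; exact: ltW.
have [u Hu] := choice ex.
(* The midpoint of x and y lies in [X], so its squared distance to z is at least [D]; the
   parallelogram law then keeps two near-minimisers close. Minimising sequences are therefore
   Cauchy. *)
have d2 x y a : X x -> X y -> rnorm (z - x) ^+ 2 <= D + a -> rnorm (z - y) ^+ 2 <= D + a ->
    rnorm (x - y) ^+ 2 <= 4 * a.
  move=> Xx Xy hx hy.
  have Xm : X ((2^-1)%:C *: (x + y)) by apply: XZ; exact: XD.
  have := DE _ Xm; have := parallelogram (z - x) (z - y).
  have -> : z - x - (z - y) = y - x by rewrite opprB addrC addrA subrK.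
  have -> : z - x + (z - y) = (2 : R)%:C *: (z - (2^-1)%:C *: (x + y)).
    rewrite scalerBr scalerA -rmorphM/= divff// scale1r.
    rewrite (_ : (2 : R)%:C = 1 + 1); last by rewrite -rmorphD.
    by rewrite scalerDl scale1r addrACA opprD.
  rewrite rnormZ rnormr ger0_norm// exprMn rdistC; lra.
have cu : cvg (u @ \oo).
  apply: cauchy_rnorm_cvg => e e0.
  pose a := e ^+ 2 / 4; have a0 : 0 < a by rewrite divr_gt0// exprn_gt0.
  have [N HN] : exists N : nat, forall n, (N <= n)%N -> n.+1%:R^-1 <= a.
    have /cvgrPdist_le /(_ a a0)[N _ HN] := @cvg_harmonic R.
    by exists N => n /HN /=; rewrite sub0r normrN ger0_norm ?invr_ge0.
  exists [set n | (N <= n)%N]; first by exists N.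
  move=> n m /= nN mN; have [Xn hn] := Hu n; have [Xm hm] := Hu m.
  rewrite -ler_sqr ?nnegrE ?rnorm_ge0 ?(ltW e0)//.
  rewrite (_ : e ^+ 2 = 4 * a); last by rewrite /a; field.
  by apply: d2 => //; [apply: le_trans hn _|apply: le_trans hm _]; rewrite lerD2l HN.
pose p := lim (u @ \oo); have /cvg_rnormP up : u @ \oo --> p := cu.
have Xp : X p.
  move/closed_rnormP: cX; apply => e e0; have [N _ /(_ N (leqnn N))/= HN] := up _ e0.
  by exists (u N); [exact: (Hu N).1|rewrite rdistC].
have pD : rnorm (z - p) ^+ 2 <= D.
  apply/ler_addgt0Pr => e e0.
  set a := rnorm (z - p); have a0 : 0 <= a := rnorm_ge0 _.
  (* Replacing [p] by a term of the sequence within [h] costs at most 2 a h <= e/2 in the squared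
     distance; the other e/2 pays for that term being only nearly minimal. *)
  pose h := e / (4 * (a + 1)).
  have h0 : 0 < h by rewrite divr_gt0//; lra.
  have ah : 2 * a * h <= e / 2.
    have -> : e / 2 = 2 * (a + 1) * h by rewrite /h; field; lra.
    by rewrite ler_wpM2r ?(ltW h0)//; lra.
  have e2 : 0 < e / 2 by lra.
  have [n [h1 h2]] : exists n, n.+1%:R^-1 <= e / 2 /\ rnorm (p - u n) <= h.
    have /cvgrPdist_le /(_ _ e2)[N _ HN] := @cvg_harmonic R.
    have [M _ HM] := up _ h0.
    exists (maxn N M); split; last by apply: HM; exact: leq_maxr.
    have := HN (maxn N M) (leq_maxl _ _).
    by rewrite /= sub0r normrN ger0_norm ?invr_ge0.
  have [_ hn] := Hu n; set b := rnorm (z - u n) in hn.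
  have ab : a <= b + h by have := rdistD (u n) z p; rewrite (rdistC (u n) p) -/a -/b; lra.
  have : a ^+ 2 - 2 * a * h <= b ^+ 2.
    have [ha|ha] := leP h a.
      have : (a - h) ^+ 2 <= b ^+ 2 by rewrite ler_sqr ?nnegrE; have := rnorm_ge0 (z - u n); rewrite -/b; lra.
      by rewrite sqrrB; have := sqr_ge0 h; lra.
    have : a ^+ 2 <= a * h by rewrite expr2 ler_wpM2l// ltW.
    by have := sqr_ge0 b; have := sqr_ge0 a; lra.
  move: hn h1; set k := _^-1; lra.
exists p => // x Xx.
(* Minimality of [p] along the line p + r x. The choice of r made below is the minimiser of this
   quadratic, which forces the inner product to vanish. *)
have V r : 0 <= r ^+ 2 * rnorm x ^+ 2 - 2 * r * ip (z - p) x.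
  have := DE (p + r%:C *: x) (XD _ _ Xp (XZ _ _ Xx)).
  rewrite opprD addrA rnormB_sqr ipZr rnormZ rnormr exprMn real_normK ?num_real//.
  lra.
have [->|x0] := eqVneq x 0; first by rewrite ip0r.
have nx : 0 < rnorm x ^+ 2 by rewrite exprn_gt0// rnorm_gt0.
have := V (ip (z - p) x / rnorm x ^+ 2).
set b := ip _ _; set n := rnorm x ^+ 2 in nx *.
have -> : (b / n) ^+ 2 * n - 2 * (b / n) * b = - (b ^+ 2 / n) by field; rewrite lt0r_neq0.
rewrite oppr_ge0 pmulr_lle0 ?invr_gt0// => b2.
by apply/eqP; rewrite -sqrf_eq0 eq_le b2 sqr_ge0.
Qed.

End InnerProduct.

(** * Adjoints and completely nonunitary contractions *)

Section Adjoint.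
Variables (R : realType) (H : completeNormedModType (Cplx R)).
Variable dot : {dot H for (@Num.conj (Cplx R))}.
Hypothesis Hdot : hilbert_norm dot.
Local Notation C := (Cplx R).
Local Notation ip := (ip dot).
Implicit Types (x y z : H) (r : R).

Lemma riesz (L : H -> R) (K : R) : (forall x y, L (x + y) = L x + L y) ->
  (forall r x, L (r%:C *: x) = r * L x) -> (forall x, `|L x| <= K * rnorm x) ->
  exists y, forall x, L x = ip x y.
Proof.
move=> LD LZ LK.
have [L0|/existsNP[z Lz]] := pselect (forall x, L x = 0).
  by exists 0 => x; rewrite L0 ip0r.
have LN x : L (- x) = - L x.
  have := LZ (-1) x; rewrite mulN1r => <-; congr L.
  by rewrite rmorphN rmorph1/= scaleN1r.
have LB x y : L (x - y) = L x - L y by rewrite LD LN.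
pose X := [set x | L x = 0].
have sX : real_subspace X.
  split.
  - apply/closed_rnormP => x Hx; apply/eqP; rewrite -normr_le0.
    apply/ler_addgt0Pr => e e0; rewrite add0r.
    have K0 : 0 < `|K| + 1 by rewrite ltr_wpDl.
    have [|y Ly yx] := Hx (e / (`|K| + 1)); first by rewrite divr_gt0.
    have -> : L x = - L (y - x) by rewrite LB Ly sub0r opprK.
    rewrite normrN; apply: le_trans (LK _) _.
    apply: (@le_trans _ _ ((`|K| + 1) * rnorm (y - x))).
      by rewrite ler_wpM2r ?rnorm_ge0//; have := ler_norm K; lra.
    by rewrite mulrC -ler_pdivlMr.
  - by rewrite /X/= -[0]subr0 LB subrr.
  - by move=> x y /= Lx Ly; rewrite /X/= LD Lx Ly addr0.
  - by move=> r x /= Lx; rewrite /X/= LZ Lx mulr0.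
have [p Lp Hp] := projection Hdot z sX.
set w := z - p in Hp.
have Lw : L w != 0 by rewrite /w LB Lp subr0; apply/eqP.
have w0 : rnorm w != 0.
  by rewrite rnorm_eq0; apply/eqP => w0; move: Lw; rewrite w0 -[0]subr0 LB subrr eqxx.
exists ((L w / rnorm w ^+ 2)%:C *: w) => x.
have Xx : X (x - (L x / L w)%:C *: w) by rewrite /X/= LB LZ divfK// subrr.
have := Hp _ Xx; rewrite ipBr ipZr ipxx// => /eqP; rewrite subr_eq0 => /eqP E.
by rewrite ipZr ipC E; field; rewrite w0 Lw.
Qed.

Section Operator.
Variables (A : H -> H) (K : R).
Hypothesis AD : forall x y, A (x + y) = A x + A y.
Hypothesis AZ : forall (a : C) x, A (a *: x) = a *: A x.
Hypothesis AK : forall x, rnorm (A x) <= K * rnorm x.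

(** Riesz represents the real part only; compatibility of A with multiplication by i lifts the
    identity to [dot]. The set in [adjoint] is then inhabited, so [xget] does not fall back on its
    default. *)
Lemma adjointP x y : dot (A x) y = dot x (adjoint dot A y).
Proof.
have [z Hz] : exists z, forall x, ip (A x) y = ip x z.
  apply: (@riesz (fun x => ip (A x) y) (K * rnorm y)).
  - by move=> a b; rewrite AD ipDl.
  - by move=> r a; rewrite AZ ipZl.
  - move=> a; apply: le_trans (norm_ip_le Hdot _ _) _.
    by rewrite mulrAC ler_wpM2r ?rnorm_ge0.
rewrite /adjoint; case: xgetP => [B -> //|/(_ z)[]] a /=.
by apply: dot_ext => //; rewrite -AZ.
Qed.

Lemma ip_adjoint x y : ip (A x) y = ip x (adjoint dot A y).
Proof. by rewrite /ip adjointP. Qed.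

End Operator.

Lemma closed_subspace_real (X : set H) : closed_subspace X -> real_subspace X.
Proof.
move=> [cX X0 XL]; split=> // [x y Xx Xy|r x Xx].
  by have := XL 1 x y Xx Xy; rewrite scale1r.
by have := XL r%:C x 0 Xx X0; rewrite addr0.
Qed.

End Adjoint.

(** * Contractions, their adjoints, and the use of complete nonunitarity *)

Section Contraction.
Variables (R : realType) (H : completeNormedModType (Cplx R)).
Variable dot : {dot H for (@Num.conj (Cplx R))}.
Hypothesis Hdot : hilbert_norm dot.
Local Notation C := (Cplx R).
Local Notation ip := (ip dot).
Implicit Types (x y z : H) (r : R).

Lemma op_norm_le (A : {linear H -> H}) x : Defs.contraction A -> rnorm (A x) <= rnorm x.
Proof.
move=> cA; have [->|x0] := eqVneq x 0; first by rewrite linear0.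
have nx : 0 < rnorm x by rewrite rnorm_gt0.
pose y : H := ((rnorm x)^-1)%:C *: x.
have y1 : rnorm y = 1.
  by rewrite rnormZ rnormr ger0_norm ?invr_ge0 ?(ltW nx)// mulVf// lt0r_neq0.
have : ((rnorm (A y))%:E <= 1%:E)%E.
  apply: le_trans cA; apply: ereal_sup_ubound; exists y => //=.
  by rewrite rnormE y1.
by rewrite lee_fin linearZ/= rnormZ rnormr ger0_norm ?invr_ge0 ?(ltW nx)// mulrC ler_pdivrMr// mul1r.
Qed.

Variable T : {linear H -> H}.
Hypothesis cT : Defs.contraction T.
Local Notation Ts := (adjoint dot T).

Lemma contrT x : rnorm (T x) <= rnorm x. Proof. exact: op_norm_le. Qed.

Let TK x : rnorm (T x) <= 1 * rnorm x. Proof. by rewrite mul1r contrT. Qed.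

Lemma dot_adj x y : dot (T x) y = dot x (Ts y).
Proof.
apply: (adjointP Hdot _ _ TK) => [u v|a u]; first exact: linearD.
by rewrite linearZ.
Qed.

Lemma ip_adj x y : ip (T x) y = ip x (Ts y).
Proof. by rewrite /ip dot_adj. Qed.

Lemma ip_adjl x y : ip (Ts x) y = ip x (T y).
Proof. by rewrite ipC -ip_adj ipC. Qed.

Lemma adjD x y : Ts (x + y) = Ts x + Ts y.
Proof.
apply/eqP; rewrite -subr_eq0; apply/eqP; apply: (ip_eq0 Hdot) => z.
by rewrite ipBl ipDl !ip_adjl ipDl subrr.
Qed.

Lemma adjZ (a : C) x : Ts (a *: x) = a *: Ts x.
Proof.
apply/eqP; rewrite -subr_eq0; apply/eqP; apply: (ip_eq0 Hdot) => z.
have E (b : C) u v : ip (b *: u) v = complex.Re (b * dot u v) by rewrite /ip linearZl_LR.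
rewrite ipBl ip_adjl !E.
suff -> : dot (Ts x) z = dot x (T z) by rewrite subrr.
by rewrite (dotC dot (Ts x)) -dot_adj -dotC.
Qed.

Lemma contrTs x : rnorm (Ts x) <= rnorm x.
Proof.
have [->|x0] := eqVneq (Ts x) 0; first by rewrite rnorm0 rnorm_ge0.
have nx : 0 < rnorm (Ts x) by rewrite rnorm_gt0.
rewrite -(ler_pM2l nx) -expr2 -(ipxx Hdot) ip_adjl.
apply: le_trans (ip_le Hdot _ _) _; rewrite mulrC ler_wpM2r ?rnorm_ge0//.
exact: contrT.
Qed.

(** The operator 1 - T Ts is self-adjoint, so being orthogonal to its range means lying in its
    kernel. *)
Lemma TTs_id z : (forall y, ip z (y - T (Ts y)) = 0) -> T (Ts z) = z.
Proof.
move=> Hz; apply/esym/eqP; rewrite -subr_eq0; apply/eqP; apply: (ip_eq0 Hdot) => y.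
by have := Hz y; rewrite ipBr ipBl -ip_adjl -ip_adj.
Qed.

(* A closed subspace X as below is everything: T and its adjoint are mutually
   inverse isometries on the orthogonal complement of X, which is reducing. *)
Lemma cnu_ind (X : set H) : completely_nonunitary dot T ->
  closed_subspace X -> (forall x, X x -> X (T x)) -> (forall x, X (T x) -> X x) ->
  (forall y, X (y - T (Ts y))) -> forall x, X x.
Proof.
move=> cnu sX XT XT' XD.
have rX := closed_subspace_real sX; have [cX X0 XA XZ] := rX.
pose M := [set z | forall x, X x -> ip z x = 0].
have MT z : M z -> T (Ts z) = z by move=> Mz; apply: TTs_id => y; exact: Mz.
have MTs z : M z -> M (Ts z) by move=> Mz x Xx; rewrite ip_adjl; apply: Mz; exact: XT.
have XM0 z : X z -> M z -> z = 0.
  by move=> Xz /(_ z Xz)/eqP; rewrite ipxx// sqrf_eq0 rnorm_eq0 => /eqP.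
have XB x y : X x -> X y -> X (x - y).
  by move=> Xx Xy; have := XZ (-1) y Xy; rewrite rmorphN rmorph1/= scaleN1r; exact: XA.
have MB x y : M x -> M y -> M (x - y).
  by move=> Mx My z Xz; rewrite ipBl Mx// My// subrr.
have split z : exists2 p, X p & M (z - p) by exact: projection.
(* Let p be the component of T z in [X] and m = T z - p. Then z - Ts m lies in [M], and T maps it to
   p, so stability under preimages puts it in [X] as well: it is 0. *)
have Tinv z : M z -> exists2 m, M m & z = Ts m.
  move=> Mz; have [p Xp Mm] := split (T z); exists (T z - p) => //.
  apply/eqP; rewrite -subr_eq0; apply/eqP; apply: XM0; last exact: MB (MTs _ Mm).
  by apply: XT'; rewrite linearB/= MT// opprB addrC subrK.
have MTz z : M z -> M (T z) by move=> /Tinv[m Mm ->]; rewrite MT.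
have sM : closed_subspace M.
  split.
  - apply/closed_rnormP => x Hx y Xy; apply/eqP; rewrite -normr_le0.
    apply/ler_addgt0Pr => e e0; rewrite add0r.
    have y0 : 0 < rnorm y + 1 by rewrite ltr_wpDl ?rnorm_ge0.
    have [|z Mz zx] := Hx (e / (rnorm y + 1)); first by rewrite divr_gt0.
    have -> : ip x y = - ip (z - x) y by rewrite ipBl (Mz y Xy) sub0r opprK.
    rewrite normrN; apply: le_trans (norm_ip_le Hdot _ _) _.
    apply: (@le_trans _ _ (rnorm (z - x) * (rnorm y + 1))).
      by rewrite ler_wpM2l ?rnorm_ge0//; lra.
    by rewrite -ler_pdivlMr.
  - by move=> x _; rewrite ip0l.
  - move=> a x y Mx My z Xz; rewrite ipDl (My z Xz) addr0.
    (* Orthogonality is tested with real parts only; stability of [X] under complex scalars is what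
       makes [M] a complex subspace. *)
    have XCZ (b : C) : X (b *: z) by case: sX => _ _ /(_ b z 0 Xz X0); rewrite addr0.
    by have := Mx _ (XCZ (Num.conj a)); rewrite /ip linearZl_LR linearZr_LR/= conjCK.
have redM : reducing dot T M.
  by split=> // _ [z Mz <-]; [exact: MTz|exact: MTs].
have uniM : unitary_on dot T M.
  split.
    move=> x y Mx /Tinv[m Mm ->]; rewrite MT//.
    by rewrite dot_adj.
  apply/seteqP; split=> [_ [z Mz <-]|z Mz]; first exact: MTz.
  by exists (Ts z); [exact: MTs|exact: MT].
have ME := cnu M redM uniM.
move=> x; have [p Xp] := split x; rewrite ME => /= /eqP; rewrite subr_eq0 => /eqP ->.
exact: Xp.
Qed.

End Contraction.

(** * Von Neumann's inequality *)

Section Parseval.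
Variables (R : realType) (H : completeNormedModType (Cplx R)).
Variable dot : {dot H for (@Num.conj (Cplx R))}.
Hypothesis Hdot : hilbert_norm dot.
Local Notation C := (Cplx R).
Implicit Types (x y z : H) (r : R).

Lemma prim_root_exists n : (0 < n)%N -> exists w : C, n.-primitive_root w.
Proof.
move=> n0; have [s] := closed_field_poly_normal ('X^n - 1 : {poly C}).
rewrite (monicP (monicXnsubC _ n0)) scale1r => Es.
have us : uniq s.
  rewrite -separable.separable_prod_XsubC -Es.
  by apply: cyclotomic.separable_Xn_sub_1; rewrite pnatr_eq0 -lt0n.
have rs : all n.-unity_root s.
  by apply/allP => w ws; rewrite /root_of_unity Es root_prod_XsubC.
have ns : (n <= size s)%N by rewrite -ltnS -(size_prod_XsubC s id) -Es size_XnsubC.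
by have /hasP[w _ wP] := cyclic.has_prim_root n0 rs us ns; exists w.
Qed.

Lemma rnorm_unity_root n (w : C) : (0 < n)%N -> w ^+ n = 1 -> rnorm w = 1.
Proof.
move=> n0 wn; have := congr1 (@rnorm R C) wn; rewrite rnormX rnorm1 => /eqP.
by rewrite pexpr_eq1 ?rnorm_ge0// => /eqP.
Qed.

Lemma sum_prim_root L (w : C) n m : L.-primitive_root w -> (n < L)%N -> (m < L)%N ->
  \sum_(k < L) (w ^+ k) ^+ n * Num.conj ((w ^+ k) ^+ m) = (n == m)%:R * L%:R.
Proof.
move=> wL nL mL; have L0 := prim_order_gt0 wL.
have w1 : rnorm w = 1 := rnorm_unity_root L0 (prim_expr_order wL).
have wV : Num.conj w = w^-1.
  by rewrite invC_norm [`|w|]rnormE w1 expr1n invr1 mul1r.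
have w0 : w != 0 by rewrite -rnorm_eq0 w1 oner_eq0.
pose u := w ^+ n / w ^+ m.
under eq_bigr => k _.
  rewrite !rmorphXn/= wV -!exprM [(k * n)%N]mulnC [(k * m)%N]mulnC !exprM exprVn -exprMn -/u.
  over.
have uL : u ^+ L = 1.
  by rewrite expr_div_n -!exprM ![(_ * L)%N]mulnC !exprM (prim_expr_order wL) !expr1n divr1.
have [nm|nm] := eqVneq n m.
  rewrite /= mul1r /u nm divff ?expf_neq0//.
  under eq_bigr do rewrite expr1n.
  by rewrite sumr_const card_ord.
rewrite mul0r; have : (u - 1) * \sum_(i < L) u ^+ i = 0 by rewrite -subrX1 uL subrr.
move/eqP; rewrite mulf_eq0 subr_eq0 => /orP[|/eqP//].
rewrite /u -(inj_eq (mulIf (expf_neq0 m w0))) divfK ?expf_neq0// mul1r.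
by rewrite (eq_prim_root_expr wL) !modn_small// (negbTE nm).
Qed.

Lemma dotxx x : dot x x = (rnorm x ^+ 2)%:C.
Proof. by rewrite -Hdot rnormE rmorphXn. Qed.

Lemma dotDl x y z : dot (x + y) z = dot x z + dot y z.
Proof. exact: linearDl. Qed.

Lemma dotDr x y z : dot z (x + y) = dot z x + dot z y.
Proof. exact: linearDr. Qed.

Lemma dotZZ (a b : C) x y : dot (a *: x) (b *: y) = a * Num.conj b * dot x y.
Proof. by rewrite linearZl_LR linearZr_LR/= mulrA. Qed.

Lemma dot_suml (I : Type) (s : seq I) (F : I -> H) y :
  dot (\sum_(i <- s) F i) y = \sum_(i <- s) dot (F i) y.
Proof.
elim: s => [|a s IH]; first by rewrite !big_nil linear0l.
by rewrite !big_cons dotDl IH.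
Qed.

Lemma dot_sumr (I : Type) (s : seq I) (F : I -> H) y :
  dot y (\sum_(i <- s) F i) = \sum_(i <- s) dot y (F i).
Proof.
elim: s => [|a s IH]; first by rewrite !big_nil linear0r.
by rewrite !big_cons dotDr IH.
Qed.

Lemma dot_lincomb n (a : nat -> C) (v : nat -> H) :
  dot (\sum_(i < n) a i *: v i) (\sum_(i < n) a i *: v i) =
  \sum_(i < n) \sum_(j < n) a i * Num.conj (a j) * dot (v i) (v j).
Proof.
rewrite dot_suml; apply: eq_bigr => i _.
by rewrite dot_sumr; apply: eq_bigr => j _; rewrite dotZZ.
Qed.

(** Discrete Fourier transform on the L-th roots of unity: the characters are orthogonal, so only
    the diagonal terms of the double sum survive. *)
Lemma parseval L (w : C) (v : nat -> H) : L.-primitive_root w ->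
  \sum_(k < L) rnorm (\sum_(n < L) (w ^+ k) ^+ n *: v n) ^+ 2 =
  L%:R * \sum_(n < L) rnorm (v n) ^+ 2.
Proof.
move=> wL; apply: (@real_complexI R).
rewrite rmorph_sum rmorphM/= rmorph_sum/= rmorph_nat.
under eq_bigr => k _ do rewrite -dotxx (@dot_lincomb L (fun n => (w ^+ k) ^+ n)).
rewrite exchange_big/= mulr_sumr; apply: eq_bigr => n _.
rewrite exchange_big/= (bigD1 n)//= [X in _ + X]big1 ?addr0.
  rewrite -mulr_suml (sum_prim_root wL (ltn_ord n) (ltn_ord n)) eqxx mul1r.
  by rewrite dotxx.
move=> m mn; rewrite -mulr_suml (sum_prim_root wL (ltn_ord n) (ltn_ord m)).
by rewrite -[n == m :> nat]/(n == m) eq_sym (negbTE mn) !mul0r.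
Qed.

End Parseval.

(** * The defect form and polynomials in a contraction *)

Section VonNeumann.
Variables (R : realType) (H : completeNormedModType (Cplx R)).
Variable dot : {dot H for (@Num.conj (Cplx R))}.
Hypothesis Hdot : hilbert_norm dot.
Local Notation C := (Cplx R).
Implicit Types (x y z : H) (r : R).

(** For a bounded linear S, this is the quadratic form of 1 - S^* S. *)
Definition defect (S : H -> H) x : R := rnorm x ^+ 2 - rnorm (S x) ^+ 2.

Lemma defect_telescope (S : H -> H) n x :
  \sum_(i < n) defect S (iter i S x) = rnorm x ^+ 2 - rnorm (iter n S x) ^+ 2.
Proof.
elim: n => [|n IH]; first by rewrite big_ord0 subrr.
by rewrite big_ord_recr/= IH /defect; ring.
Qed.

Lemma defect_ge0 (S : H -> H) x : rnorm (S x) <= rnorm x -> 0 <= defect S x.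
Proof. by move=> h; rewrite subr_ge0 ler_sqr ?nnegrE ?rnorm_ge0. Qed.

Section Defect.
Variable S : {linear H -> H}.
Hypothesis cS : forall x, rnorm (S x) <= rnorm x.

Lemma linZ (a : C) x : S (a *: x) = a *: S x.
Proof. by rewrite linearZ. Qed.

Local Notation defect := (defect S).

Lemma defectZ (a : C) x : defect (a *: x) = rnorm a ^+ 2 * defect x.
Proof. by rewrite /defect linZ !rnormZ !exprMn mulrBr. Qed.

(** The form is a difference of two squared norms, and S commutes with the Fourier sums, so Parseval
    holds for each of the two norms. *)
Lemma parseval_defect L (w : C) (v : nat -> H) : L.-primitive_root w ->
  \sum_(k < L) defect (\sum_(n < L) (w ^+ k) ^+ n *: v n) =
  L%:R * \sum_(n < L) defect (v n).
Proof.
move=> wL; rewrite sumrB (parseval Hdot _ wL).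
have -> : \sum_(k < L) rnorm (S (\sum_(n < L) (w ^+ k) ^+ n *: v n)) ^+ 2 =
    \sum_(k < L) rnorm (\sum_(n < L) (w ^+ k) ^+ n *: (S \o v) n) ^+ 2.
  apply: eq_bigr => k _; rewrite linear_sum; congr (_ ^+ _); congr rnorm.
  by apply: eq_bigr => n _; rewrite linZ.
by rewrite (parseval Hdot _ wL) -mulrBr -sumrB.
Qed.

(** The length [L] leaves room for the full support of the convolution, so no term is lost when the
    sum is cut at [L]. *)
Lemma conv_sum (c : nat -> C) (h : nat -> H) N M L (z : C) : (N + M <= L)%N ->
  (forall m, (M <= m)%N -> h m = 0) ->
  \sum_(n < L) z ^+ n *: (\sum_(j < N | (j <= n)%N) c j *: h (n - j)%N) =
  (\sum_(j < N) c j * z ^+ j) *: \sum_(m < L) z ^+ m *: h m.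
Proof.
move=> NML h0.
have tail K : (M <= K)%N -> \sum_(m < K) z ^+ m *: h m = \sum_(m < M) z ^+ m *: h m.
  move=> MK; rewrite -!(big_mkord predT (fun m => z ^+ m *: h m)) (big_cat_nat (n := M))//=.
  rewrite [X in _ + X]big_nat_cond [X in _ + X]big1 ?addr0// => m; rewrite andbT => /andP[Mm _].
  by rewrite h0// scaler0.
under eq_bigr do rewrite scaler_sumr.
rewrite (exchange_big_dep predT)//= scaler_suml; apply: eq_bigr => j _.
rewrite -(big_geq_mkord j L predT (fun n => z ^+ n *: (c j *: h (n - j)%N))).
rewrite -{1}[nat_of_ord j]add0n big_addn big_mkord.
rewrite (eq_bigr (fun i : 'I_(L - j) => (c j * z ^+ j) *: (z ^+ i *: h i))).
  rewrite -scaler_sumr.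
  rewrite !tail//.
    by apply: leq_trans NML; exact: leq_addl.
  rewrite leq_subRL; last by apply: leq_trans NML; rewrite (leq_trans (ltnW (ltn_ord j)))// leq_addr.
  by apply: leq_trans NML; rewrite leq_add2r ltnW.
move=> i _; rewrite (_ : (i + j - j)%N = i :> nat); last exact: addnK.
by rewrite exprD !scalerA; congr (_ *: _); ring.
Qed.

(* Parseval over the (M + N)-th roots of unity, where the convolution of c and h
   becomes a pointwise product. *)
Lemma conv_defect_le (c : nat -> C) (h : nat -> H) N M (K : R) : (0 < M)%N ->
  (forall z : C, rnorm z = 1 -> rnorm (\sum_(j < N) c j * z ^+ j) <= K) ->
  (forall m, (M <= m)%N -> h m = 0) ->
  \sum_(n < M) defect (\sum_(j < N | (j <= n)%N) c j *: h (n - j)%N) <=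
  K ^+ 2 * \sum_(m < M) defect (h m).
Proof.
move=> M0 cK h0; pose L := (M + N)%N.
have L0 : (0 < L)%N by rewrite addn_gt0 M0.
have [w wL] := prim_root_exists R L0.
pose v n := \sum_(j < N | (j <= n)%N) c j *: h (n - j)%N.
have d0 : defect 0 = 0 by rewrite /defect linear0 subrr.
have hL : \sum_(m < L) defect (h m) = \sum_(m < M) defect (h m).
  rewrite /L big_split_ord/= [X in _ + X]big1 ?addr0// => i _.
  by rewrite h0 ?d0// leq_addr.
have vL : \sum_(n < M) defect (v n) <= \sum_(n < L) defect (v n).
  rewrite /L big_split_ord/= lerDl; apply: sumr_ge0 => i _; exact/defect_ge0.
have L0' : 0 < L%:R :> R by rewrite ltr0n.
apply: le_trans vL _; rewrite -hL -(ler_pM2l L0').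
rewrite -(parseval_defect v wL) mulrCA -(parseval_defect h wL) mulr_sumr.
apply: ler_sum => k _; rewrite (@conv_sum c h N M L) ?[(N + M)%N]addnC// defectZ.
apply: ler_wpM2r; first exact/defect_ge0.
rewrite lerXn2r ?nnegrE ?rnorm_ge0//.
  (* Evaluation at z = 1 shows that [K] is nonnegative. *)
  by apply: le_trans (cK 1 _); rewrite ?rnorm1 ?rnorm_ge0.
apply: cK; rewrite rnormX (rnorm_unity_root L0 (prim_expr_order wL)).
by rewrite expr1n.
Qed.

Lemma iter_sum n (I : Type) (s : seq I) (P : pred I) (F : I -> H) :
  iter n S (\sum_(i <- s | P i) F i) = \sum_(i <- s | P i) iter n S (F i).
Proof. by elim: n => [//|n IH] /=; rewrite IH linear_sum. Qed.

Lemma iterZ n (a : C) x : iter n S (a *: x) = a *: iter n S x.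
Proof. by elim: n => [//|n IH] /=; rewrite IH linZ. Qed.

(* von Neumann's inequality, up to a term that tends to 0 with k when S is a
   strict contraction. *)
Lemma poly_op_le (c : nat -> C) N (K : R) x k :
  (forall z : C, rnorm z = 1 -> rnorm (\sum_(j < N) c j * z ^+ j) <= K) ->
  rnorm (\sum_(j < N) c j *: iter j S x) ^+ 2 <=
  K ^+ 2 * rnorm x ^+ 2 + rnorm (iter k S (\sum_(j < N) c j *: iter j S x)) ^+ 2.
Proof.
move=> cK; set p := \sum_(j < N) _.
pose M := (k + N)%N.
have [M0|M0] := posnP M.
  move/eqP: M0; rewrite addn_eq0 => /andP[/eqP -> /eqP N0] /=.
  by rewrite lerDr mulr_ge0// sqr_ge0.
(* The orbit of x in reverse order. Convolving it with [c] gives S^(M-1-n) p at every index n >= N,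
   so defects along the orbit of p appear on the left and those along the orbit of x on the
   right. *)
pose h m := if (m < M)%N then iter (M - m.+1)%N S x else 0.
have h0 m : (M <= m)%N -> h m = 0 by rewrite /h ltnNge => ->.
have := conv_defect_le M0 cK h0.
have -> : \sum_(m < M) defect (h m) = \sum_(m < M) defect (iter m S x).
  rewrite (reindex_inj rev_ord_inj)/=; apply: eq_bigr => m _; congr defect.
  have mM := ltn_ord m.
  rewrite /h ifT; last by rewrite ltn_subrL M0.
  by congr iter; rewrite subnSK// subKn// ltnW.
(* Read backwards, the first [k] indices are those where the convolution is complete; they telescope
   to |p|^2 - |S^k p|^2. The remaining [N] terms are nonnegative and are dropped. *)
rewrite defect_telescope (reindex_inj rev_ord_inj)/= {1}/M big_split_ord/=.
have -> : \sum_(i < k) defect (\sum_(j < N | (j <= M - (lshift N i).+1)%N) c j *: h (M - (lshift N i).+1 - j)%N) =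
    \sum_(i < k) defect (iter i S p).
  apply: eq_bigr => i _; congr defect; rewrite iter_sum.
  have ik := ltn_ord i.
  have Mi : (N <= M - i.+1)%N by rewrite /M addnC -addnBA// leq_addr.
  apply: eq_big => [j|j _]; first by rewrite /= (leq_trans (ltnW (ltn_ord j)) Mi).
  have jM : (j <= M - i.+1)%N by rewrite (leq_trans (ltnW (ltn_ord j)) Mi).
  have iM : (i < M)%N by rewrite (leq_trans ik)// /M leq_addr.
  rewrite iterZ -iterD /h ifT/=; last first.
    by rewrite -subnDA ltn_subrL M0.
  congr (_ *: _); congr iter.
  have ijM : (i + j < M)%N by move: jM; rewrite leq_subRL.
  by rewrite -subnDA addSn subnSK// subKn// ltnW.
rewrite defect_telescope; set Z := \sum_(i < N) _ => E.
have Z0 : 0 <= Z by apply: sumr_ge0 => i _; exact/defect_ge0.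
have := sqr_ge0 (rnorm (iter M S x)); have := sqr_ge0 K; nra.
Qed.

End Defect.

End VonNeumann.

(** * The functional calculus *)

Section Dilation.
Variables (R : realType) (H : completeNormedModType (Cplx R)).
Variable dot : {dot H for (@Num.conj (Cplx R))}.
Hypothesis Hdot : hilbert_norm dot.
Local Notation C := (Cplx R).
Implicit Types (x y z : H) (r s e : R) (a : nat -> C).

Lemma nondecreasing_cauchy (u : nat -> R) B : (forall n, u n <= u n.+1) ->
  (forall n, u n <= B) -> forall e, 0 < e -> exists N, forall n, (N <= n)%N -> u n - u N <= e.
Proof.
move=> um uB e e0.
have mono m n : (m <= n)%N -> u m <= u n.
  move=> /subnKC <-; elim: (n - m)%N => [|k]; first by rewrite addn0.
  by move=> /le_trans; apply; rewrite addnS.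
have hs : has_sup (range u).
  by split; [exists (u 0%N); exists 0%N|exists B => _ [n _ <-]].
have [_ [N _ <-] hN] := sup_adherent e0 hs.
exists N => n Nn; have : u n <= sup (range u) by apply: sup_upper_bound => //; exists n.
lra.
Qed.

(* Keeping r away from 0 makes the class stable under the backward shift. *)
Definition bounded_symbol a (M : R) := 0 <= M /\ forall r, 1 / 2 <= r -> r < 1 ->
  exists N0, forall N, (N0 <= N)%N -> forall z : C, rnorm z = r ->
    rnorm (\sum_(k < N) a k * z ^+ k) <= M.

Definition shift a k := a k.+1.

(** Remove the constant term and divide by z: since |z| >= 1/2, this costs the factor 2. *)
Lemma bounded_symbol_shift a M : bounded_symbol a M ->
  bounded_symbol (shift a) (2 * (M + rnorm (a 0%N))).
Proof.
move=> [M0 aM]; have a0 := rnorm_ge0 (a 0%N); split; first by lra.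
move=> r r2 r1; have [N0 H0] := aM r r2 r1.
exists N0 => N NN0 z zr; have := H0 N.+1 (leqW NN0) z zr.
rewrite big_ord_recl/= expr0 mulr1 => H1.
have : rnorm (z * \sum_(k < N) shift a k * z ^+ k) <= M + rnorm (a 0%N).
  apply: (@le_trans _ _ (rnorm (a 0%N + \sum_(i < N) a (bump 0 i) * z ^+ bump 0 i - a 0%N))).
    rewrite [a 0%N + _]addrC addrK mulr_sumr le_eqVlt; apply/orP; left; apply/eqP; congr rnorm.
    by apply: eq_bigr => k _; rewrite /shift /bump /= add1n exprS; ring.
  by apply: le_trans (rnormB _ _) _; rewrite lerD2r.
rewrite rnormM zr => h2.
have S0 := rnorm_ge0 (\sum_(k < N) shift a k * z ^+ k).
have : 1 / 2 * rnorm (\sum_(k < N) shift a k * z ^+ k) <= r * rnorm (\sum_(k < N) shift a k * z ^+ k).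
  by rewrite ler_wpM2r.
lra.
Qed.

Lemma pow_near1 n e : 0 < e -> exists2 d, d < 1 & forall r, d <= r -> r < 1 -> `|r ^+ n - 1| <= e.
Proof.
move=> e0; have : (fun r : R => r ^+ n) @ (1 : R) --> (1 : R) ^+ n by exact: exprn_continuous.
rewrite expr1n => /cvgrPdist_le /(_ e e0) /nbhs_ballP[d /= d0 Hd].
exists (1 - d / 2); first lra.
move=> r rd r1; rewrite distrC; apply: Hd; rewrite -ball_normE/= ger0_norm; lra.
Qed.

(** Parseval on a circle of radius r < 1 bounds the l^2 norm of the coefficients a_k r^k by the
    supremum M; then r tends to 1. The factor |x|^2 is kept because Parseval is stated in [H], which
    may be zero. *)
Lemma coef_l2 a M K x : bounded_symbol a M ->
  \sum_(k < K) rnorm (a k) ^+ 2 * rnorm x ^+ 2 <= M ^+ 2 * rnorm x ^+ 2.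
Proof.
move=> [M0 aM].
set A := \sum_(k < K) _.
have A0 : 0 <= A by apply: sumr_ge0 => i _; rewrite mulr_ge0// sqr_ge0.
have key r : 1 / 2 <= r -> r < 1 -> r ^+ (2 * K) * A <= M ^+ 2 * rnorm x ^+ 2.
  move=> r2 r1; have [N0 H0] := aM r r2 r1.
  have r0 : 0 <= r by lra.
  (* Long enough both for the partial sum to be bounded by [M] and for the first [K] coefficients to
     be included. *)
  pose L := maxn N0 K.+1.
  have L0 : (0 < L)%N by rewrite leq_max orbT.
  have [w wL] := prim_root_exists R L0.
  have := parseval Hdot (fun n => (a n * r%:C ^+ n) *: x) wL.
  set P := \sum_(k < L) _; set Q := \sum_(n < L) _ => PQ.
  have hP : P <= L%:R * (M ^+ 2 * rnorm x ^+ 2).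
    have HB (k : 'I_L) : rnorm (\sum_(n < L) (w ^+ k) ^+ n *: ((a n * r%:C ^+ n) *: x)) ^+ 2 <= M ^+ 2 * rnorm x ^+ 2.
      have -> : \sum_(n < L) (w ^+ k) ^+ n *: ((a n * r%:C ^+ n) *: x) =
          (\sum_(n < L) a n * (r%:C * w ^+ k) ^+ n) *: x.
        rewrite scaler_suml; apply: eq_bigr => n _; rewrite scalerA exprMn; congr (_ *: _); ring.
      rewrite rnormZ exprMn ler_wpM2r ?sqr_ge0// lerXn2r ?nnegrE ?rnorm_ge0//.
      apply: H0; first exact: leq_maxl.
      by rewrite rnormM rnormX (rnorm_unity_root L0 (prim_expr_order wL)) expr1n mulr1 rnormr ger0_norm.
    apply: le_trans (ler_sum _ (fun k _ => HB k)) _.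
    by rewrite sumr_const card_ord mulr_natl.
  have L0' : 0 < L%:R :> R by rewrite ltr0n.
  rewrite PQ ler_pM2l// in hP; apply: le_trans hP.
  have KL : (K <= L)%N by rewrite leq_max leqnSn orbT.
  rewrite /Q /A -(subnKC KL) big_split_ord/= mulr_sumr -[leLHS]addr0; apply: lerD; last first.
    by apply: sumr_ge0 => i _; exact: sqr_ge0.
  apply: ler_sum => n _; rewrite rnormZ rnormM rnormX rnormr (ger0_norm r0) !exprMn.
  rewrite mulrA; apply: ler_wpM2r; first exact: sqr_ge0.
  rewrite mulrC; apply: ler_wpM2l; first exact: sqr_ge0.
  rewrite -exprM; apply: ler_wiXn2l => //; first exact: ltW.
  by rewrite mulnC leq_mul2l ltnW.
set B := M ^+ 2 * _ in key *.
apply/ler_addgt0Pr => e e0.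
have h : 0 < e / (A + 1) by rewrite divr_gt0//; lra.
have [d d1 Hd] := pow_near1 (2 * K) h.
pose r := Num.max d (1 / 2).
have r1 : r < 1 by rewrite gt_max d1; lra.
have := Hd r; rewrite /r le_max lexx -/r => /(_ isT r1).
have := key r; rewrite /r le_max lexx orbT -/r => /(_ isT r1).
set q := r ^+ _ => k1; rewrite distrC => /ler_normlW k2.
have : (1 - q) * A <= e.
  apply: (@le_trans _ _ (e / (A + 1) * A)); first by rewrite ler_wpM2r.
  by rewrite mulrAC ler_pdivrMr; [rewrite ler_wpM2l//; lra|lra].
lra.
Qed.

Variable T : {linear H -> H}.
Hypothesis cT : forall x, rnorm (T x) <= rnorm x.

Lemma iter_contr n x : rnorm (iter n T x) <= rnorm x.
Proof. by elim: n => [//|n IH] /=; apply: le_trans (cT _) IH. Qed.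

Definition psum a r N x : H := \sum_(k < N) (a k * r%:C ^+ k) *: iter k T x.

Lemma psum_lin a r N (c : C) x y : psum a r N (c *: x + y) = c *: psum a r N x + psum a r N y.
Proof.
rewrite /psum scaler_sumr -big_split/=; apply: eq_bigr => k _.
have -> : iter k T (c *: x + y) = c *: iter k T x + iter k T y.
  by elim: (nat_of_ord k) => [//|n IH] /=; rewrite IH linearP.
by rewrite scalerDr !scalerA [c * _]mulrC.
Qed.

Lemma psum_T a r N x : psum a r N (T x) = T (psum a r N x).
Proof.
rewrite /psum linear_sum; apply: eq_bigr => k _.
by rewrite linZ -iterSr.
Qed.

Lemma psum_shift a r N x : psum a r N.+1 x = a 0%N *: x + r%:C *: psum (shift a) r N (T x).
Proof.
rewrite /psum big_ord_recl/= expr0 mulr1; congr (_ + _); rewrite scaler_sumr.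
apply: eq_bigr => k _; rewrite scalerA /shift /bump/= add1n -iterS iterSr exprS; congr (_ *: _).
ring.
Qed.

(** With s = sqrt r, a_k r^k T^k = (a_k s^k)(sT)^k. The polynomial with coefficients a_k s^k is
    bounded by [M] on the unit circle, and the extra term of [poly_op_le] vanishes in the limit
    because sT is a strict contraction. The condition r >= 1/4 ensures s >= 1/2, as [bounded_symbol]
    demands. *)
Lemma psum_le a M r : bounded_symbol a M -> 1 / 4 <= r -> r < 1 ->
  exists N0, forall N, (N0 <= N)%N -> forall x, rnorm (psum a r N x) <= M * rnorm x.
Proof.
move=> [M0 aM] r4 r1; pose s := Num.sqrt r.
have r0 : 0 <= r by lra.
have s0 : 0 <= s by exact: sqrtr_ge0.
have ss : s ^+ 2 = r by rewrite sqr_sqrtr.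
have s1 : s < 1 by rewrite -(@ltr_pXn2r _ 2)// ?nnegrE// expr1n ss.
have s2 : 1 / 2 <= s.
  by rewrite leNgt; apply/negP => h; move: ss; rewrite expr2; nra.
have [N0 H0] := aM s s2 s1; exists N0 => N NN0 x.
have [S SE] : exists S : {linear H -> H}, forall y, S y = s%:C *: T y.
  by exists (s%:C \*: T).
have cS y : rnorm (S y) <= s * rnorm y.
  by rewrite SE rnormZ rnormr ger0_norm// ler_wpM2l.
have cS1 y : rnorm (S y) <= rnorm y.
  by apply: le_trans (cS y) _; rewrite ler_piMl ?rnorm_ge0// ltW.
have Sk k y : iter k S y = s%:C ^+ k *: iter k T y.
  elim: k => [|k IH] /=; first by rewrite expr0 scale1r.
  by rewrite IH SE linZ scalerA exprS.
have Sn k y : rnorm (iter k S y) <= s ^+ k * rnorm y.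
  by rewrite Sk rnormZ rnormX rnormr ger0_norm// ler_wpM2l ?exprn_ge0// iter_contr.
pose c k := a k * s%:C ^+ k.
have cK (z : C) : rnorm z = 1 -> rnorm (\sum_(j < N) c j * z ^+ j) <= M.
  move=> z1; rewrite (eq_bigr (fun j : 'I_N => a j * (s%:C * z) ^+ j)); last first.
    by move=> j _; rewrite /c exprMn mulrA.
  by apply: H0 => //; rewrite rnormM rnormr z1 mulr1 ger0_norm.
have := poly_op_le Hdot cS1 x _ cK.
have -> : \sum_(j < N) c j *: iter j S x = psum a r N x.
  have cE j : c j * s%:C ^+ j = a j * r%:C ^+ j.
    by rewrite /c -ss rmorphXn/= expr2 exprMn mulrA.
  by apply: eq_bigr => j _; rewrite Sk scalerA cE.
set p := psum a r N x => key.
rewrite -ler_sqr ?nnegrE ?mulr_ge0 ?rnorm_ge0// exprMn.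
apply/ler_addgt0Pr => e e0.
have h : 0 < e / (rnorm p ^+ 2 + 1) by rewrite divr_gt0// ltr_wpDl ?sqr_ge0.
have : (fun k => s ^+ k) @ \oo --> 0 by apply: cvg_expr; rewrite ger0_norm.
move=> /cvgrPdist_le /(_ _ h) [k _ /(_ k (leqnn k))] /=.
rewrite sub0r normrN ger0_norm ?exprn_ge0// => hk.
apply: le_trans (key k) _; rewrite lerD2l.
have P0 := sqr_ge0 (rnorm p).
apply: (@le_trans _ _ (s ^+ k * rnorm p ^+ 2)).
  apply: (@le_trans _ _ ((s ^+ k * rnorm p) ^+ 2)).
    by rewrite ler_sqr ?nnegrE ?mulr_ge0 ?exprn_ge0 ?rnorm_ge0.
  rewrite exprMn; apply: ler_wpM2r => //.
  by rewrite expr2 ler_piMl ?exprn_ge0// exprn_ile1// ltW.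
apply: (@le_trans _ _ (e / (rnorm p ^+ 2 + 1) * rnorm p ^+ 2)); first by rewrite ler_wpM2r.
by rewrite mulrAC ler_pdivrMr; [rewrite ler_wpM2l//; lra|lra].
Qed.

End Dilation.

(** * The operators f(rT) for r < 1 *)

Section DilationLimit.
Variables (R : realType) (H : completeNormedModType (Cplx R)).
Variable dot : {dot H for (@Num.conj (Cplx R))}.
Hypothesis Hdot : hilbert_norm dot.
Local Notation C := (Cplx R).
Implicit Types (x y z : H) (r s e : R) (a : nat -> C).

Lemma rnorm_lim_le (u : nat -> H) (l c : H) (B : R) : u @ \oo --> l ->
  (exists N, forall n, (N <= n)%N -> rnorm (u n - c) <= B) -> rnorm (l - c) <= B.
Proof.
move=> /cvg_rnormP ul [N HN]; apply/ler_addgt0Pr => e e0.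
have [M _ HM] := ul e e0.
have h1 := HM (maxn N M) (leq_maxr _ _); have h2 := HN (maxn N M) (leq_maxl _ _).
by apply: le_trans (rdistD (u (maxn N M)) _ _) _; rewrite addrC lerD.
Qed.

Variable T : {linear H -> H}.
Hypothesis cT : forall x, rnorm (T x) <= rnorm x.
Local Notation psum := (psum T).

Lemma coef_le a M k x : bounded_symbol a M -> rnorm (a k) * rnorm x <= M * rnorm x.
Proof.
move=> aM; have M0 := aM.1; have := coef_l2 Hdot k.+1 x aM.
rewrite big_ord_recr/= => h.
rewrite -ler_sqr ?nnegrE ?mulr_ge0 ?rnorm_ge0// !exprMn; apply: le_trans h.
by rewrite lerDr; apply: sumr_ge0 => i _; rewrite mulr_ge0// sqr_ge0.
Qed.

Lemma psum_cvg a M r x : bounded_symbol a M -> 0 <= r -> r < 1 ->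
  cvg ((fun N => psum a r N x) @ \oo).
Proof.
move=> aM r0 r1; have M0 := aM.1.
pose u n := \sum_(k < n) M * rnorm x * r ^+ k.
have um n : u n <= u n.+1.
  by rewrite /u big_ord_recr/= lerDl !mulr_ge0 ?exprn_ge0 ?rnorm_ge0.
have uB n : u n <= M * rnorm x / (1 - r).
  rewrite ler_pdivlMr; last by lra.
  have E : (\sum_(k < n) r ^+ k) * (1 - r) = 1 - r ^+ n.
    by rewrite -[RHS]opprB subrX1; ring.
  rewrite /u -mulr_sumr -(mulrA (M * rnorm x)) E -[leRHS]mulr1 ler_wpM2l ?mulr_ge0 ?rnorm_ge0//.
  by have := exprn_ge0 n r0; lra.
have diff N n : (N <= n)%N -> rnorm (psum a r n x - psum a r N x) <= u n - u N.
  move=> /subnKC <-; elim: (n - N)%N => [|k IH]; first by rewrite addn0 !subrr rnorm0.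
  rewrite addnS /psum /u !big_ord_recr/= -/(psum _ _ _ _) -/(u _).
  rewrite addrAC; apply: le_trans (rnormD _ _) _; rewrite [leRHS]addrAC; apply: lerD => //.
  rewrite rnormZ rnormM rnormX rnormr (ger0_norm r0).
  apply: (@le_trans _ _ (rnorm (a (N + k)%N) * rnorm x * r ^+ (N + k))).
    rewrite [leRHS]mulrAC; apply: ler_wpM2l; last exact: iter_contr.
    by rewrite mulr_ge0 ?exprn_ge0 ?rnorm_ge0.
  by rewrite ler_wpM2r ?exprn_ge0// (coef_le _ _ aM).
apply: cauchy_rnorm_cvg => e e0.
have e2 : 0 < e / 2 by lra.
have [N HN] := nondecreasing_cauchy um uB e2.
exists [set n | (N <= n)%N]; first by exists N.
move=> n m /= Nn Nm; apply: le_trans (rdistD (psum a r N x) _ _) _.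
rewrite [rnorm (_ - psum a r m x)]rdistC.
have := le_trans (diff _ _ Nn) (HN _ Nn); have := le_trans (diff _ _ Nm) (HN _ Nm); lra.
Qed.

(** This is [dilated_calculus] with the coefficient sequence as a parameter, so that it can be
    applied to a shifted symbol. *)
Definition dil a r x : H := limn (fun N => psum a r N x).

Section Symbol.
Variables (a : nat -> C) (M : R).
Hypothesis aM : bounded_symbol a M.
Variable r : R.
Hypotheses (r4 : 1 / 4 <= r) (r1 : r < 1).

Let r0 : 0 <= r. Proof. by apply: le_trans r4; lra. Qed.

Lemma psum_dil x : (fun N => psum a r N x) @ \oo --> dil a r x.
Proof. exact: psum_cvg aM r0 r1. Qed.

Lemma dil_lin (c : C) x y : dil a r (c *: x + y) = c *: dil a r x + dil a r y.
Proof.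
apply: cvg_lim => //; under eq_fun do rewrite psum_lin.
by apply: cvgD; [apply: cvgZl_tmp; exact: psum_dil|exact: psum_dil].
Qed.

Lemma dil_le x : rnorm (dil a r x) <= M * rnorm x.
Proof.
rewrite -[dil a r x]subr0; apply: (rnorm_lim_le (@psum_dil x)).
have [N0 H0] := psum_le Hdot cT aM r4 r1.
by exists N0 => N /H0 h; rewrite subr0.
Qed.

Lemma dil_T x : dil a r (T x) = T (dil a r x).
Proof.
apply: cvg_lim => //; under eq_fun do rewrite psum_T.
apply/cvg_rnormP => e e0; have /cvg_rnormP /(_ e e0) := @psum_dil x.
by apply: filterS => N; apply: le_trans; rewrite -linearB.
Qed.

(** It recovers f(rT)x from the shifted symbol applied at T x, which is how convergence at T x is
    carried back to x. *)
Lemma dil_shift x : dil a r x = a 0%N *: x + r%:C *: dil (shift a) r (T x).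
Proof.
have aS := bounded_symbol_shift aM.
have /cvg_rnormP h := psum_cvg (x := T x) aS r0 r1.
apply: cvg_lim => //; apply/cvg_rnormP => e e0.
have [N _ HN] := h e e0; exists N.+1 => // -[//|n] /= nN.
rewrite psum_shift opprD addrACA subrr add0r -scalerBr rnormZ rnormr ger0_norm//.
apply: (@le_trans _ _ (1 * e)); last by rewrite mul1r.
by apply: ler_pM; rewrite ?rnorm_ge0// ?(ltW r1)//; exact: HN.
Qed.

Lemma dil_psum_le K (B : R) x : (forall N, (K <= N)%N -> rnorm (psum a r N x - psum a r K x) <= B) ->
  rnorm (dil a r x - psum a r K x) <= B.
Proof. by move=> h; apply: (rnorm_lim_le (@psum_dil x)); exists K. Qed.

End Symbol.
End DilationLimit.

(** * Convergence of f(rT) as r increases to 1, and weak decay of the powers of T *)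

Section Calculus.
Variables (R : realType) (H : completeNormedModType (Cplx R)).
Variable dot : {dot H for (@Num.conj (Cplx R))}.
Hypothesis Hdot : hilbert_norm dot.
Local Notation C := (Cplx R).
Local Notation ip := (ip dot).
Implicit Types (x y z : H) (r s e : R) (a : nat -> C).

Variable T : {linear H -> H}.
Hypothesis cT : Defs.contraction T.
Hypothesis cnuT : completely_nonunitary dot T.
Local Notation Ts := (adjoint dot T).
Local Notation dil := (dil T).
Local Notation psum := (psum T).

Let cT' : forall x, rnorm (T x) <= rnorm x := contrT cT.

Lemma ip_suml (I : Type) (s : seq I) (F : I -> H) z :
  ip (\sum_(i <- s) F i) z = \sum_(i <- s) ip (F i) z.
Proof.
elim: s => [|i s IH]; first by rewrite !big_nil ip0l.
by rewrite !big_cons ipDl IH.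
Qed.

Lemma ip_iter_adj k x z : ip (iter k T x) z = ip x (iter k Ts z).
Proof. by elim: k x z => [//|k IH] x z; rewrite iterS (ip_adj Hdot cT) IH iterSr. Qed.

(** Positivity of P = 1 - T Ts at w - u gives 2 <P w, u> <= <P w, w> + <P u, u>, and <P w, w> <=
    |w|^2, where w = c y. *)
Lemma ip_defect (c : C) y u :
  ip (c *: (y - T (Ts y))) u <= (rnorm c ^+ 2 * rnorm y ^+ 2 + defect Ts u) / 2.
Proof.
pose w := c *: y.
have -> : c *: (y - T (Ts y)) = w - T (Ts w).
  by rewrite /w (adjZ Hdot cT) linZ scalerBr.
have := defect_ge0 (contrTs Hdot cT (w - u)).
have TsB : Ts (w - u) = Ts w - Ts u.
  by rewrite (adjD Hdot cT) -scaleN1r (adjZ Hdot cT (-1)) scaleN1r.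
rewrite /defect TsB !(rnormB_sqr Hdot) ipBl (ip_adj Hdot cT).
have -> : rnorm w ^+ 2 = rnorm c ^+ 2 * rnorm y ^+ 2 by rewrite rnormZ exprMn.
by have := sqr_ge0 (rnorm (Ts w)); lra.
Qed.

(* The sum is paired with itself: the defects of Ts along its orbit telescope. *)
Lemma defect_range_sum (b : nat -> C) n y :
  rnorm (\sum_(k < n) b k *: iter k T (y - T (Ts y))) ^+ 2 <=
  \sum_(k < n) rnorm (b k) ^+ 2 * rnorm y ^+ 2.
Proof.
set z := \sum_(k < n) _; set B := \sum_(k < n) _.
have : rnorm z ^+ 2 <= \sum_(k < n) (rnorm (b k) ^+ 2 * rnorm y ^+ 2 + defect Ts (iter k Ts z)) / 2.
  have E u : ip z u = \sum_(k < n) ip (b k *: iter k T (y - T (Ts y))) u by rewrite ip_suml.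
  rewrite -(ipxx Hdot z) E; apply: ler_sum => k _.
  rewrite -(iterZ T) ip_iter_adj; exact: ip_defect.
rewrite -mulr_suml big_split/= defect_telescope -/B.
by have := sqr_ge0 (rnorm (iter n Ts z)); lra.
Qed.

(** The Cauchy criterion for r increasing to 1. It is linear and closed in x without any limit being
    named. *)
Definition good a x := forall e, 0 < e -> exists2 d, d < 1 &
  forall r s, d <= r -> r < 1 -> d <= s -> s < 1 -> rnorm (dil a r x - dil a s x) <= e.

Lemma good_lin a M (c : C) x y : bounded_symbol a M -> good a x -> good a y -> good a (c *: x + y).
Proof.
move=> aM gx gy e e0.
have c0 : 0 < rnorm c + 1 by rewrite ltr_wpDl ?rnorm_ge0.
have h1 : 0 < e / 2 / (rnorm c + 1) by rewrite !divr_gt0.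
have h2 : 0 < e / 2 by lra.
have [d1 d11 H1] := gx _ h1; have [d2 d21 H2] := gy _ h2.
exists (Num.max (1 / 2) (Num.max d1 d2)); first by rewrite !gt_max d11 d21; lra.
move=> r s; rewrite !ge_max => /and3P[r2 rd1 rd2] r1 /and3P[s2 sd1 sd2] s1.
rewrite !(dil_lin Hdot cT' aM)//; try lra.
rewrite opprD addrACA -scalerBr; apply: le_trans (rnormD _ _) _; rewrite rnormZ.
have := H1 _ _ rd1 r1 sd1 s1; have := H2 _ _ rd2 r1 sd2 s1 => k2.
rewrite ler_pdivlMr// => k1.
have : rnorm c * rnorm (dil a r x - dil a s x) <= rnorm (dil a r x - dil a s x) * (rnorm c + 1).
  by rewrite [leRHS]mulrC ler_wpM2r ?rnorm_ge0//; lra.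
lra.
Qed.

Lemma good_zero a M : bounded_symbol a M -> good a 0.
Proof.
move=> aM e e0; exists (1 / 2); first lra.
have d0 r : 1 / 4 <= r -> r < 1 -> dil a r 0 = 0.
  move=> r4 r1; apply/eqP; rewrite -rnorm_eq0 eq_le rnorm_ge0 andbT.
  by apply: le_trans (dil_le Hdot cT' aM r4 r1 0) _; rewrite rnorm0 mulr0.
by move=> r s *; rewrite !d0 ?subrr ?rnorm0 ?ltW//; lra.
Qed.

(** By [dil_le] the operators f(rT) are bounded uniformly in r, so an approximation of x serves all
    r at once. *)
Lemma good_closed a M x : bounded_symbol a M ->
  (forall e, 0 < e -> exists2 y, good a y & rnorm (y - x) <= e) -> good a x.
Proof.
move=> aM Hx e e0; have M0 := aM.1.
have h : 0 < e / (3 * (M + 1)) by rewrite divr_gt0//; lra.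
have [y gy yx] := Hx _ h.
have e3 : 0 < e / 3 by lra.
have third : e / 3 + e / 3 + e / 3 = e by field.
have [d d1 Hd] := gy _ e3.
exists (Num.max (1 / 2) d); first by rewrite gt_max d1; lra.
move=> r s; rewrite !ge_max => /andP[r2 rd] r1 /andP[s2 sd] s1.
have near t : 1 / 4 <= t -> t < 1 -> rnorm (dil a t y - dil a t x) <= e / 3.
  move=> t4 t1.
  have -> : dil a t y - dil a t x = dil a t (-1 *: x + y).
    by rewrite (dil_lin Hdot cT' aM t4 t1) scaleN1r addrC.
  apply: le_trans (dil_le Hdot cT' aM t4 t1 _) _.
  rewrite scaleN1r addrC; apply: (@le_trans _ _ ((M + 1) * (e / (3 * (M + 1))))).
    by apply: ler_pM; rewrite ?rnorm_ge0//; lra.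
  by rewrite le_eqVlt; apply/orP; left; apply/eqP; field; rewrite lt0r_neq0//; lra.
have r4 : 1 / 4 <= r by lra.
have s4 : 1 / 4 <= s by lra.
have k1 := near r r4 r1; have k2 := near s s4 s1; have k3 := Hd r s rd r1 sd s1.
apply: le_trans (rdist3 (dil a r y) (dil a s y) _ _) _.
by apply: le_trans (lerD (lerD k1 k3) k2) _; rewrite third.
Qed.

Lemma good_T a M x : bounded_symbol a M -> good a x -> good a (T x).
Proof.
move=> aM gx e e0; have [d d1 Hd] := gx e e0.
exists (Num.max (1 / 2) d); first by rewrite gt_max d1; lra.
move=> r s; rewrite !ge_max => /andP[r2 rd] r1 /andP[s2 sd] s1.
rewrite !(dil_T Hdot cT' aM)//; try lra.
by rewrite -linearB; apply: le_trans (cT' _) _; exact: Hd.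
Qed.

Lemma good_shift a M x : bounded_symbol a M -> good (shift a) (T x) -> good a x.
Proof.
move=> aM gx e e0; have aS := bounded_symbol_shift aM; set M' := 2 * _ in aS.
have M0 := aS.1.
have e2 : 0 < e / 2 by lra.
have [d d1 Hd] := gx _ e2.
pose K := M' * rnorm (T x); have K0 : 0 <= K by rewrite mulr_ge0 ?rnorm_ge0.
have h0 : 0 < e / 2 / (K + 1) by rewrite divr_gt0//; lra.
exists (Num.max (1 / 2) (Num.max d (1 - e / 2 / (K + 1)))); first by rewrite !gt_max d1; lra.
move=> r s; rewrite !ge_max => /and3P[r2 rd rh] r1 /and3P[s2 sd sh] s1.
have r4 : 1 / 4 <= r by lra.
have s4 : 1 / 4 <= s by lra.
rewrite (dil_shift Hdot cT' aM r4 r1) (dil_shift Hdot cT' aM s4 s1).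
set p := dil (shift a) r (T x); set q := dil (shift a) s (T x).
have -> : a 0%N *: x + r%:C *: p - (a 0%N *: x + s%:C *: q) = r%:C *: (p - q) + (r - s)%:C *: q.
  by rewrite opprD addrACA subrr add0r scalerBr rmorphB scalerBl addrA subrK.
apply: le_trans (rnormD _ _) _; rewrite !rnormZ !rnormr ger0_norm; last by lra.
have k1 : r * rnorm (p - q) <= 1 * (e / 2).
  by apply: ler_pM; rewrite ?rnorm_ge0 ?(ltW r1)//; [lra|exact: Hd].
have k2 : `|r - s| * rnorm q <= e / 2 / (K + 1) * (K + 1).
  apply: ler_pM; rewrite ?rnorm_ge0//; first by rewrite ler_norml; apply/andP; split; lra.
  by apply: le_trans (dil_le Hdot cT' aS s4 s1 _) _; rewrite -/K; lra.
apply: le_trans (lerD k1 k2) _; rewrite mul1r divfK ?lt0r_neq0 ?ltr_wpDl//.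
by rewrite -splitr.
Qed.

Lemma pow_near1_lt n e : 0 < e -> exists2 d, d < 1 & forall r, d <= r -> r < 1 ->
  forall k, (k < n)%N -> `|r ^+ k - 1| <= e.
Proof.
move=> e0; elim: n => [|n [d1 d11 H1]]; first by exists 0.
have [d2 d21 H2] := @pow_near1 R n _ e0.
exists (Num.max d1 d2); first by rewrite gt_max d11.
move=> r; rewrite ge_max => /andP[r1 r2] r11 k; rewrite ltnS leq_eqVlt => /predU1P[->|kn].
  exact: H2.
exact: H1.
Qed.

(** By [defect_range_sum] the tail of the series is controlled by the tail of sum |a_k|^2, uniformly
    in r; what remains is a polynomial in r, continuous at r = 1. *)
Lemma good_defect_range a M y : bounded_symbol a M -> good a (y - T (Ts y)).
Proof.
move=> aM e e0; set v := y - T (Ts y).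
pose u n := \sum_(k < n) rnorm (a k) ^+ 2 * rnorm y ^+ 2.
have um n : u n <= u n.+1 by rewrite /u big_ord_recr/= lerDl mulr_ge0// sqr_ge0.
have uB n : u n <= M ^+ 2 * rnorm y ^+ 2 by exact: (coef_l2 Hdot).
(* Each of the two radii costs one [e'] for the tail and one for the polynomial part, hence 4 e' <=
   e in total. *)
pose e' := e / 6; have e'0 : 0 < e' by rewrite divr_gt0.
have e2 : 0 < e' ^+ 2 by rewrite exprn_gt0.
have [K HK] := nondecreasing_cauchy um uB e2.
have tail r N : 0 <= r -> r < 1 -> (K <= N)%N -> rnorm (psum a r N v - psum a r K v) <= e'.
  move=> r0 r1 KN.
  rewrite -ler_sqr ?nnegrE ?rnorm_ge0 ?(ltW e'0)//; apply: le_trans (HK N KN).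
  (* With the first [K] coefficients set to 0, the tail becomes a full sum to which
     [defect_range_sum] applies. *)
  pose b k : C := if (k < K)%N then 0 else a k * r%:C ^+ k.
  have -> : psum a r N v - psum a r K v = \sum_(k < N) b k *: iter k T v.
    rewrite /psum -(subnKC KN) !big_split_ord/= [X in _ = X + _]big1 ?add0r; last first.
      by move=> i _; rewrite /b ltn_ord scale0r.
    rewrite [X in X - _]addrC addrK.
    by apply: eq_bigr => i _; rewrite /b ltnNge leq_addr.
  apply: le_trans (defect_range_sum b N y) _.
  rewrite /u -(subnKC KN) !big_split_ord/= [X in X + _ <= _]big1 ?add0r; last first.
    by move=> i _; rewrite /b ltn_ord rnorm0 expr0n/= mul0r.
  rewrite [X in X - _]addrC addrK; apply: ler_sum => i _; rewrite /b ltnNge leq_addr/=.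
  apply: ler_wpM2r; first exact: sqr_ge0.
  rewrite lerXn2r ?nnegrE ?rnorm_ge0// rnormM rnormX rnormr ger0_norm//.
  by rewrite ler_piMr ?rnorm_ge0// exprn_ile1// ltW.
pose P := \sum_(k < K) rnorm (a k *: iter k T v).
have P0 : 0 <= P by apply: sumr_ge0 => i _; exact: rnorm_ge0.
have h : 0 < e' / (P + 1) by rewrite divr_gt0// ltr_wpDl.
have [d d1 Hd] := pow_near1_lt K h.
have poly r : d <= r -> r < 1 -> rnorm (psum a r K v - psum a 1 K v) <= e'.
  move=> rd r1; rewrite /psum -sumrB.
  apply: le_trans (rnorm_sum _ _ _) _.
  apply: (@le_trans _ _ (\sum_(k < K) e' / (P + 1) * rnorm (a k *: iter k T v))).
    apply: ler_sum => k _.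
    have -> : (a k * r%:C ^+ k) *: iter k T v - (a k * 1%:C ^+ k) *: iter k T v =
       (r ^+ k - 1)%:C *: (a k *: iter k T v).
      by rewrite -scalerBl scalerA rmorphB rmorphXn rmorph1/= expr1n; congr (_ *: _); ring.
    rewrite [leLHS]rnormZ rnormr; apply: ler_wpM2r; first exact: rnorm_ge0.
    exact: Hd.
  rewrite -mulr_sumr -/P mulrAC ler_pdivrMr; last by lra.
  by rewrite ler_wpM2l ?(ltW e'0)//; lra.
exists (Num.max (1 / 2) d); first by rewrite gt_max d1; lra.
move=> r s; rewrite !ge_max => /andP[r2 rd] r1 /andP[s2 sd] s1.
have near t : 1 / 2 <= t -> d <= t -> t < 1 -> rnorm (dil a t v - psum a 1 K v) <= e' + e'.
  move=> t2 td t1; have t4 : 1 / 4 <= t by lra.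
  apply: le_trans (rdistD (psum a t K v) _ _) _; apply: lerD; last exact: poly.
  apply: (dil_psum_le Hdot cT' aM t4 t1) => N KN; apply: tail => //; lra.
have e6 : e' + e' + (e' + e') <= e by rewrite /e'; lra.
have k1 := near r r2 rd r1; have k2 := near s s2 sd s1; rewrite rdistC in k2.
by apply: le_trans (rdistD (psum a 1 K v) _ _) _; apply: le_trans (lerD k1 k2) _.
Qed.

(** The set [X] quantifies over every symbol: stability under preimages by T trades a symbol for its
    shift, so no set attached to a single symbol would do. *)
Lemma all_good x a M : bounded_symbol a M -> good a x.
Proof.
pose X := [set x | forall a M, bounded_symbol a M -> good a x].
suff : X x by apply.
apply: (cnu_ind Hdot cT (X := X) cnuT).
- split.
  + apply/closed_rnormP => z Hz b N bN; apply: (good_closed bN) => e e0.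
    by have [y Xy yz] := Hz e e0; exists y => //; exact: Xy bN.
  + by move=> b N; exact: good_zero.
  + by move=> c u v Xu Xv b N bN; apply: (good_lin c bN); [exact: Xu bN|exact: Xv bN].
- by move=> z Xz b N bN; apply: (good_T bN); exact: Xz bN.
- move=> z Xz b N bN; apply: (good_shift bN); exact: Xz (bounded_symbol_shift bN).
- by move=> y b N; exact: good_defect_range.
Qed.

Definition weakly_null (u : nat -> H) := forall z e, 0 < e ->
  exists N, forall n, (N <= n)%N -> `|ip (u n) z| <= e.

Lemma iter_lin n (c : C) y z : iter n T (c *: y + z) = c *: iter n T y + iter n T z.
Proof. by elim: n => [//|n IH] /=; rewrite IH linearP. Qed.

(** The defects are nonnegative and telescope to at most |z|^2, so they are the terms of a
    convergent series. *)
Lemma defect_iter_small z e : 0 < e ->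
  exists N, forall n, (N <= n)%N -> defect Ts (iter n Ts z) <= e.
Proof.
move=> e0; pose u n := \sum_(i < n) defect Ts (iter i Ts z).
have d0 n : 0 <= defect Ts (iter n Ts z) by apply: defect_ge0; exact: (contrTs Hdot cT).
have um n : u n <= u n.+1 by rewrite /u big_ord_recr/= lerDl.
have uB n : u n <= rnorm z ^+ 2.
  by rewrite /u defect_telescope; have := sqr_ge0 (rnorm (iter n Ts z)); lra.
have [N HN] := nondecreasing_cauchy um uB e0.
have uN n : (N <= n)%N -> u N <= u n.
  by move=> /subnKC <-; elim: (n - N)%N => [|k IH]; [rewrite addn0|rewrite addnS (le_trans IH)].
exists N => n Nn; apply: le_trans (HN n.+1 (leqW Nn)).
by rewrite /u big_ord_recr/= -/(u n) -/(u N) addrAC lerDr subr_ge0 uN.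
Qed.

(** Stability under T and under preimages only shifts the index of the sequence. On the range of 1 -
    T Ts, <T^n v, z> = <v, Ts^n z> is controlled by the defect of Ts^n z, which tends to 0. *)
Lemma iter_weakly_null x : weakly_null (fun n => iter n T x).
Proof.
pose X := [set x | weakly_null (fun n => iter n T x)].
suff : X x by [].
apply: (cnu_ind Hdot cT (X := X) cnuT).
- split.
  + apply/closed_rnormP => y Hy z e e0.
    have z0 : 0 < rnorm z + 1 by rewrite ltr_wpDl ?rnorm_ge0.
    have h : 0 < e / 2 / (rnorm z + 1) by rewrite !divr_gt0.
    have e2 : 0 < e / 2 by lra.
    have [w Xw wy] := Hy _ h; have [N HN] := Xw z _ e2.
    exists N => n /HN hn.
    have E : iter n T y = iter n T w - iter n T (w - y).
      by rewrite [w - y]addrC -(scaleN1r y) iter_lin scaleN1r opprD opprK addrCA subrr addr0.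
    rewrite E ipBl; apply: le_trans (ler_normB _ _) _.
    have : `|ip (iter n T (w - y)) z| <= e / 2.
      apply: le_trans (norm_ip_le Hdot _ _) _.
      apply: (@le_trans _ _ (e / 2 / (rnorm z + 1) * (rnorm z + 1))); last by rewrite divfK// lt0r_neq0.
      apply: ler_pM; rewrite ?rnorm_ge0//; last by rewrite lerDl.
      exact: le_trans (iter_contr cT' _ _) wy.
    by move=> h2; apply: le_trans (lerD hn h2) _; rewrite -splitr.
  + move=> z e e0; exists 0%N => n _.
    have -> : iter n T 0 = 0 by elim: n => [//|n IH] /=; rewrite IH linear0.
    by rewrite ip0l normr0 ltW.
  + move=> c u v Xu Xv z e e0.
    have e2 : 0 < e / 2 by lra.
    have [N1 H1] := Xu (Num.conj c *: z) _ e2; have [N2 H2] := Xv z _ e2.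
    exists (maxn N1 N2) => n; rewrite geq_max => /andP[/H1 h1 /H2 h2].
    rewrite iter_lin ipDl; apply: le_trans (ler_normD _ _) _.
    have -> : ip (c *: iter n T u) z = ip (iter n T u) (Num.conj c *: z).
      by rewrite /ip linearZl_LR linearZr_LR/= conjCK.
    by apply: le_trans (lerD h1 h2) _; rewrite -splitr.
- move=> y Xy z e e0; have [N HN] := Xy z e e0; exists N => n Nn.
  by rewrite -iterSr; apply: HN; exact: leqW.
- move=> y Xy z e e0; have [N HN] := Xy z e e0; exists N.+1 => -[//|n] Nn.
  by rewrite iterSr; exact: HN.
- move=> y z e e0; set v := y - T (Ts y).
  have Y0 := sqr_ge0 (rnorm y).
  have Y1 : 0 < rnorm y ^+ 2 + 1 by rewrite ltr_wpDl.
  (* [ip_defect] bounds the pairing by a constant plus a small defect. Scaling v by t makes the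
     constant quadratic in t, and it stays small after division by t; the values t and -t give both
     signs. *)
  pose t := e / (rnorm y ^+ 2 + 1); have t0 : 0 < t by rewrite divr_gt0.
  have tE : t * (rnorm y ^+ 2 + 1) = e by rewrite divfK// lt0r_neq0.
  have te : (e + e - t) / 2 <= e by lra.
  have [|N HN] := @defect_iter_small z (t * e); first by rewrite mulr_gt0.
  exists N => n /HN; rewrite ip_iter_adj; set u := iter n Ts z => du.
  have bnd (b : R) : `|b| = t -> b * ip v u <= t * e.
    move=> bt; have := ip_defect b%:C y u; rewrite -/v ipZl rnormr bt => h.
    apply: le_trans h _; apply: (@le_trans _ _ ((t ^+ 2 * rnorm y ^+ 2 + t * e) / 2)).
      by rewrite ler_wpM2r// lerD2l.
    have -> : (t ^+ 2 * rnorm y ^+ 2 + t * e) / 2 = t * ((t * (rnorm y ^+ 2 + 1) + e - t) / 2) by field.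
    by rewrite tE ler_pM2l.
  have h1 := bnd t (gtr0_norm t0); rewrite ler_pM2l// in h1.
  have := bnd (- t); rewrite normrN mulNr -mulrN ler_pM2l// => /(_ (gtr0_norm t0)) h2.
  by rewrite ler_norml h1 andbT lerNl.
Qed.

End Calculus.

(** * f(T) as a bounded operator commuting with T *)

Section FunctionOfT.
Variables (R : realType) (H : completeNormedModType (Cplx R)).
Variable dot : {dot H for (@Num.conj (Cplx R))}.
Hypothesis Hdot : hilbert_norm dot.
Local Notation C := (Cplx R).
Implicit Types (x y z : H) (r s e : R).

Variable T : {linear H -> H}.
Hypothesis cT : Defs.contraction T.
Hypothesis cnuT : completely_nonunitary dot T.
Variable f : C -> C.
Hypothesis Hf : Hinfty f.

Let cT' : forall x, rnorm (T x) <= rnorm x := contrT cT.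

Lemma taylor_symbol : exists M, bounded_symbol (taylor_coef f) M.
Proof.
have [M M0 fM] := taylor_bounded Hf; exists M; split=> // r r2 r1.
by apply: fM => //; lra.
Qed.

(** Up to conversion, [dil T (taylor_coef f)] is [dilated_calculus T f], so existence of the limit
    is enough: its value is [calculus T f x] by definition. *)
Lemma calculus_cvg x :
  dil T (taylor_coef f) r x @[r --> (1 : R)^'-] --> calculus T f x.
Proof.
have [M aM] := taylor_symbol.
have : cvg (dil T (taylor_coef f) r x @[r --> (1 : R)^'-]); last exact.
apply: cauchy_rnorm_cvg => e e0.
have [d d1 Hd] := all_good Hdot cT cnuT x aM e0.
exists [set r | d <= r < 1].
  near=> r; apply/andP; split.
    by near: r; exact: nbhs_left_ge.
  by near: r; exact: nbhs_left_lt.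
by move=> r s /andP[r1 r2] /andP[s1 s2]; exact: Hd.
Unshelve. all: by end_near. Qed.

Lemma near_left1 : \forall r \near (1 : R)^'-, 1 / 4 <= r < 1.
Proof.
near=> r; apply/andP; split.
  by near: r; apply: nbhs_left_ge; lra.
by near: r; exact: nbhs_left_lt.
Unshelve. all: by end_near. Qed.

Lemma calculus_lin (c : C) x y : calculus T f (c *: x + y) = c *: calculus T f x + calculus T f y.
Proof.
have [M aM] := taylor_symbol.
apply: cvg_lim => //.
have : c *: dil T (taylor_coef f) r x + dil T (taylor_coef f) r y @[r --> (1 : R)^'-] -->
    c *: calculus T f x + calculus T f y.
  by apply: cvgD; [apply: cvgZl_tmp; exact: calculus_cvg|exact: calculus_cvg].
apply: cvg_trans; apply: near_eq_cvg.
by apply: filterS near_left1 => r /andP[r4 r1]; apply/esym; exact: (dil_lin Hdot cT' aM r4 r1).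
Qed.

Lemma calculus_T x : calculus T f (T x) = T (calculus T f x).
Proof.
have [M aM] := taylor_symbol.
apply: cvg_lim => //; apply/cvg_rnormP => e e0.
have /cvg_rnormP /(_ e e0) := @calculus_cvg x.
apply: filterS2 near_left1 => r /andP[r4 r1].
have -> : dilated_calculus T f r (T x) = T (dil T (taylor_coef f) r x) by exact: (dil_T Hdot cT' aM).
rewrite -linearB.
exact: le_trans (cT' _).
Qed.

Lemma calculus_le : exists2 M, 0 <= M & forall x, rnorm (calculus T f x) <= M * rnorm x.
Proof.
have [M aM] := taylor_symbol; exists M; first exact: aM.1.
move=> x; apply/ler_addgt0Pr => e e0.
have /cvg_rnormP /(_ e e0) h := @calculus_cvg x.
have [r hr /andP[r4 r1]] : exists2 r, rnorm (calculus T f x - dil T (taylor_coef f) r x) <= e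
    & 1 / 4 <= r < 1.
  by near (1 : R)^'- => r; exists r; near: r; [exact: h|exact: near_left1].
have := dil_le Hdot cT' aM r4 r1 x.
have := rdistD (dil T (taylor_coef f) r x) (calculus T f x) 0; rewrite !subr0.
move=> h1 h2; apply: le_trans h1 _; rewrite addrC; exact: lerD.
Unshelve. all: by end_near. Qed.

End FunctionOfT.

(** * Compact operators *)

Section Compactness.
Variables (R : realType) (H : completeNormedModType (Cplx R)).
Local Notation C := (Cplx R).
Implicit Types (x y z : H) (r s e : R) (A B : H -> H).

Lemma unit_ballE x : (`|x| <= 1) = (rnorm x <= 1).
Proof. by rewrite rnormE -[1 in LHS]/((1 : R)%:C) lecR. Qed.

Definition totally_bounded_op A := forall e, 0 < e -> exists s : seq H,
  forall x, rnorm x <= 1 -> exists2 z, z \in s & rnorm (A x - z) <= e.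

Lemma compact_op_totally_bounded A : compact_op A -> totally_bounded_op A.
Proof.
rewrite /compact_op precompactE compact_cover => cA e e0.
set S := A @` _ in cA.
have [|x Sx|D _ HD] := cA H setT (fun z => ball z (e%:C : C)).
- by move=> z _; exact: ball_open.
- by exists x => //; apply: ballxx; rewrite ltcR.
exists (finmap.enum_fset D) => x x1.
have /HD[z /= zD zx] : closure S (A x).
  by apply: subset_closure; exists x => //=; rewrite unit_ballE.
exists z => //; rewrite rdistC.
by move: zx; rewrite -ball_normE /ball_/= rnormE ltcR => /ltW.
Qed.

Lemma totally_bounded_compact_op A : totally_bounded_op A -> compact_op A.
Proof.
move=> tA; rewrite /compact_op precompactE compact_ultra => F UF FS.
set S := A @` _ in FS.
(* An ultrafilter containing a finite union contains one of its members. *)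
have big (s : seq H) (P : H -> set H) : F [set y | exists2 z, z \in s & P z y] ->
    exists z, F (P z).
  elim: s => [|z s IH] Fs.
    by exfalso; have [y [z]] := filter_ex Fs; rewrite in_nil.
  have [Fz|Fz] := in_ultra_setVsetC (P z) UF; first by exists z.
  apply: IH; apply: filterS (filterI Fs Fz) => y [[w]]; rewrite inE => /predU1P[->//|ws Pw _].
  by exists w.
have cF : cauchy F.
  apply/cauchy_exP => _ /gt0_real_complex[e e0 ->].
  have e3 : 0 < e / 3 by lra.
  have [s Hs] := tA _ e3.
  (* One e/3 goes from a point of the closure to the image of the unit ball, another from there to
     the net. *)
  have [|z Fz] := big s (fun z => [set y | rnorm (y - z) <= 2 * (e / 3)]).
    apply: filterS FS => y /(_ [set w | rnorm (w - y) <= e / 3]).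
    case; first by apply/near_rnorm; exists (e / 3).
    move=> _ [[x /= x1 <-] xy]; have [|z zs zx] := Hs x; first by rewrite -unit_ballE.
    exists z => //=; apply: le_trans (rdistD (A x) _ _) _.
    by rewrite mulr_natl mulr2n; apply: lerD => //; rewrite rdistC.
  exists z; apply: filterS Fz => y /=; rewrite -ball_normE /ball_/= rdistC rnormE ltcR.
  by move/le_lt_trans; apply; lra.
have /cauchy_cvgP /cvg_ex[l Fl] := cF.
exists l; split=> //.
apply: (@closed_closure _ S) => B Bl.
by have [y [Sy By]] := filter_ex (filterI FS (Fl B Bl)); exists y.
Qed.

(* Colorings of the unit ball, unlike nets in the range, combine by products. *)
Definition finitely_split A e := exists (I : finType) (c : H -> I),
  forall x y, rnorm x <= 1 -> rnorm y <= 1 -> c x = c y -> rnorm (A x - A y) <= e.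

Lemma totally_bounded_split A e : totally_bounded_op A -> 0 < e -> finitely_split A e.
Proof.
move=> tA e0; have e2 : 0 < e / 2 by lra.
have [s Hs] := tA _ e2.
(* One color beyond the size of the net guarantees that [ord0] exists, as a color for the points
   outside the unit ball, even if the net is empty. *)
have /choice[c Hc] : forall x, exists i : 'I_(size s).+1, rnorm x <= 1 -> rnorm (A x - nth 0 s i) <= e / 2.
  move=> x; have [x1|x1] := boolP (rnorm x <= 1); last by exists ord0.
  have [z zs zx] := Hs x x1.
  have h : (index z s < (size s).+1)%N by rewrite ltnS index_size.
  by exists (Ordinal h) => _; rewrite /= nth_index.
exists 'I_(size s).+1, c => x y x1 y1 cxy.
have h1 := Hc x x1; have := Hc y y1; rewrite -cxy rdistC => h2.
by apply: le_trans (rdistD (nth 0 s (c x)) _ _) _; rewrite [leRHS]splitr lerD.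
Qed.

(** One point is picked in each color that occurs in the unit ball. The net then consists of values
    of A, which lets [op_norm_of_compact] use the representatives themselves. *)
Lemma split_reps A e : finitely_split A e -> exists s : seq H,
  forall x, rnorm x <= 1 -> exists2 p, p \in s & rnorm (A x - A p) <= e.
Proof.
move=> [I [c Hc]].
have /choice[p Hp] : forall i : I, exists p, forall x, rnorm x <= 1 -> c x = i -> rnorm p <= 1 /\ c p = i.
  move=> i; have [[p [p1 pi]]|n] := pselect (exists p, rnorm p <= 1 /\ c p = i).
    by exists p.
  by exists 0 => x x1 xi; exfalso; apply: n; exists x.
exists [seq p i | i <- enum I] => x x1.
have [p1 pc] := Hp (c x) x x1 erefl.
exists (p (c x)); first by apply: map_f; rewrite mem_enum.
by apply: Hc.
Qed.

Lemma split_totally_bounded A : (forall e, 0 < e -> finitely_split A e) -> totally_bounded_op A.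
Proof.
move=> sA e e0; have [s Hs] := split_reps (sA e e0).
exists [seq A p | p <- s] => x x1; have [p ps px] := Hs x x1.
by exists (A p) => //; exact: map_f.
Qed.

End Compactness.

(** * Norm decay against compactness *)

Section EssentiallyUnitary.
Variables (R : realType) (H : completeNormedModType (Cplx R)).
Variable dot : {dot H for (@Num.conj (Cplx R))}.
Hypothesis Hdot : hilbert_norm dot.
Local Notation C := (Cplx R).
Local Notation ip := (ip dot).
Implicit Types (x y z : H) (r s e K : R) (A B : H -> H).

Lemma le_op_norm A x : rnorm x <= 1 -> ((rnorm (A x))%:E <= op_norm A)%E.
Proof. by move=> x1; apply: ereal_sup_ubound; exists x => //=; rewrite unit_ballE. Qed.

Lemma op_norm_ub A e : (forall x, rnorm x <= 1 -> rnorm (A x) <= e) -> (op_norm A <= e%:E)%E.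
Proof.
move=> He; apply: ge_ereal_sup => _ [x /= x1 <-]; rewrite lee_fin.
by apply: He; rewrite -unit_ballE.
Qed.

Lemma op_norm_ge0 A : A 0 = 0 -> (0%:E <= op_norm A)%E.
Proof. by move=> A0; have := @le_op_norm A 0; rewrite A0 !rnorm0; apply; exact: ler01. Qed.

Lemma op_norm_cvg0P (A : nat -> H -> H) : (forall n, A n 0 = 0) ->
  op_norm (A n) @[n --> \oo] --> 0%:E <->
  forall e, 0 < e -> exists N, forall n, (N <= n)%N -> forall x, rnorm x <= 1 -> rnorm (A n x) <= e.
Proof.
move=> A0; split=> [cA e e0|HA].
  have : nbhs 0%:E [set u : \bar R | (u < e%:E)%E] by apply: open_ereal_lt'; rewrite lte_fin.
  move=> /cA [N _ HN]; exists N => n /HN /= h x x1.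
  by rewrite -lee_fin; apply: le_trans (le_op_norm _ x1) (ltW h).
have fin e n : (op_norm (A n) <= e%:E)%E -> op_norm (A n) = (fine (op_norm (A n)))%:E /\ 0 <= fine (op_norm (A n)) <= e.
  move=> h; have h0 := op_norm_ge0 (A0 n).
  have F : op_norm (A n) \is a fin_num.
    by rewrite ge0_fin_numE//; apply: le_lt_trans h (ltry _).
  by rewrite fineK//; split=> //; rewrite -!lee_fin fineK// h0 h.
apply/fine_cvgP; split.
  have [N HN] := HA 1 ltr01; exists N => // n /= /HN /op_norm_ub /fin [-> _].
  by [].
apply/cvgrPdist_le => e e0; have [N HN] := HA e e0.
exists N => // n /= /HN /op_norm_ub /fin [_ /andP[h1 h2]].
by rewrite sub0r normrN ger0_norm.
Qed.

Variable T : {linear H -> H}.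
Hypothesis cT : Defs.contraction T.
Hypothesis euT : essentially_unitary dot T.
Local Notation Ts := (adjoint dot T).

Definition bounded_linear A K :=
  (forall (c : C) x y, A (c *: x + y) = c *: A x + A y) /\ forall x, rnorm (A x) <= K * rnorm x.

Lemma bounded_linearB A K x y : bounded_linear A K -> A (x - y) = A x - A y.
Proof. by move=> [AL _]; rewrite addrC -scaleN1r AL scaleN1r addrC. Qed.

Lemma bounded_linearZ A K (c : C) x : bounded_linear A K -> A (c *: x) = c *: A x.
Proof.
move=> bA; have A0 : A 0 = 0 by have := bounded_linearB x x bA; rewrite !subrr.
by have := bA.1 c x 0; rewrite !addr0 A0 addr0.
Qed.

Lemma bounded_linear_T A K : bounded_linear A K -> bounded_linear (T \o A) K.
Proof.
move=> [AL AK]; split=> [c x y|x] /=; first by rewrite AL linearP.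
exact: le_trans (contrT cT _) (AK x).
Qed.

Let D x := x - Ts (T x).

Let DB x y : D (x - y) = D x - D y.
Proof.
rewrite /D linearB/= (adjD Hdot cT) -(scaleN1r (T y)) (adjZ Hdot cT (-1)) scaleN1r.
by rewrite !opprD !opprK addrACA.
Qed.

Let DZ (c : C) x : D (c *: x) = c *: D x.
Proof. by rewrite /D linZ (adjZ Hdot cT) scalerBr. Qed.

Lemma norm_sqr_defect x : rnorm x ^+ 2 = rnorm (T x) ^+ 2 + ip (D x) x.
Proof.
rewrite /D ipBl (ip_adjl Hdot cT) !(ipxx Hdot); ring.
Qed.

(** Dividing by k = |K| + 1 brings A x into the unit ball, where the compactness of D = 1 - Ts T
    applies; its coloring is pulled back along A. *)
Lemma split_comp_defect A K e : bounded_linear A K -> 0 < e -> finitely_split (D \o A) e.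
Proof.
move=> bA e0; pose k := `|K| + 1; have k0 : 0 < k by rewrite ltr_wpDl.
have h : 0 < e / k by rewrite divr_gt0.
have [I [c Hc]] := totally_bounded_split (compact_op_totally_bounded euT) h.
have AE x : A x = k%:C *: ((k^-1)%:C *: A x).
  by rewrite scalerA -rmorphM/= divff ?lt0r_neq0// scale1r.
have A1 x : rnorm x <= 1 -> rnorm ((k^-1)%:C *: A x) <= 1.
  move=> x1; rewrite rnormZ rnormr gtr0_norm ?invr_gt0// mulrC ler_pdivrMr// mul1r.
  apply: le_trans (bA.2 x) _; rewrite /k; have := rnorm_ge0 x; have := ler_norm K; have := normr_ge0 K; nra.
exists I, (fun x => c ((k^-1)%:C *: A x)) => x y x1 y1 cxy.
have := Hc _ _ (A1 x x1) (A1 y y1) cxy; rewrite ler_pdivlMr// => {}Hc.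
rewrite /= AE (AE y) !(DZ k%:C) -scalerBr rnormZ rnormr gtr0_norm// mulrC.
exact: Hc.
Qed.

(** Color x by the pair of its colors for T A and for D A. For two points of equal color and w = A
    (x - y), |w|^2 = |T w|^2 + <D w, w>, where |T w| <= e, |w| <= k and D w is small enough to fill
    the gap between e^2 and e'^2. *)
Lemma split_of_T A K e e' : bounded_linear A K -> 0 <= e -> e < e' ->
  finitely_split (T \o A) e -> finitely_split A e'.
Proof.
move=> bA e0 ee' [I [c Hc]]; pose k := 2 * (`|K| + 1).
have k0 : 0 < k by rewrite mulr_gt0// ltr_wpDl.
have ee2 : 0 < e' ^+ 2 - e ^+ 2 by nra.
have h : 0 < (e' ^+ 2 - e ^+ 2) / k by rewrite divr_gt0.
have [J [c' Hc']] := split_comp_defect bA h.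
exists (I * J)%type, (fun x => (c x, c' x)) => x y x1 y1 [cxy cxy'].
rewrite -(bounded_linearB _ _ bA); set w := A (x - y).
have h1 : rnorm (T w) <= e.
  by rewrite /w (bounded_linearB _ _ bA) linearB/=; exact: Hc.
have h2 : rnorm (D w) <= (e' ^+ 2 - e ^+ 2) / k.
  by rewrite /w (bounded_linearB _ _ bA) DB; exact: Hc'.
have h3 : rnorm w <= k.
  apply: le_trans (bA.2 _) _; have := rnormB x y; have := rnorm_ge0 (x - y).
  rewrite /k; have := ler_norm K; have := normr_ge0 K; nra.
rewrite -ler_sqr ?nnegrE ?rnorm_ge0//; last by rewrite ltW// (le_lt_trans e0).
rewrite norm_sqr_defect -[leRHS](subrKC (e ^+ 2)).
apply: lerD; first by rewrite ler_sqr ?nnegrE ?rnorm_ge0.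
apply: le_trans (ip_le Hdot _ _) _.
rewrite -[leRHS](divfK (lt0r_neq0 k0)).
by apply: ler_pM; rewrite ?rnorm_ge0.
Qed.

Lemma split_of_iter n A K e e' : bounded_linear A K -> 0 <= e -> e < e' ->
  finitely_split (iter n T \o A) e -> finitely_split A e'.
Proof.
elim: n A e e' => [|n IH] A e e' bA e0 ee' sA.
  have [I [c Hc]] := sA; exists I, c => x y x1 y1 cxy.
  by apply: le_trans (Hc x y x1 y1 cxy) (ltW ee').
(* Each removal of a T needs a strict gap, so the available gap is halved at every stage. *)
pose m := (e + e') / 2.
have em : e < m by rewrite midf_lt.
have me : m < e' by rewrite midf_lt.
apply: (split_of_T bA _ me); first by rewrite ltW// (le_lt_trans e0).
apply: (IH (T \o A) e m (bounded_linear_T bA)) => //.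
have [I [c Hc]] := sA; exists I, c => x y x1 y1 cxy.
by rewrite /= -!iterSr; exact: Hc.
Qed.

Lemma compact_of_op_norm A K : bounded_linear A K ->
  (forall e, 0 < e -> exists n, forall x, rnorm x <= 1 -> rnorm (iter n T (A x)) <= e) ->
  compact_op A.
Proof.
move=> bA HA; apply: totally_bounded_compact_op; apply: split_totally_bounded => e e0.
have e4 : 0 < e / 4 by lra.
have [n Hn] := HA _ e4.
apply: (@split_of_iter n A K (e / 2) e bA); [lra|lra|].
(* A single color suffices for T^n A, since all its values on the unit ball have norm at most
   e/4. *)
exists unit, (fun=> tt) => x y x1 y1 _ /=.
apply: le_trans (rnormB _ _) _; apply: le_trans (lerD (Hn x x1) (Hn y y1)) _; lra.
Qed.

(** With b z a net point near A u_n, |A u_n|^2 = <A u_n, b z> + <A u_n, A u_n - b z>. The first term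
    is <u_n, A^* (b z)>, small for large n simultaneously for the finitely many z; the second is at
    most k b h = e^2 / 2. *)
Lemma compact_weakly_null A K (u : nat -> H) (B : R) : bounded_linear A K -> compact_op A ->
  weakly_null dot u -> (forall n, rnorm (u n) <= B) ->
  forall e, 0 < e -> exists N, forall n, (N <= n)%N -> rnorm (A (u n)) <= e.
Proof.
move=> bA cA wu uB e e0.
have [AL AK] := bA.
have B0 : 0 <= B by apply: le_trans (uB 0%N); exact: rnorm_ge0.
pose b := B + 1; have b0 : 0 < b by rewrite ltr_wpDl.
pose k := (`|K| + 1) * b; have k0 : 0 < k by rewrite mulr_gt0// ltr_wpDl.
pose h := e ^+ 2 / (2 * k * b).
have h0 : 0 < h by rewrite divr_gt0 ?exprn_gt0// !mulr_gt0.
have [s Hs] := compact_op_totally_bounded cA h0.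
have AD x y : A (x + y) = A x + A y by have := AL 1 x y; rewrite !scale1r.
have AZ (c : C) x : A (c *: x) = c *: A x := bounded_linearZ c x bA.
have e2 : 0 < e ^+ 2 / 2 by rewrite divr_gt0// exprn_gt0.
have [N HN] : exists N, forall n, (N <= n)%N -> forall z, z \in s -> ip (A (u n)) (b%:C *: z) <= e ^+ 2 / 2.
  elim: s {Hs} => [|z s [N1 H1]]; first by exists 0%N.
  have [N2 H2] := wu (adjoint dot A (b%:C *: z)) _ e2.
  exists (maxn N1 N2) => n; rewrite geq_max => /andP[n1 n2] w; rewrite inE => /predU1P[->|ws].
    by rewrite (ip_adjoint Hdot AD AZ AK); apply: le_trans (ler_norm _) (H2 n n2).
  exact: H1.
exists N => n Nn.
have ub : rnorm ((b^-1)%:C *: u n) <= 1.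
  rewrite rnormZ rnormr gtr0_norm ?invr_gt0// mulrC ler_pdivrMr// mul1r.
  by apply: le_trans (uB n) _; rewrite lerDl.
have [z zs zu] := Hs _ ub; have hz := HN n Nn z zs.
have AuE : A (u n) = b%:C *: A ((b^-1)%:C *: u n).
  by rewrite -AZ scalerA -rmorphM/= divff ?lt0r_neq0// scale1r.
have Auk : rnorm (A (u n)) <= k.
  apply: le_trans (AK _) _; apply: (@le_trans _ _ ((`|K| + 1) * rnorm (u n))).
    by rewrite ler_wpM2r ?rnorm_ge0//; have := ler_norm K; lra.
  by rewrite ler_wpM2l//; apply: le_trans (uB n) _; rewrite lerDl.
have diff : rnorm (A (u n) - b%:C *: z) <= b * h.
  by rewrite AuE -scalerBr rnormZ rnormr gtr0_norm// ler_wpM2l// ltW.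
rewrite -ler_sqr ?nnegrE ?rnorm_ge0 ?(ltW e0)// -(ipxx Hdot (A (u n))).
have -> : ip (A (u n)) (A (u n)) = ip (A (u n)) (b%:C *: z) + ip (A (u n)) (A (u n) - b%:C *: z).
  by rewrite -ipDr addrC subrK.
rewrite [leRHS]splitr; apply: lerD => //; apply: le_trans (ip_le Hdot _ _) _.
have -> : e ^+ 2 / 2 = k * (b * h) by rewrite /h; field; rewrite !lt0r_neq0.
by apply: ler_pM; rewrite ?rnorm_ge0.
Qed.

(* T^n A x = A T^n x, and A is compact while T^n x is weakly null. *)
Lemma op_norm_of_compact A K : completely_nonunitary dot T -> bounded_linear A K ->
  (forall x, A (T x) = T (A x)) -> compact_op A ->
  forall e, 0 < e -> exists N, forall n, (N <= n)%N -> forall x, rnorm x <= 1 -> rnorm (iter n T (A x)) <= e.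
Proof.
move=> cnuT bA AT cA e e0.
have AiterT n x : iter n T (A x) = A (iter n T x).
  by elim: n => [//|n IH] /=; rewrite IH AT.
have e2 : 0 < e / 2 by lra.
(* Finitely many representatives p have to be handled. Since T^n is a contraction, the error e/2
   made in replacing A x by A p does not grow with n. *)
have [s Hs] := split_reps (totally_bounded_split (compact_op_totally_bounded cA) e2).
have [N HN] : exists N, forall n, (N <= n)%N -> forall p, p \in s -> rnorm (iter n T (A p)) <= e / 2.
  elim: s {Hs} => [|p s [N1 H1]]; first by exists 0%N.
  have wp : weakly_null dot (fun n => iter n T p) by exact: (iter_weakly_null Hdot cT cnuT).
  have bp n : rnorm (iter n T p) <= rnorm p by exact: (iter_contr (contrT cT)).
  have [N2 H2] := compact_weakly_null bA cA wp bp e2.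
  exists (maxn N1 N2) => n; rewrite geq_max => /andP[n1 n2] q; rewrite inE => /predU1P[->|qs].
    by rewrite AiterT; exact: H2.
  exact: H1.
exists N => n Nn x x1; have [p ps px] := Hs x x1.
rewrite [leRHS]splitr.
have := rdistD (iter n T (A p)) (iter n T (A x)) 0; rewrite !subr0 => h.
apply: le_trans h _; apply: lerD; last exact: HN.
have -> : iter n T (A x) - iter n T (A p) = iter n T (A x - A p).
  by elim: n {Nn} => [//|n IH] /=; rewrite -linearB IH.
exact: le_trans (iter_contr (contrT cT) _ _) px.
Qed.

End EssentiallyUnitary.

Theorem theorem3p4 (R : realType) (H : completeNormedModType (Cplx R))
    (dot : {dot H for (@Num.conj (Cplx R))}) (Hdot : hilbert_norm dot)
    (Hsep : separable H)
    (T : {linear H -> H}) (HC0 : C0_contraction dot T)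
    (Heu : essentially_unitary dot T)
    (f : Cplx R -> Cplx R) (Hf : Hinfty f) :
  op_norm (fun x => iter n T (calculus T f x)) @[n --> \oo] --> 0%:E
  <-> compact_op (calculus T f).
Proof.
have [cT cnuT _] := HC0.
have [K K0 AK] := calculus_le Hdot cT cnuT Hf.
have bA : bounded_linear (calculus T f) K.
  by split=> // c x y; exact: (calculus_lin Hdot cT cnuT Hf).
have A0 n : iter n T (calculus T f 0) = 0.
  have -> : calculus T f 0 = 0 by have := bounded_linearB 0 0 bA; rewrite !subrr.
  by elim: n => [//|n IH] /=; rewrite IH linear0.
split.
  move=> /(op_norm_cvg0P A0) h; apply: (compact_of_op_norm Hdot cT Heu bA) => e e0.
  by have [N HN] := h e e0; exists N; exact: HN.
move=> cA; apply/(op_norm_cvg0P A0) => e e0.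
by apply: (op_norm_of_compact Hdot cT cnuT bA) => // x; exact: (calculus_T Hdot cT cnuT Hf).
Qed.
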